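(* Let $\pi=1\pi'\in S_n$, where $\pi'$ is a dominant permutation of $\{2,\ldots,n\}$. Then the canonical reduced form of $m[T(\pi)]$ at $\beta=-1$, evaluated by substituting $$x_{ij}=\frac{1}{x_{\phi_{ij}(i)}-y_{\phi_{ij}(j)}+x_{\phi_{ij}(i)}y_{\phi_{ij}(j)}}$$ for each variable $x_{ij}$ with $(i,j)_T\in R(\pi)$ (i.e. for each tree label $(i,j)$ of a box of $R(\pi)$), satisfies $$\mathrm{Crf}^{\beta=-1}_{T(\pi)}\Big(x_{ij}=\tfrac{1}{x_{\phi_{ij}(i)}-y_{\phi_{ij}(j)}+x_{\phi_{ij}(i)}y_{\phi_{ij}(j)}}\Big)=\Big(\prod_{(i,j)_T\in R(\pi)}\frac{1}{x_{\phi_{ij}(i)}-y_{\phi_{ij}(j)}+x_{\phi_{ij}(i)}y_{\phi_{ij}(j)}}\Big)\,\mathfrak{G}_{\pi}(\mathbf{x},\mathbf{y}).$$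
   Context: Permutations and diagrams. A permutation $\pi\in S_n$ is written in one-line notation $\pi_1\cdots\pi_n$. Positions in the $n\times n$ grid are (row, column), rows numbered top to bottom and columns left to right. The diagram of $\pi$ is $D(\pi)=\{(\pi_j,i): i<j,\ \pi_i>\pi_j\}$. $\pi=1\pi'$ with $\pi'$ dominant means $\pi_1=1$ and $\pi'=\pi_2\cdots\pi_n$ is a $132$-avoiding permutation of $\{2,\ldots,n\}$; equivalently $D(\pi)$ is the Young diagram of a partition whose north-west most box is at $(2,2)$. Pipe dreams. A pipe dream for $w\in S_n$ is a tiling of the $n\times n$ grid by crosses (two strands cross straight) and elbows (one strand joins the left edge to the top edge, another joins the bottom edge to the right edge) such that all tiles at $(a,b)$ with $a+b\ge n+1$ are elbows, and if the strands entering from the left in rows $1,\ldots,n$ are labelled $1,\ldots,n$ and followed (ignoring second crossings among the same strands), they exit at the top reading $w_1,\ldots,w_n$ from left to right. It is reduced if no two strands cross twice. $PD(w)$ is the simplicial complex with vertices the entries $(a,b)$, $a+b\le n$, and facets the sets of elbow positions (in this triangle) of reduced pipe dreams for $w$. $\mathrm{Pipes}(w)$ is the set of all pipe dreams of $w$, reduced and nonreduced; for $P\in\mathrm{Pipes}(w)$, $F(P)$ is the (interior) face of $PD(w)$ given by the elbow positions of $P$. Double Grothendieck polynomial. With $\mathbf{x}=(x_1,\ldots,x_{n-1})$, $\mathbf{y}=(y_1,\ldots,y_{n-1})$, $\mathfrak{G}_w(\mathbf{x},\mathbf{y})=\sum_{P\in\mathrm{Pipes}(w)}(-1)^{\mathrm{codim}_{PD(w)}F(P)}\prod_{(i,j)\in\mathrm{cross}(P)}(x_i-y_j+x_iy_j)$,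 where $\mathrm{cross}(P)$ is the set of positions (row $i$, column $j$) of the crosses of $P$. The region $R(\pi)$. The bottom reduced pipe dream of $\pi$ has crosses at the boxes obtained by pushing $D(\pi)$ left (left-justifying each row); the top reduced pipe dream has crosses at the boxes obtained by pushing $D(\pi)$ up. The core region $\mathrm{cr}(\pi)$ is the union of the cross positions of these two pipe dreams, and $R(\pi)=\mathrm{cr}(\pi)\cup\{(1,1)\}$. The tree $T(\pi)$. Traverse the southeast boundary of $R(\pi)$ from its SW corner to its NE corner as a sequence of east steps (E) and north steps (N). Let $A$ consist of all N steps together with those E steps such that E bounds the bottom reduced pipe dream (the box of $R(\pi)$ directly above E is a cross of it) but the N step directly preceding E (if the preceding step is an N step) does not bound it (the box directly left of that N step is not a cross of it). Label the steps of $A$ by $1,\ldots,m$ in the order traversed; an E step not in $A$ receives the label of the N step directly preceding it. Place a dot in each box of $R(\pi)$ that is an elbow in the bottom reduced pipe dream, then let the dots in each column drop south so that they occupy the lowest boxes of that column of $R(\pi)$. $T(\pi)$ is the (noncrossing) tree on $[m]$ with an edge $(i,j)$, $i<j$, whenever there is a dot in the box in the column of the E step labelled $i$ and the row of the N step labelled $j$. Tree labels and $\phi$. A box of $R(\pi)$ has tree label $(i,j)$, written $(i,j)_T$, if the E step of the boundary below it (in its column) is labelled $i$ and the N step of the boundary to its right (in its row) is labelled $j$. The tree labels of the boxes of $R(\pi)$ are exactly the edges of the directed transitive closure of $T(\pi)$ ($T(\pi)$ together with all $(i,j)$ joined by an increasing path in $T(\pi)$), and only variables $x_{ij}$ with such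 $(i,j)$ occur in reduced forms of $m[T(\pi)]$. The map $\phi$ sends the tree label $(i,j)$ of a box to its conventional label $(\phi_{ij}(i),\phi_{ij}(j))=(\text{row},\text{column})$. On the right-hand side of the substitution, $x_{\phi_{ij}(i)}$ and $y_{\phi_{ij}(j)}$ are the singly indexed variables of $\mathbf{x},\mathbf{y}$. Canonical reduced form. The subdivision algebra is the commutative algebra over $\mathbb{Q}[\beta]$ generated by $x_{ij}$, $1\le i<j\le m$, subject to $x_{ij}x_{jk}=x_{ik}(x_{ij}+x_{jk}+\beta)$ for $i<j<k$. A reduced form of a monomial is a polynomial obtained by successively substituting $x_{ik}(x_{ij}+x_{jk}+\beta)$ in place of an occurrence of $x_{ij}x_{jk}$ ($i<j<k$), on each monomial separately, until no further reduction is possible. For a noncrossing tree $T$ (no edges $(i,k),(j,l)$ with $i<j<k<l$), $m[T]=\prod_{(i,j)\in E(T),\,i<j}x_{ij}$, and the canonical reduced form $\mathrm{Crf}_T(x_{ij})$ is the reduced form of $m[T]$ obtained by performing the reductions from front to back (or back to front) along the vertices $1,2,\ldots,m$, always on the topmost edges: at a vertex $j$ having both an edge $(i,j)$ with $i<j$ and an edge $(j,k)$ with $j<k$, the pair with $i$ smallest and $k$ largest is reduced. $\mathrm{Crf}^{\beta=-1}_T$ denotes it with $\beta=-1$. *)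

(* Defs.v *)
From HB Require Import structures.
From mathcomp Require Import all_boot all_order all_fingroup all_algebra.
From mathcomp Require Import mpoly.

Set Implicit Arguments.
Unset Strict Implicit.
Unset Printing Implicit Defensive.

Import GRing.Theory.
Local Open Scope ring_scope.

(* All rows, columns, positions, values and tree vertices are numbered from 0,
   so the box (row a, column b) of the paper is (a - 1, b - 1) here, and
   a + b <= n becomes (a + b).+1 < n. *)

Definition box (n : nat) : Type := ('I_n * 'I_n)%type.

Section Permutations.
Variables (n : nat) (w : 'S_n).

(* w = 1 w' where w' avoids 132 *)
Definition one_dominant : Prop :=
  (forall i : 'I_n, i = 0%N :> nat -> w i = 0%N :> nat) /\
  (forall i j k : 'I_n, (0 < i)%N -> (i < j)%N -> (j < k)%N ->
     ~~ ((w i < w k)%N && (w k < w j)%N)).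

Definition diagram : {set box n} :=
  [set c : box n | [exists j, [&& w j == c.1, (c.2 < j)%N & (w j < w c.2)%N]]].

(* The diagram with each row pushed to the left, resp. each column pushed up. *)
Definition bottom_pd : {set box n} :=
  [set c : box n | (c.2 < #|[set b | (c.1, b) \in diagram]|)%N].

Definition top_pd : {set box n} :=
  [set c : box n | (c.1 < #|[set a | (a, c.2) \in diagram]|)%N].

Definition core_region : {set box n} := bottom_pd :|: top_pd.

Definition region : {set box n} :=
  core_region :|: [set c : box n | (c.1 == 0%N :> nat) && (c.2 == 0%N :> nat)].

End Permutations.

Section PipeDreams.
Variable n : nat.

Definition triangle : {set box n} := [set c : box n | ((c.1 + c.2).+1 < n)%N].

(* A tiling is given by its set of crosses.  [None] labels the strands that
   enter through the bottom edge of the grid; they never reach the triangle. *)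
Definition strand : Type := option 'I_n.

(* The tiles are visited row by row from the bottom, each row from left to
   right; every strand moves only right and up, so its tiles are visited in the
   order in which it runs through them.  In a state (h, v, log), h is the strand
   entering the current tile from the left, v b is the strand travelling upwards
   in column b, and log lists the pairs of strands that have crossed so far.  If
   [ign] holds, a cross where two strands meet that have already crossed is
   treated as an elbow. *)
Definition trace_tile (ign : bool) (P : {set box n})
    (s : strand * {ffun 'I_n -> strand} * seq {set strand}) (c : box n) :
    strand * {ffun 'I_n -> strand} * seq {set strand} :=
  let: (h, v, log) := s in
  let pq := [set h; v c.2] in
  if (c \in P) && ~~ (ign && (pq \in log)) then (h, v, pq :: log)
  else (v c.2, [ffun b => if b == c.2 then h else v b], log).

Definition trace_row (ign : bool) (P : {set box n})
    (s : {ffun 'I_n -> strand} * seq {set strand}) (a : 'I_n) :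
    {ffun 'I_n -> strand} * seq {set strand} :=
  let: (h, v, log) :=
    foldl (trace_tile ign P) (Some a, s.1, s.2) [seq (a, b) | b <- enum 'I_n] in
  (v, log).

Definition trace (ign : bool) (P : {set box n}) :
    {ffun 'I_n -> strand} * seq {set strand} :=
  foldl (trace_row ign P) ([ffun=> None], [::]) (rev (enum 'I_n)).

Definition reduced_pd (P : {set box n}) : bool := uniq (trace false P).2.

Definition Pipes (w : 'S_n) : {set {set box n}} :=
  [set P : {set box n} | (P \subset triangle) &&
     [forall b, (trace true P).1 b == Some (w b)]].

Definition elbows (P : {set box n}) : {set box n} := triangle :\: P.

Definition PD (w : 'S_n) : {set {set box n}} :=
  [set F : {set box n} |
     [exists P in Pipes w, reduced_pd P && (F \subset elbows P)]].

(* dim PD(w) - dim F; both dimensions are a cardinality minus 1 *)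
Definition codimPD (w : 'S_n) (F : {set box n}) : nat :=
  ((\max_(G in PD w) #|G|) - #|F|)%N.

(* x_i is the i-th and y_j the (n + j)-th variable.  The last x and the last y
   never occur for n > 1, since every box used below lies in the triangle; for
   n = 1 they are needed because the region is then the box (0, 0). *)
Definition xvar (i : 'I_n) : {mpoly rat[n + n]} := 'X_(lshift n i).
Definition yvar (j : 'I_n) : {mpoly rat[n + n]} := 'X_(rshift n j).

Definition weight (c : box n) : {mpoly rat[n + n]} :=
  xvar c.1 - yvar c.2 + xvar c.1 * yvar c.2.

Definition double_grothendieck (w : 'S_n) : {mpoly rat[n + n]} :=
  \sum_(P in Pipes w) (-1) ^+ codimPD w (elbows P) * \prod_(c in P) weight c.

End PipeDreams.

Notation ratfun n := {fraction {mpoly rat[n + n]}}.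

Section Tree.
Variables (n : nat) (w : 'S_n).

Let R := region w.

Definition row_length (a : 'I_n) : nat := #|[set b | (a, b) \in R]|.
Definition col_height (b : 'I_n) : nat := #|[set a | (a, b) \in R]|.

(* [inl b] is the east step below column b, [inr a] the north step to the right
   of row a. *)
Definition bstep : Type := ('I_n + 'I_n)%type.

(* When w is 1 followed by a dominant permutation, R is a Young diagram.  The
   east steps just before the north step of row a are those of the columns that
   end in row a. *)
Definition boundary : seq bstep :=
  flatten [seq [seq inl b | b <- enum 'I_n & col_height b == a.+1]
                 ++ [:: inr a]
          | a : 'I_n <- rev (enum 'I_n) & (0 < row_length a)%N].

(* The box of R adjacent to the step is a cross of the bottom pipe dream. *)
Definition bounds_bottom (s : bstep) : bool :=
  match s with
  | inl b => [exists a : 'I_n,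
                (a.+1 == col_height b) && ((a, b) \in bottom_pd w)]
  | inr a => [exists b : 'I_n,
                (b.+1 == row_length a) && ((a, b) \in bottom_pd w)]
  end.

(* An east step outside A takes its label from the north step before it, so the
   first step is put into A.  This matters only for the identity, where R is a
   single box: in all other cases the first step bounds the bottom pipe dream. *)
Fixpoint inA_rec (prev : option bstep) (s : seq bstep) : seq bool :=
  if s is st :: s' then
    (match st, prev with
     | inr _, _ | inl _, None => true
     | inl _, Some (inl _) => bounds_bottom st
     | inl _, Some (inr a) => bounds_bottom st && ~~ bounds_bottom (inr a)
     end) :: inA_rec (Some st) s'
  else [::].

Definition inA : seq bool := inA_rec None boundary.

Definition tree_size : nat := count id inA.

(* Label of the k-th step: the number of earlier steps in A if it is in A, and
   the label of the preceding step (a north step, hence in A) otherwise. *)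
Definition step_label (k : nat) : nat :=
  count id (take (if nth false inA k then k else k.-1) inA).

Definition tree_label (c : box n) : nat * nat :=
  (step_label (index (inl c.2) boundary), step_label (index (inr c.1) boundary)).

Definition dots : {set box n} := R :\: bottom_pd w.

(* The dots after they have dropped to the lowest boxes of their columns. *)
Definition dropped_dots : {set box n} :=
  [set c in R | (#|[set a : 'I_n | ((c.1 < a)%N) && ((a, c.2) \in R)]|
                 < #|[set a | (a, c.2) \in dots]|)%N].

Definition tree : {set 'I_tree_size * 'I_tree_size} :=
  [set e : 'I_tree_size * 'I_tree_size |
     [exists c in dropped_dots, tree_label c == (e.1 : nat, e.2 : nat)]].

(* The box of R with tree label (i, j), if there is one. *)
Definition phi (i j : 'I_tree_size) : option (box n) :=
  [pick c in R | tree_label c == (i : nat, j : nat)].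

End Tree.

Section SubdivisionAlgebra.
Variable m : nat.

(* The variable x_ij is indexed by [mxvec_index i j], so an assignment of values
   to the variables is the vectorisation [mxvec] of an m x m matrix.  Only the
   variables with i < j are ever used. *)
Local Notation E i j := (mxvec_index i j).

Definition beta : {poly rat} := 'X.

Definition tree_monomial (T : {set 'I_m * 'I_m}) : {mpoly {poly rat}[m * m]} :=
  \prod_(e in T | (e.1 < e.2)%N) 'X_(E e.1 e.2).

Definition in_nbrs (M : 'X_{1..m * m}) (j : 'I_m) : {set 'I_m} :=
  [set i : 'I_m | (i < j)%N && (0 < M (E i j))%N].

Definition out_nbrs (M : 'X_{1..m * m}) (j : 'I_m) : {set 'I_m} :=
  [set k : 'I_m | (j < k)%N && (0 < M (E j k))%N].

Definition topmost (M : 'X_{1..m * m}) (j : 'I_m) : option ('I_m * 'I_m) :=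
  [pick p : 'I_m * 'I_m |
     [&& p.1 \in in_nbrs M j, p.2 \in out_nbrs M j,
         [forall i in in_nbrs M j, (p.1 <= i)%N]
       & [forall k in out_nbrs M j, (k <= p.2)%N]]].

(* x_ij x_jk is replaced by x_ik (x_ij + x_jk + beta).  Each reduction at j
   lowers the number of factors involving j, so [mdeg M] rounds are enough to
   make M irreducible at j. *)
Fixpoint reduce_monomial (fuel : nat) (j : 'I_m) (M : 'X_{1..m * m}) :
    {mpoly {poly rat}[m * m]} :=
  match fuel, topmost M j with
  | f.+1, Some (i, k) =>
      let N := (M - U_(E i j) - U_(E j k) + U_(E i k))%MM in
      reduce_monomial f j (N + U_(E i j))%MM
      + reduce_monomial f j (N + U_(E j k))%MM
      + beta *: reduce_monomial f j N
  | _, _ => 'X_[M]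
  end.

Definition reduce_at (p : {mpoly {poly rat}[m * m]}) (j : 'I_m) :
    {mpoly {poly rat}[m * m]} :=
  \sum_(M <- msupp p) p@_M *: reduce_monomial (mdeg M) j M.

(* From front to back, or from back to front if [back] holds. *)
Definition Crf (back : bool) (T : {set 'I_m * 'I_m}) :
    {mpoly {poly rat}[m * m]} :=
  foldl reduce_at (tree_monomial T)
        (if back then rev (enum 'I_m) else enum 'I_m).

Definition Crf_beta (b : rat) (back : bool) (T : {set 'I_m * 'I_m}) :
    {mpoly rat[m * m]} :=
  map_mpoly (horner_eval b) (Crf back T).

End SubdivisionAlgebra.

Definition eval_sd (n m : nat) (v : 'M[ratfun n]_m)
    (p : {mpoly rat[m * m]}) : ratfun n :=
  mmap (fun c : rat => tofrac c%:MP) (fun k => mxvec v 0 k) p.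

(* The variables x_ij such that (i, j) is not the tree label of a box of the
   region keep an arbitrary value z i j; they do not occur in the canonical
   reduced form. *)
Definition tree_subst (n : nat) (w : 'S_n)
    (z : 'M[ratfun n]_(tree_size w)) :
    'M[ratfun n]_(tree_size w) :=
  \matrix_(i, j) if phi i j is Some c then (tofrac (weight c))^-1 else z i j.

(* Main.v *)
(** After the substitution [x_ij = 1 / t_c] at [beta = -1], put [y_c = - 1 / t_c].
    Multiplying each side by a sign turns the reduction rule into the rule with all
    coefficients equal to 1, and turns the Grothendieck sum into the sum over all
    pipe dreams of the product of [y_c] over the boxes [c] of the region that are
    not crosses.  Both are then computed by the same recursion [Zsum] over the rows.

    Pipe dreams: after the rows below a given one, what matters is the set [L] of
    columns whose strand is not yet the final one, and the set of columns of [L] in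
    which a cross would be ignored because the strands have crossed before.  In row
    [a] the crosses are then forced except for the column [c] of [L] in which the
    strand [a] turns up, and for repeated crossings to the right of [c], which can
    be chosen freely.

    Tree: reductions at two different vertices commute (a diamond argument, by
    induction on the number of edges at these vertices), so that both orders give
    the same value.  From front to back, the vertices that matter belong to corners
    of the region.  At a corner the edges form a hook (a row meeting a column), its
    reduction is a sum over Delannoy paths, and these sums telescope to [Zsum].

    A pipe dream [P] of [pi] has codimension [#|P| - #|D(pi)|], as each inversion
    needs a cross and the bottom pipe dream has no others; this matches the signs. *)

From HB Require Import structures.
Require Import Defs.
From mathcomp Require Import all_boot all_order all_fingroup all_algebra.
From mathcomp Require Import mpoly ssrcomplements bigenough.
From mathcomp Require Import zify ring.

Set Implicit Arguments.
Unset Strict Implicit.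
Unset Printing Implicit Defensive.

Import GRing.Theory.

(** * One row of a pipe dream *)

(** Two facts make a common recursion possible. Strands never move left, and a pair that has crossed
    stays crossed; so a row that puts two strands against the order of their targets can never be
    repaired. For a dominant permutation this leaves so little freedom that the arrangement of the
    strands can be forgotten and only sets of columns remain. A column with an ignored cross
    receives its final strand in that same row. The choice of using such a cross can therefore be
    moved back to the row in which the column became available, and this is the origin of the two
    summands of [Zsum]. On the tree side, acyclicity keeps every monomial squarefree, so that
    monomials are sets of edges, and an edge is a box of the region. The obstacle is that a corner
    treats all rows of one length at once, whereas [Zsum] treats one row at a time. The two sums are
    thus not compared term by term but block by block, each block of rows of equal length being a
    transfer from its lowest row to the row above it. *)

Section Row.
Implicit Types (u : nat -> nat) (C L D : pred nat) (a b c k : nat).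

(* Arrangements of strands are infinite sequences, with the strands entering
   through the bottom edge of the grid numbered from [n] on.  Row [a] with crosses
   [C] receives [u] from below; [carry a C u b] enters its column [b] from the left
   and [row_out a C u b] leaves it at the top.  Two strands have crossed before
   exactly when the larger one is on the left. *)
Fixpoint carry a C u b : nat :=
  if b is b'.+1 then
    let h := carry a C u b' in if C b' && (h < u b') then h else u b'
  else a.

Definition row_out a C u b : nat :=
  let h := carry a C u b in if C b && (h < u b) then u b else h.

Lemma carryS a C u b : carry a C u b.+1 =
  if C b && (carry a C u b < u b) then carry a C u b else u b.
Proof. by []. Qed.

Lemma carry_lands a C u N b : (forall i, C i -> i < N) ->
  exists2 y, b <= y & row_out a C u y = carry a C u b.
Proof.
move=> CN; have [d] := ubnP (N - b); elim: d b => // d IH b ltd.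
case: (boolP (C b && (carry a C u b < u b))) => [/andP[Cb lt]|nC].
  have [|y by_ E] := IH b.+1; first by have := CN b Cb; lia.
  by exists y; [exact: ltnW | rewrite E carryS Cb lt].
by exists b => //; rewrite /row_out (negPf nC).
Qed.

Lemma strand_lands a C u N x : (forall i, C i -> i < N) ->
  exists2 y, x <= y & row_out a C u y = u x.
Proof.
move=> CN; case: (boolP (C x && (carry a C u x < u x))) => nC.
  by exists x => //; rewrite /row_out nC.
have [y xy E] := carry_lands a u x.+1 CN; exists y; first exact: ltnW.
by rewrite E carryS (negPf nC).
Qed.

(** A cross with the larger strand on the left counts as an elbow. So if the strand [u x] travels as
    far as column [y], it turns up there and sends [u y] further right; the order of the pair is
    kept. *)
Lemma inversion_persists a C u N x y : (forall i, C i -> i < N) ->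
  x < y -> u y < u x ->
  exists x' y', [/\ x' < y', row_out a C u x' = u x & row_out a C u y' = u y].
Proof.
move=> CN xy inv.
case: (boolP (C x && (carry a C u x < u x))) => nC.
  have [y' yy' E] := strand_lands a u y CN.
  by exists x, y'; split=> //; [exact: leq_trans xy yy' | rewrite /row_out nC].
have P z : x < z -> z <= y -> (exists x', [/\ x' < z & row_out a C u x' = u x])
    \/ carry a C u z = u x.
  elim: z => // z IH xz zy; rewrite carryS.
  have [E|xz'] := eqVneq x z; first by right; rewrite -E (negPf nC).
  have [||[x' [lt E]]|E] := IH; [by lia | by lia | by left; exists x'; split=> //; lia |].
  rewrite E; case: (boolP (C z && (u x < u z))) => nCz; first by right.
  by left; exists z; split=> //; rewrite /row_out E (negPf nCz).
have [[x' [lt E]]|E] := P y xy (leqnn y).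
  have [y' yy' E'] := strand_lands a u y CN.
  by exists x', y'; split=> //; exact: leq_trans lt yy'.
have [y' yy' E'] := carry_lands a u y.+1 CN.
have nCy : C y && (carry a C u y < u y) = false by rewrite E; case: (C y); lia.
exists y, y'; split=> //; first by rewrite /row_out nCy.
by rewrite E' carryS nCy.
Qed.

(** The column of [L] whose strand comes next to column [b] from the left. The value 0 at the end of
    the search lies in [L] for every state. *)
Fixpoint prev L b : nat := if b is b'.+1 then if L b' then b' else prev L b' else 0.

Lemma prev_spec L b : L 0 -> 0 < b ->
  [/\ L (prev L b), prev L b < b & forall x, L x -> x < b -> x <= prev L b].
Proof.
move=> L0; elim: b => // b IH _ /=; case: (boolP (L b)) => Lb; first by split.
have b0 : 0 < b by case: b Lb {IH} => [|//]; rewrite L0.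
have [H1 H2 H3] := IH b0; split=> //; first exact: ltnW.
move=> x Lx; rewrite ltnS leq_eqVlt => /orP[/eqP E|]; last exact: H3.
by rewrite -E Lx in Lb.
Qed.

Lemma prev_uniq L b p : L 0 -> 0 < b -> L p -> p < b ->
  (forall x, L x -> x < b -> x <= p) -> prev L b = p.
Proof.
move=> L0 b0 Lp pb H; have [H1 H2 H3] := prev_spec L0 b0.
by apply/eqP; rewrite eqn_leq H // H3.
Qed.

End Row.

(** * Rows that can still lead to the target permutation *)

Section Target.
Variables (w pos lam : nat -> nat).
Hypotheses (wK : cancel w pos) (posK : cancel pos w) (w0 : w 0 = 0)
  (diagE : forall a b, (b < pos a) && (a < w b) = (0 < b <= lam a))
  (lam_mono : forall a, 0 < a -> lam a.+1 <= lam a).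
Implicit Types (u : nat -> nat) (C L D S : pred nat) (a b c k : nat).

(* The arrangements that can enter row [k.-1] from below: [L] is the set of columns
   whose strand is not yet the final one, [D] the set of those columns of [L] where
   the strands have crossed already, so that a cross is ignored. *)
Record state k L D u : Prop := State {
  st0 : L 0;
  st_far : forall i, lam k < i -> L i;
  st_D : forall i, D i -> L i /\ i <= lam k;
  st_settled : forall i, ~~ L i -> u i = w i;
  st_inj : injective u;
  st_ge : forall i, k <= u i;
  st_surj : forall v, k <= v -> exists i, u i = v;
  st_order : forall i j, L i -> L j -> i < j -> pos (u i) < pos (u j);
  st_right : forall i, L i -> i < pos (u i);
  st_settled_gt : forall e, ~~ L e -> u (prev L e) < u e;
  st_D_inv : forall e, L e -> 0 < e -> D e -> u e < u (prev L e);
  st_nD : forall e, L e -> 0 < e -> ~~ D e -> u (prev L e) < u e }.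

Definition row_crosses c L S : pred nat := fun i => [|| i < c, ~~ L i | S i].

Definition valid a L D C : Prop := exists c S,
  [/\ L c, c <= lam a, (forall i, S i -> D i /\ c < i) & C =1 row_crosses c L S].

(** Right of [c] each column of [L] up to [lam a] receives the strand of the column of [L] before
    it, which is its final strand; so these columns leave [L]. Column [c] now holds [a], the
    smallest strand present; whatever comes to it from the left has crossed it, so [c] joins [D]. *)
Definition next_L a c L : pred nat := fun i => L i && (i <= c) || (lam a < i).
Definition next_D c D : pred nat := fun i => D i && (i < c) || (i == c).

Section Step.
Variables (a : nat) (L D : pred nat) (u : nat -> nat).
Hypothesis st : state a.+1 L D u.
Let L0 := st0 st.

(** Let [d] be the column of the strand with target [c]; it lies in [L] and left of [c]. If [d] came
    before [p = prev L c], the induction hypothesis would put a strand with target [p < c] in a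
    column of [L] at or after [d], against the increasing order of targets. *)
Lemma prev_target t c : (forall p, 0 < p -> p <= t -> a < w p) ->
  L c -> 0 < c -> c <= t -> pos (u (prev L c)) = c.
Proof.
move=> ht; have [n] := ubnP c; elim: n c => // n IH c ltn Lc c0 ct.
have [d Ed] := st_surj st (ht c c0 ct).
have pd : pos (u d) = c by rewrite Ed wK.
have Ld : L d.
  apply: contraT => nLd; have := st_settled st nLd => E.
  by rewrite E wK in pd; rewrite -pd (negPf nLd) in Lc.
have dc : d < c by rewrite -[X in _ < X]pd; exact: (st_right st).
have [Lp pc maxp] := prev_spec L0 c0.
have dp := maxp d Ld dc.
have [->//|ne] := eqVneq (prev L c) d.
set p := prev L c in Lp pc maxp dp ne *.
have p0 : 0 < p by lia.
have Ep : pos (u (prev L p)) = p by apply: IH => //; lia.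
have [Lq qp maxq] := prev_spec L0 p0.
have dq : d <= prev L p by apply: maxq => //; lia.
have : pos (u d) <= pos (u (prev L p)).
  move: dq; rewrite leq_eqVlt => /orP[/eqP->//|dq].
  by apply/ltnW/(st_order st).
lia.
Qed.

Lemma prev_target_lam c : L c -> 0 < c -> c <= lam a -> pos (u (prev L c)) = c.
Proof.
apply: prev_target => p p0 pl.
by have := diagE a p; rewrite p0 pl /= => /andP[].
Qed.

(** A target up to [lam a] would be a column of [L] further right, against the choice of [q]. A
    target beyond [lam a] but before [pos a] would give row [a] of the diagram an additional box,
    because the strand is larger than [a]. *)
Lemma last_target : let q := prev L (lam a).+1 in
  lam a < pos (u q) /\ pos a < pos (u q).
Proof.
move=> q; have [Lq qle maxq] := prev_spec L0 (ltn0Sn (lam a)).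
have H1 : lam a < pos (u q).
  rewrite ltnNge; apply/negP => le.
  set p := pos (u q) in le; have qp : q < p := st_right st Lq.
  have Lp : L p.
    apply: contraT => /(st_settled st); rewrite /p posK => /(st_inj st) E.
    by move: qp; rewrite /p E ltnn.
  by have := maxq p Lp; rewrite ltnS le => /(_ isT); rewrite leqNgt qp.
split=> //; rewrite ltnNge leq_eqVlt; apply/negP => /orP[/eqP E|lt].
  have := congr1 w E; rewrite !posK => Eq.
  by have := st_ge st q; rewrite Eq ltnn.
have := diagE a (pos (u q)); rewrite lt posK (st_ge st) /=; lia.
Qed.

Variables (c : nat) (S : pred nat).
Hypotheses (Lc : L c) (cl : c <= lam a) (SD : forall i, S i -> D i /\ c < i).
Let C := row_crosses c L S.

(** Up to [c] all crosses are real, since [a] is the smallest strand. Afterwards the carried strand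
    crosses the settled columns, whose strands are larger, and is exchanged in every column of [L]:
    a cross from [S] is ignored, that pair being inverted already. *)
Lemma valid_carry b : carry a C u b = if b <= c then a else u (prev L b).
Proof.
elim: b => // b IH; rewrite carryS IH.
have [bc|] := ltnP b c; first by rewrite (ltnW bc) /C /row_crosses bc /= (st_ge st).
rewrite leq_eqVlt => /orP[/eqP Ec|cb].
  have -> : C b = false.
    rewrite /C /row_crosses -Ec ltnn Lc /=; apply/negP => /SD[_]; by rewrite ltnn.
  by rewrite -Ec leqnn /= Lc.
rewrite (leqNgt b c) cb /=.
case: (boolP (L b)) => Lb; last first.
  by rewrite /C /row_crosses Lb orbT /= (st_settled_gt st).
case: (boolP (C b)) => //= Cb; case: ifP => // lt.
have Sb : S b by move: Cb; rewrite /C /row_crosses ltnNge (ltnW cb) Lb.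
have [Db _] := SD Sb.
have := st_D_inv st Lb (leq_ltn_trans (leq0n c) cb) Db; lia.
Qed.

Lemma valid_row_out b : row_out a C u b =
  if b < c then u b else if b == c then a else if L b then u (prev L b) else u b.
Proof.
rewrite /row_out valid_carry.
have [bc|] := ltnP b c; first by rewrite (ltnW bc) /C /row_crosses bc /= (st_ge st).
rewrite leq_eqVlt => /orP[/eqP Ec|cb].
  have -> : C b = false.
    rewrite /C /row_crosses -Ec ltnn Lc /=; apply/negP => /SD[_]; by rewrite ltnn.
  by rewrite -Ec eqxx leqnn.
rewrite (gtn_eqF cb) (leqNgt b c) cb /=.
case: (boolP (L b)) => Lb; last by rewrite /C /row_crosses Lb orbT /= (st_settled_gt st).
case: (boolP (C b)) => //= Cb; case: ifP => // lt.
have Sb : S b by move: Cb; rewrite /C /row_crosses ltnNge (ltnW cb) Lb.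
have [Db _] := SD Sb.
have := st_D_inv st Lb (leq_ltn_trans (leq0n c) cb) Db; lia.
Qed.

(** Row 0 of the diagram is empty, which forces [c] to be 0. Every column [p > 0] has [w p > 0], so
    [prev_target] applies to all columns of [L] and not only to those up to [lam a]. *)
Lemma valid_final b : a = 0 -> row_out a C u b = w b.
Proof.
move=> a0; have c0 : c = 0.
  have := diagE 0 (lam 0); rewrite -[X in _ < pos X]w0 wK /=.
  by rewrite leqnn andbT -a0; lia.
rewrite valid_row_out c0 /= a0; case: eqP => [->//|/eqP b0].
have pb : 0 < b by lia.
case: (boolP (L b)) => Lb; last by apply: (st_settled st).
have H : pos (u (prev L b)) = b.
  apply: (@prev_target b) => // p p0 _; rewrite a0 lt0n; apply/eqP => E.
  by have := congr1 pos E; rewrite wK -w0 wK => E'; rewrite E' in p0.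
by rewrite -[in RHS]H posK.
Qed.

(** Along the new [L] the targets increase: left of [c] they are at most [c], then comes [pos a],
    which exceeds [lam a], and by [last_target] the strands moved into the columns beyond [lam a]
    have targets larger than [pos a]. *)
Lemma valid_state : 0 < a -> state a (next_L a c L) (next_D c D) (row_out a C u).
Proof.
move=> a0; have mono := lam_mono a0.
have [qlam qpos] := last_target; set q := prev L (lam a).+1 in qlam qpos.
have [Lq qle maxq] := prev_spec L0 (ltn0Sn (lam a)); rewrite -/q in Lq qle maxq.
have posa : lam a < pos a.
  have [l0|l0] := posnP (lam a).
    by rewrite l0 lt0n; apply/eqP => E; have := congr1 w E; rewrite posK w0; lia.
  by have := diagE a (lam a); rewrite l0 leqnn /= => /andP[].
have out := valid_row_out.
have far i : lam a < i -> L i by move=> li; apply: (st_far st); lia.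
have far_out i : lam a < i -> row_out a C u i = u (prev L i).
  by move=> li; rewrite out far // (gtn_eqF (leq_ltn_trans cl li)) ltnNge (ltnW (leq_ltn_trans cl li)).
have far_prev i : lam a < i -> [/\ L (prev L i), q <= prev L i & prev L i < i].
  move=> li; have [H1 H2 H3] := prev_spec L0 (leq_ltn_trans (leq0n _) li).
  by split=> //; apply: H3 => //; lia.
have far_pos i : lam a < i -> pos (u q) <= pos (u (prev L i)).
  move=> li; have [H1 H2 H3] := far_prev i li.
  move: H2; rewrite leq_eqVlt => /orP[/eqP->//|H2].
  by apply/ltnW/(st_order st).
have old_pos i : L i -> i < c -> pos (u i) <= c.
  move=> Li ic; have c0 : 0 < c by lia.
  have [H1 H2 H3] := prev_spec L0 c0; have := H3 i Li ic.
  rewrite -[X in _ -> _ <= X](prev_target_lam Lc c0 cl) leq_eqVlt.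
  by move=> /orP[/eqP->//|lt]; apply/ltnW/(st_order st).
have nLE i : next_L a c L i = false -> i <= lam a /\ (L i -> c < i).
  by rewrite /next_L; case: (L i) => /= H; split; lia.
have out_c : row_out a C u c = a by rewrite out ltnn eqxx.
have out_gt i : i != c -> a < row_out a C u i.
  by move=> ic; rewrite out (negPf ic); do 2?case: ifP => _; apply: (st_ge st).
have prevE i : i <= c -> 0 < i -> prev (next_L a c L) i = prev L i.
  move=> ic i0; have [H1 H2 H3] := prev_spec L0 i0.
  apply: prev_uniq => //; rewrite /next_L.
  - by rewrite L0.
  - by rewrite H1; apply/orP; left; lia.
  - by move=> x /orP[/andP[Lx _]|lx] xi; [exact: H3 | lia].
have prev_gt i : c < i -> i <= (lam a).+1 -> prev (next_L a c L) i = c.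
  move=> ci il; apply: prev_uniq; rewrite /next_L ?L0 ?Lc ?leqnn //; lia.
have prev_far i : lam a < i -> prev (next_L a c L) i.+1 = i /\ prev L i.+1 = i.
  by move=> li /=; rewrite /next_L li orbT far.
split.
- by rewrite /next_L L0.
- by move=> i li; rewrite /next_L li orbT.
- move=> i; rewrite /next_D /next_L => /orP[/andP[/(st_D st)[Li _] ic]|/eqP->].
    by rewrite Li (ltnW ic); split=> //; lia.
  by rewrite Lc leqnn.
- move=> i /negbTE/nLE[il Lci]; rewrite out.
  have [ic|ci] := ltnP i c.
    by apply: (st_settled st); apply/negP => /Lci; lia.
  have [E|ne] := eqVneq i c; first by move: (Lci); rewrite E Lc ltnn => /(_ isT).
  case: (boolP (L i)) => Li; last by apply: (st_settled st).
  have i0 : 0 < i by lia.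
  by rewrite -[in RHS](prev_target_lam Li i0 il) posK.
- move=> i j; rewrite !out.
  have prevc x : c < x -> L (prev L x) /\ c <= prev L x < x.
    move=> cx; have [H1 H2 H3] := prev_spec L0 (leq_ltn_trans (leq0n _) cx).
    by split=> //; rewrite H2 andbT H3.
  have prevI x y : c < x -> c < y -> L x -> L y -> prev L x = prev L y -> x = y.
    move=> cx cy Lx Ly E.
    have [H1 H2 H3] := prev_spec L0 (leq_ltn_trans (leq0n _) cx).
    have [H1' H2' H3'] := prev_spec L0 (leq_ltn_trans (leq0n _) cy).
    case: (ltngtP x y) => // xy; first by have := H3' x Lx xy; lia.
    by have := H3 y Ly xy; lia.
  have ne x : a <> u x by move=> E; have := st_ge st x; lia.
  case: (ltngtP i c) => [ic|ci|Ei]; case: (ltngtP j c) => [jc|cj|Ej].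
  + exact: (st_inj st).
  + case: (boolP (L j)) => Lj /(st_inj st) // E; have [] := prevc j cj; lia.
  + by move/esym/ne.
  + case: (boolP (L i)) => Li /(st_inj st) // E; have [] := prevc i ci; lia.
  + case: (boolP (L i)) => Li; case: (boolP (L j)) => Lj /(st_inj st) //.
    * exact: prevI.
    * by move=> E; have [] := prevc i ci; rewrite E (negPf Lj).
    * by move=> E; have [] := prevc j cj; rewrite -E (negPf Li).
  + by case: ifP => _ /esym/ne.
  + by move/ne.
  + by case: ifP => _ /ne.
  + by rewrite Ei Ej.
- move=> i; have [->|ne] := eqVneq i c; first by rewrite out_c.
  by apply: ltnW; apply: out_gt.
- move=> v; rewrite leq_eqVlt => /orP[/eqP<-|av]; first by exists c.
  have [x Ex] := st_surj st av.
  have [xc|cx] := ltnP x c; first by exists x; rewrite out xc.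
  case: (boolP (L x)) => Lx; last first.
    exists x; rewrite out ltnNge cx (negPf Lx) /=.
    by case: eqP => [E|//]; rewrite E Lc in Lx.
  (* Everything beyond [lam a] is in [L], so a next column of [L] exists; the strand of column [x]
     moves there. *)
  have ex : exists y, L y && (x < y).
    by exists (maxn x (lam a)).+1; rewrite far ?ltnS ?leq_maxl ?leq_maxr.
  case: (ex_minnP ex) => y /andP[Ly xy] miny.
  exists y; rewrite out ltnNge (ltnW (leq_ltn_trans cx xy)) /=.
  rewrite (gtn_eqF (leq_ltn_trans cx xy)) Ly -Ex; congr u.
  apply: prev_uniq => //; first by lia.
  by move=> z Lz zy; rewrite leqNgt; apply/negP => xz; have := miny z; rewrite Lz xz; lia.
- move=> i j; rewrite /next_L.
  have oldi x y : L x -> x <= c -> lam a < y -> pos (row_out a C u x) < pos (row_out a C u y).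
    move=> Lx xc ly; rewrite (far_out y ly).
    apply: leq_trans (far_pos y ly).
    have [->|ne] := eqVneq x c; first by rewrite out_c.
    have xc' : x < c by lia.
    by rewrite out xc'; apply: leq_ltn_trans (old_pos x Lx xc') _; lia.
  move=> /orP[/andP[Li ic]|li] /orP[/andP[Lj jc]|lj] ij.
  + have ic' : i < c by lia.
    rewrite out ic'; move: jc; rewrite leq_eqVlt => /orP[/eqP->|jc].
      by rewrite out_c; apply: leq_ltn_trans (old_pos i Li ic') _; lia.
    by rewrite out jc; apply: (st_order st).
  + exact: oldi.
  + lia.
  + rewrite !far_out //; have [H1 H2 H3] := far_prev i li; have [H1' H2' H3'] := far_prev j lj.
    apply: (st_order st) => //; have [_ _ mx] := prev_spec L0 (leq_ltn_trans (leq0n _) lj).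
    by apply: leq_trans H3 _; apply: mx => //; apply: far.
- move=> i; rewrite /next_L => /orP[/andP[Li ic]|li].
    move: ic; rewrite leq_eqVlt => /orP[/eqP->|ic]; first by rewrite out_c; lia.
    by rewrite out ic; apply: (st_right st).
  rewrite far_out //; elim: i li => // i IH; rewrite ltnS leq_eqVlt => /orP[/eqP E|li].
    by rewrite -E; have := far_pos (lam a).+1 (ltnSn _); lia.
  have [_ ->] := prev_far i li.
  have [H1 H2 H3] := far_prev i li.
  have := st_order st H1 (far i li) H3; have := IH li; lia.
- move=> e /negbTE/nLE[el Lce].
  have ec : e != c by apply/eqP => E; move: Lce; rewrite E Lc ltnn => /(_ isT).
  have [lt|ge] := ltnP e c.
    have nLe : ~~ L e by apply/negP => /Lce; lia.
    have e0 : 0 < e by case: (e) nLe => //; rewrite L0.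
    rewrite prevE ?(ltnW lt) // !out lt.
    have [H1 H2 H3] := prev_spec L0 e0.
    by rewrite (ltn_trans H2 lt); apply: (st_settled_gt st).
  rewrite prev_gt ?out_c ?out_gt //; lia.
- move=> e; rewrite /next_L /next_D => Le e0 /orP[/andP[De ec]|/eqP E].
    have [Le' _] := st_D st De.
    rewrite prevE ?(ltnW ec) // !out ec.
    have [H1 H2 H3] := prev_spec L0 e0.
    by rewrite (ltn_trans H2 ec); apply: (st_D_inv st).
  have [H1 H2 H3] := prev_spec L0 e0.
  by rewrite E out_c prevE ?leqnn -?E // out -E H2; apply: (st_ge st).
- move=> e; rewrite /next_L /next_D negb_or negb_and => Le e0 /andP[De ec].
  case/orP: Le => [/andP[Le lec]|le].
    have ec' : e < c by lia.
    have nDe : ~~ D e by move: De; rewrite ec' orbF.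
    have [H1 H2 H3] := prev_spec L0 e0.
    rewrite prevE // !out ec' (ltn_trans H2 ec').
    by apply: (st_nD st).
  have [E|ne] := eqVneq e (lam a).+1.
    by rewrite prev_gt ?E // ?out_c ?out_gt //; lia.
  case: e e0 {De ec} le ne => // e _ le ne.
  have lt : lam a < e by lia.
  have [-> E2] := prev_far e lt.
  rewrite !far_out // ?E2.
  apply: (st_nD st); [exact: far | exact: leq_ltn_trans lt | ].
  by apply/negP => /(st_D st)[_]; lia.
Qed.

End Step.

(** Both clauses are necessary for [u] to be completed to [w]: strands never move left, and inverted
    pairs stay inverted. *)
Definition good_arr u : Prop :=
  (forall x, x <= pos (u x)) /\ (forall x y, x < y -> u y < u x -> pos (u x) < pos (u y)).

Lemma good_target u : u =1 w -> good_arr u.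
Proof. by move=> E; split=> [x|x y xy _]; rewrite !E !wK. Qed.

Lemma good_row_out a C u N : (forall i, C i -> i < N) ->
  good_arr (row_out a C u) -> good_arr u.
Proof.
move=> CN [G1 G2]; split=> [x|x y xy inv].
  have [y xy E] := strand_lands a u x CN.
  by rewrite -E; apply: leq_trans (G1 y).
have [x' [y' [lt Ex Ey]]] := inversion_persists a CN xy inv.
by rewrite -Ex -Ey; apply: G2 => //; rewrite Ex Ey.
Qed.

(** The first column without a cross serves as [c]; the strand [a] turns up there. A settled strand
    must not be pushed out of its column, and a real cross between neighbouring strands of [L] would
    put them for good in the order opposite to their targets. Only columns of [D] remain free. *)
Lemma valid_of_good a L D u C N : state a.+1 L D u -> (forall i, C i -> i < N) ->
  good_arr (row_out a C u) -> valid a L D C.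
Proof.
move=> st CN [G1 G2]; have L0 := st0 st.
have ex : exists i, ~~ C i by exists N; apply/negP => /CN; rewrite ltnn.
case: (ex_minnP ex) => c nCc minc.
have Clt i : i < c -> C i.
  by move=> ic; apply: contraT => /minc; lia.
have carry_le b : b <= c -> carry a C u b = a.
  elim: b => // b IH bc; rewrite carryS IH ?(ltnW bc) // Clt //=.
  by rewrite (st_ge st).
have out_lt b : b < c -> row_out a C u b = u b.
  by move=> bc; rewrite /row_out carry_le ?(ltnW bc) // Clt //= (st_ge st).
have out_c : row_out a C u c = a by rewrite /row_out carry_le // (negPf nCc).
have carry_c : carry a C u c.+1 = u c by rewrite carryS (negPf nCc).
have [qlam qpos] := last_target st; set q := prev L (lam a).+1 in qlam qpos.
have [Lq qle _] := prev_spec L0 (ltn0Sn (lam a)); rewrite -/q in Lq qle.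
(* Otherwise the larger strand in column [q] stays to the left of [a], although its target lies to
   the right of [pos a]. *)
have cl : c <= lam a.
  rewrite leqNgt; apply/negP => lc.
  have qc : q < c by lia.
  have := G2 q c qc; rewrite (out_lt q qc) out_c (st_ge st) => /(_ isT); lia.
have no_move x b : ~~ L x -> x < b -> carry a C u b = u x -> False.
  move=> nLx xb E; have [y by_ Ey] := carry_lands a u b CN.
  by have := G1 y; rewrite Ey E (st_settled st nLx) wK; lia.
have Lc : L c by apply: contraT => nLc; case: (no_move c c.+1 nLc).
have step b : c < b -> carry a C u b = u (prev L b) ->
    [/\ ~~ L b -> C b, L b -> C b -> D b & carry a C u b.+1 = u (prev L b.+1)].
  move=> cb Eb; have b0 : 0 < b by lia.
  have [Lp pb _] := prev_spec L0 b0.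
  rewrite carryS Eb /=; case: (boolP (L b)) => Lb.
    case: (boolP (D b)) => Db.
      have lt := st_D_inv st Lb b0 Db; split=> //.
      by case: ifP => // /andP[_]; lia.
    have lt := st_nD st Lb b0 Db.
    (* With a cross, [u b] would leave at [b] and the smaller strand further right: an inversion
       that contradicts the order of the targets in [L]. *)
    have nC : C b = false.
      apply/negP => Cb.
      have [y by_ Ey] := carry_lands a u b.+1 CN.
      have Eo : row_out a C u b = u b by rewrite /row_out Eb Cb lt.
      have Ec : carry a C u b.+1 = u (prev L b) by rewrite carryS Eb Cb lt.
      have := G2 b y by_; rewrite Eo Ey Ec => /(_ lt).
      by have := st_order st Lp Lb pb; lia.
    by rewrite nC.
  have lt := st_settled_gt st Lb.
  have Cb : C b.
    apply: contraT => nC; case: (no_move b b.+1 Lb) => //.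
    by rewrite carryS (negPf nC).
  by rewrite Cb lt.
have carryE b : c < b -> carry a C u b = u (prev L b).
  elim: b => // b IH; rewrite ltnS leq_eqVlt => /orP[/eqP<-|cb].
    by rewrite carry_c /= Lc.
  by have [] := step b cb (IH cb).
have main b : c < b -> (~~ L b -> C b) /\ (L b -> C b -> D b).
  by move=> cb; have [] := step b cb (carryE b cb).
exists c, (fun i => [&& C i, L i & c < i]); split=> //.
  by move=> i /and3P[Ci Li ci]; have [_ H] := main i ci; split=> //; exact: H.
move=> i; rewrite /row_crosses; case: (ltngtP i c) => [ic|ci|->] /=.
- exact: Clt.
- by have [H _] := main i ci; case: (boolP (L i)) H => //= _; [rewrite andbT | move=> ->].
- by rewrite Lc (negPf nCc).
Qed.

End Target.

(** * Sets of ordinals and sums over subsets *)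

Section DropEnum.
Variable m : nat.

Lemma mem_drop_enum v (x : 'I_m) : (x \in drop v (enum 'I_m)) = (v <= x).
Proof.
rewrite -(mem_map val_inj) map_drop val_enum_ord drop_iota mem_iota add0n.
by move: (ltn_ord x) => /=; move: (nat_of_ord x) => t; lia.
Qed.

Lemma drop_enum (j : 'I_m) : drop j (enum 'I_m) = j :: drop j.+1 (enum 'I_m).
Proof. by rewrite (drop_nth j) ?size_enum_ord ?ltn_ord // nth_ord_enum. Qed.

End DropEnum.

Section MemNat.
Variable n : nat.
Implicit Types (A B : {set 'I_n}) (i : nat).

Definition mem_nat A : pred nat := fun i => if insub i is Some x then x \in A else false.

Lemma mem_natE A (x : 'I_n) : mem_nat A x = (x \in A).
Proof. by rewrite /mem_nat valK. Qed.

Lemma mem_natP A i : reflect (exists2 x : 'I_n, x = i :> nat & x \in A) (mem_nat A i).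
Proof.
apply: (iffP idP); last by case=> x <-; rewrite mem_natE.
by rewrite /mem_nat; case: insubP => // x _ <-; exists x.
Qed.

Lemma mem_nat_ge A i : n <= i -> mem_nat A i = false.
Proof. by move=> ni; apply/mem_natP => -[x E _]; have := ltn_ord x; lia. Qed.

End MemNat.

Section SubsetSums.
Local Open Scope ring_scope.
Variables (T : finType) (K : nmodType).
Implicit Types (A B S : {set T}).

Lemma sum_subsetU A B (G : {set T} -> K) : [disjoint A & B] ->
  \sum_(S : {set T} | S \subset A :|: B) G S
  = \sum_(S1 : {set T} | S1 \subset A) \sum_(S2 : {set T} | S2 \subset B) G (S1 :|: S2).
Proof.
move=> dAB; rewrite pair_big /=.
rewrite (reindex_onto (fun p => p.1 :|: p.2) (fun S => (S :&: A, S :&: B))) /=; last first.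
  by move=> S sS; rewrite -setIUr; apply/setIidPl.
have AB0 : A :&: B = set0 by apply/disjoint_setI0.
have H (X Y : {set T}) : X \subset A -> Y \subset B -> X :&: B = set0 /\ Y :&: A = set0.
  move=> XA YB; split; apply/eqP; rewrite -subset0 -AB0; first exact: setSI.
  by rewrite setIC setIS.
apply: eq_bigl => -[X Y] /=; rewrite xpair_eqE !setIUl; apply/andP/andP.
  case=> _ /andP[/eqP E1 /eqP E2].
  by split; [rewrite -E1 subUset !subsetIr | rewrite -E2 subUset !subsetIr].
case=> XA YB; have [-> ->] := H _ _ XA YB.
by rewrite setU0 set0U setUSS //; split=> //; apply/andP; split; apply/eqP/setIidPl.
Qed.

Lemma sum_subset1 (x : T) (G : {set T} -> K) :
  \sum_(S : {set T} | S \subset [set x]) G S = G set0 + G [set x].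
Proof.
rewrite (bigD1 set0) ?sub0set //= (bigD1 [set x]) /=; last first.
  by rewrite subxx; apply/set0Pn; exists x; rewrite inE.
rewrite big1 ?addr0 // => S; rewrite subset1 => /andP[/andP[/orP[/eqP->|/eqP->]]];
  by rewrite eqxx.
Qed.

End SubsetSums.

(** Outside the triangle there are only elbows, and a row of elbows shifts all strands one column to
    the right. *)
Lemma row_out_tail n a u (C : pred nat) i : (a < n)%N ->
  (forall j, C j -> ((j + a).+1 < n)%N) ->
  (forall j, (n - a.+1 <= j)%N -> u j = (j + a.+1)%N) ->
  (n - a <= i)%N -> row_out a C u i = (i + a)%N.
Proof.
move=> an tC tail ni; have Ca j : (n - a.+1 <= j)%N -> C j = false.
  by move=> nj; apply/negP => /tC; lia.
have i0 : (0 < i)%N by lia.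
rewrite /row_out Ca /=; last by lia.
by rewrite -(prednK i0) carryS Ca /= ?tail; lia.
Qed.

(** * The row recursion for pipe dreams *)

Section Sum.
Local Open Scope ring_scope.
Variables (n : nat) (K : comNzRingType) (w pos lam : nat -> nat).
Hypotheses (n_gt0 : (0 < n)%N) (wK : cancel w pos) (posK : cancel pos w) (w0 : w 0%N = 0%N)
  (w_ge : forall i, (n <= i)%N -> w i = i)
  (diagE : forall a b, ((b < pos a) && (a < w b) = (0 < b <= lam a))%N)
  (lam_mono : forall a, (0 < a)%N -> (lam a.+1 <= lam a)%N)
  (lam_lt : forall a, (0 < lam a)%N -> (lam a + a < n)%N).
Variables (reg : nat -> pred nat) (yb : nat -> nat -> K) (wt : nat -> {set 'I_n} -> K).
Hypotheses
  (reg1 : forall a i, (i < lam a)%N -> reg a i)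
  (reg2 : forall a i, (0 < i <= lam a.+1)%N -> reg a i)
  (wtE : forall a (C : {set 'I_n}), (forall i : 'I_n, i \in C -> reg a i) ->
     wt a C = \prod_(i | i \notin C) yb a i).

Implicit Types (S U C : {set 'I_n}).

Definition in_triangle a (C : {set 'I_n}) := [forall i in C, (i + a).+1 < n]%N.

Fixpoint completions k (u : nat -> nat) : K :=
  if k is a.+1 then
    \sum_(C : {set 'I_n} | in_triangle a C) wt a C * completions a (row_out a (mem_nat C) u)
  else [forall i : 'I_n, u i == w i]%:R.

Definition far a : {set 'I_n} := [set i : 'I_n | lam a < i]%N.
Definition upto c (L : {set 'I_n}) : {set 'I_n} := [set i in L | i <= c]%N.
Definition below c (L : {set 'I_n}) : {set 'I_n} := [set i in L | i < c]%N.

(* [c] is the column in which the strand [a] leaves row [a], and the two summands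
   correspond to a later row having no ignored cross in column [c], or having one. *)
Fixpoint Zsum a (L : {set 'I_n}) : K :=
  if a is a'.+1 then
    \sum_(c in L | (c <= lam a)%N) (\prod_(e in L | (c <= e)%N) yb a e) *
       (Zsum a' (upto c L :|: far a) + Zsum a' (below c L :|: far a))
  else (mem_nat L 0%N)%:R * \prod_(e in L) yb 0 e.

(** The columns from [n] on count as unsettled, because every row still shifts their strands. *)
Definition unsettled (L : {set 'I_n}) : pred nat := fun i => (n <= i)%N || mem_nat L i.

Lemma state_ext k (L L' D D' : pred nat) u u' : L =1 L' -> D =1 D' -> u =1 u' ->
  state w pos lam k L D u -> state w pos lam k L' D' u'.
Proof.
move=> EL ED Eu [s1 s2 s3 s4 s5 s6 s7 s8 s9 s10 s11 s12].
have EP b : prev L' b = prev L b by elim: b => //= b ->; rewrite EL.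
split.
- by rewrite -EL.
- by move=> i /s2; rewrite EL.
- by move=> i; rewrite -ED -EL; apply: s3.
- by move=> i; rewrite -EL -Eu; apply: s4.
- by move=> i j; rewrite -!Eu; apply: s5.
- by move=> i; rewrite -Eu; apply: s6.
- by move=> v /s7[i <-]; exists i.
- by move=> i j; rewrite -!EL -!Eu; apply: s8.
- by move=> i; rewrite -EL -Eu; apply: s9.
- by move=> e; rewrite -EL -!Eu EP; apply: s10.
- by move=> e; rewrite -EL -ED -!Eu EP; apply: s11.
- by move=> e; rewrite -EL -ED -!Eu EP; apply: s12.
Qed.

Lemma eq_row_out a u (C C' : pred nat) : C =1 C' -> row_out a C u =1 row_out a C' u.
Proof.
move=> E b; rewrite /row_out E.
by have -> : carry a C u b = carry a C' u b by elim: b => //= b ->; rewrite E.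
Qed.

(** An arrangement that is not good cannot become good, whereas [w] is good. The hypothesis on the
    tail turns agreement with [w] in the first [n] columns into agreement everywhere. *)
Lemma completions_dead k u : (k <= n)%N -> (forall i, (n - k <= i)%N -> u i = (i + k)%N) ->
  (good_arr pos u -> False) -> completions k u = 0.
Proof.
elim: k u => [|a IH] u kn tail ng /=.
  case: forallP => //= H; case: ng; apply: (good_target wK) => i.
  have [i_n|n_i] := ltnP i n; first by have /eqP := H (Ordinal i_n).
  by rewrite w_ge // tail ?addn0 // subn0.
rewrite big1 // => C /forall_inP tC.
have Cn i : mem_nat C i -> (i < n)%N by move=> /mem_natP[x <- _].
have Ca i : (n - a.+1 <= i)%N -> mem_nat C i = false.
  by move=> ni; apply/mem_natP => -[x E /tC]; rewrite E; lia.
rewrite IH ?mulr0 //; first exact: ltnW.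
  move=> i ni; have i0 : (0 < i)%N by lia.
  have {}ni' : (n - a.+1 <= i.-1)%N by lia.
  rewrite /row_out Ca /=; last by lia.
  by rewrite -(prednK i0) carryS Ca //= tail //; lia.
by move=> /(good_row_out Cn).
Qed.

Section Valid.
Variables (a : nat) (L D : {set 'I_n}) (u : nat -> nat).
Hypotheses (a_n : (a < n)%N)
  (st : state w pos lam a.+1 (unsettled L) (mem_nat D) u)
  (tail : forall i, (n - a.+1 <= i)%N -> u i = (i + a.+1)%N).

Definition above c (S : {set 'I_n}) : {set 'I_n} := [set i in S | c < i]%N.

Definition crosses c (S : {set 'I_n}) : {set 'I_n} :=
  [set i : 'I_n | [|| i < c, i \notin L | i \in S]%N].

Lemma unsettledE (i : 'I_n) : unsettled L i = (i \in L).
Proof. by rewrite /unsettled mem_natE leqNgt ltn_ord. Qed.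

Lemma mem_crosses c S : (c <= n)%N -> S \subset D ->
  mem_nat (crosses c S) =1 row_crosses c (unsettled L) (mem_nat S).
Proof.
move=> cn SD i; rewrite /row_crosses.
have [i_n|n_i] := ltnP i n.
  by rewrite -[i]/(val (Ordinal i_n)) !mem_natE unsettledE inE.
by rewrite !mem_nat_ge // /unsettled n_i /= orbF ltnNge (leq_trans cn n_i).
Qed.

Lemma D_sub (i : 'I_n) : i \in D -> i \in L /\ (i <= lam a.+1)%N.
Proof.
by rewrite -mem_natE => /(st_D st)[]; rewrite unsettledE.
Qed.

(** The crosses left of [c] lie in row [a] of the bottom pipe dream. All others have a column from 1
    to [lam a.+1], that is, they lie in row [a] of the top one. This makes [wtE] applicable. *)
Lemma crosses_reg (c : 'I_n) S (i : 'I_n) : c \in L -> (c <= lam a)%N -> S \subset above c D ->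
  i \in crosses c S -> reg a i /\ ((i + a).+1 < n)%N.
Proof.
move=> Lc cl SD; rewrite inE => H.
have [ic|ci] := ltnP i c.
  have il := leq_trans ic cl; split; first exact: reg1.
  by have := lam_lt (leq_ltn_trans (leq0n _) il); lia.
have {}H : (0 < i <= lam a.+1)%N.
  rewrite ltnNge ci /= in H; case/orP: H => [nL|iS].
    have i0 : (0 < i)%N.
      rewrite lt0n; apply/eqP => E; have := st0 st.
      by rewrite -E unsettledE (negPf nL).
    rewrite i0 leqNgt; apply/negP => /(st_far st); by rewrite unsettledE (negPf nL).
  have := subsetP SD i iS; rewrite inE => /andP[/D_sub[_ ->]]; rewrite andbT; lia.
split; first exact: reg2.
by have := lam_lt (leq_trans (proj1 (andP H)) (proj2 (andP H))); case/andP: H; lia.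
Qed.

(** The number [c] can be read off as the first column without a cross, and then [S] as the crosses
    in columns of [L] beyond it. *)
Lemma crosses_inj (c c' : 'I_n) S S' : c \in L -> c' \in L ->
  S \subset above c D -> S' \subset above c' D -> crosses c S = crosses c' S' ->
  c = c' /\ S = S'.
Proof.
have main (d d' : 'I_n) U U' : d \in L -> U \subset above d D ->
    crosses d U = crosses d' U' -> (d' <= d)%N.
  move=> Ld UD /setP /(_ d); rewrite !inE ltnn Ld /= => E.
  rewrite leqNgt; apply/negP => dd'; rewrite dd' /= in E.
  by have := subsetP UD d E; rewrite inE ltnn andbF.
move=> Lc Lc' SD SD' E.
have Ec : c = c'.
  by apply/val_inj/eqP; rewrite eqn_leq (main _ _ _ _ Lc' SD' (esym E)) (main _ _ _ _ Lc SD E).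
split=> //; apply/setP => i; have /setP/(_ i) := E; rewrite !inE -Ec.
have out (U : {set 'I_n}) : U \subset above c D -> i \in U -> (i \in L) && (c < i)%N.
  by move=> UD /(subsetP UD); rewrite inE => /andP[/D_sub[-> _] ->].
rewrite -Ec in SD'.
case: (boolP (i \in S)) => iS; case: (boolP (i \in S')) => iS' //.
  by have /andP[-> ci] := out _ SD iS; rewrite /= ltnNge (ltnW ci).
by have /andP[-> ci] := out _ SD' iS'; rewrite /= ltnNge (ltnW ci).
Qed.

(** Sets of crosses that are not of the valid form lead to a dead arrangement and contribute 0; the
    others are parametrised by [c] and [S]. *)
Lemma sum_valid :
  completions a.+1 u = \sum_(c in L | (c <= lam a)%N) \sum_(S : {set 'I_n} | S \subset above c D)
    (\prod_(e in L :\: S | (c <= e)%N) yb a e) * completions a (row_out a (mem_nat (crosses c S)) u).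
Proof.
pose A : {set 'I_n * {set 'I_n}} :=
  [set p : 'I_n * {set 'I_n} | [&& p.1 \in L, (p.1 <= lam a)%N & p.2 \subset above p.1 D]].
pose h (p : 'I_n * {set 'I_n}) := crosses p.1 p.2.
pose F C := wt a C * completions a (row_out a (mem_nat C) u).
have E1 : completions a.+1 u = \sum_(C in h @: A) F C.
  rewrite /= [LHS]big_mkcond [RHS]big_mkcond /=; apply: eq_bigr => C _.
  case: imsetP => [[[c S]]|nA].
    rewrite inE /= => /and3P[Lc cl SD] ->; rewrite ifT //.
    by apply/forall_inP => i /(crosses_reg Lc cl SD)[].
  case: ifP => // /forall_inP tC; rewrite completions_dead ?mulr0 //; first exact: ltnW.
    move=> i ni; have Ca j : (n - a.+1 <= j)%N -> mem_nat C j = false.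
      by move=> nj; apply/mem_natP => -[x E /tC]; rewrite E; lia.
    have i0 : (0 < i)%N by lia.
    rewrite /row_out Ca /=; last by lia.
    by rewrite -(prednK i0) carryS Ca /= ?tail; lia.
  have Cn i : mem_nat C i -> (i < n)%N by move=> /mem_natP[x <- _].
  move=> /(valid_of_good wK posK w0 diagE st Cn)[c [S [Lc cl SD EC]]]; apply: nA.
  have cn : (c < n)%N by case: (posnP (lam a)) => [|/lam_lt]; lia.
  pose S' := [set i : 'I_n | S i].
  exists (Ordinal cn, S'); first rewrite inE /= -unsettledE cl [unsettled L _]Lc /=.
    by apply/subsetP => i; rewrite !inE => /SD; rewrite mem_natE => -[-> ->].
  by apply/setP => i; rewrite /h /= -mem_natE EC !inE /row_crosses unsettledE.
rewrite E1 big_imset; last first.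
  move=> [c S] [c' S']; rewrite !inE /= => /and3P[Lc _ SD] /and3P[Lc' _ SD'] E.
  by have [-> ->] := crosses_inj Lc Lc' SD SD' E.
rewrite pair_big_dep /=; apply: eq_big => [[c S]|[c S]]; rewrite !inE /=.
  by rewrite andbA.
case/and3P=> Lc cl SD; rewrite /F /h /= wtE; last first.
  by move=> i /(crosses_reg Lc cl SD)[].
congr (_ * _); apply: eq_bigl => i; rewrite !inE !negb_or negbK -leqNgt.
by case: (i \in L); case: (i \in S); case: (c <= i)%N.
Qed.

Lemma above_valid c S (i : nat) : S \subset above c D -> mem_nat S i -> mem_nat D i /\ (c < i)%N.
Proof.
move=> SD /mem_natP[x <- /(subsetP SD)]; rewrite inE => /andP[xD cx].
by rewrite mem_natE.
Qed.

Lemma above_sub c  : above c D \subset D.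
Proof. by apply/subsetP => i; rewrite inE => /andP[]. Qed.

Lemma in_upto_far (c : 'I_n) :
  next_L lam a c (unsettled L) =1 unsettled (upto c L :|: far a).
Proof.
have la : (lam a < n)%N by case: (posnP (lam a)) => [->//|/lam_lt]; lia.
move=> i; rewrite /next_L; have [i_n|n_i] := ltnP i n.
  rewrite -[i]/(val (Ordinal i_n)) unsettledE /unsettled mem_natE !inE /=.
  by rewrite [in RHS](leqNgt n) i_n.
by rewrite /unsettled n_i (leq_trans la n_i) orbT.
Qed.

Lemma in_below (c : 'I_n) : next_D c (mem_nat D) =1 mem_nat (c |: below c D).
Proof.
move=> i; rewrite /next_D; have [i_n|n_i] := ltnP i n.
  by rewrite -[i]/(val (Ordinal i_n)) !mem_natE !inE orbC (inj_eq val_inj).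
by rewrite !mem_nat_ge //= gtn_eqF // (leq_trans (ltn_ord c)).
Qed.

Lemma next_state (c : 'I_n) S : (0 < a)%N -> c \in L -> (c <= lam a)%N -> S \subset above c D ->
  state w pos lam a (unsettled (upto c L :|: far a)) (mem_nat (c |: below c D))
    (row_out a (mem_nat (crosses c S)) u).
Proof.
move=> a0 Lc cl SD; apply: state_ext (in_upto_far c) (in_below c) _ _; last first.
  apply: (valid_state wK posK w0 diagE lam_mono st (c := c) (S := mem_nat S)) => //.
    by rewrite unsettledE.
  by move=> i; apply: above_valid.
apply: eq_row_out => i; apply/esym/mem_crosses; first exact: ltnW.
exact: subset_trans SD (above_sub _).
Qed.

End Valid.

(** The set [S] fixes in advance the columns of [D] in which an ignored cross will be used; these
    contribute no factor and act as if they were absent from [L]. When the strand turns in column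
    [c], the part of [S] above [c] is used at once, the part below is passed on, and the two states
    of the new member [c] of [D] give the two summands of [Zsum]. *)
Lemma completionsE a (L D : {set 'I_n}) u : (a < n)%N ->
  state w pos lam a.+1 (unsettled L) (mem_nat D) u ->
  (forall i, (n - a.+1 <= i)%N -> u i = (i + a.+1)%N) ->
  completions a.+1 u = \sum_(S : {set 'I_n} | S \subset D) Zsum a (L :\: S).
Proof.
elim: a L D u => [|a IH] L D u a_n st tail; rewrite (sum_valid a_n st tail).
  have lam0 : lam 0 = 0%N.
    by apply/eqP; rewrite -leqn0; have := diagE 0 (lam 0); rewrite -[X in (_ < pos X)%N]w0 wK; lia.
  have n0 : (0 < n)%N by [].
  pose o : 'I_n := Ordinal n0.
  have oL : o \in L by rewrite -(unsettledE L o); exact: st0 st.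
  rewrite (big_pred1 o); last first.
    by move=> c; rewrite /= lam0 leqn0 -(inj_eq val_inj) /=; case: eqP => [E|]; rewrite ?andbF // andbT
      -[c]/(c) (_ : c = o) //; apply: val_inj.
  (* Row 0 turns in column 0, so the sets containing this column have to drop out; [Zsum] vanishes
     on them. *)
  rewrite [RHS](bigID (fun S => o \in S)) /= [X in X + _]big1 ?add0r; last first.
    move=> S /andP[_ oS]; have -> : mem_nat (L :\: S) 0%N = false.
      by rewrite -[0%N]/(val o) mem_natE !inE oS.
    by rewrite mul0r.
  apply: eq_big => [S|S SD].
    apply/idP/andP => [/subsetP H|[/subsetP H oS]].
      split; first by apply/subsetP => i /H; rewrite inE => /andP[].
      by apply/negP => /H; rewrite inE ltnn andbF.
    apply/subsetP => i iS; rewrite inE H //= lt0n; apply: contra oS => /eqP E.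
    by rewrite (_ : o = i) //; apply: val_inj.
  rewrite /= [X in _ * X%:R = _](_ : _ = 1%N) ?mulr1; last first.
    apply/eqP; rewrite eqb1; apply/forallP => i; apply/eqP.
    rewrite (eq_row_out _ _ (mem_crosses L (ltnW n0) (subset_trans SD (above_sub _ _)))).
    by apply: (valid_final wK posK w0 diagE st) => //; [exact: (st0 st) | move=> j; exact: above_valid].
  have -> : mem_nat (L :\: S) 0%N = true.
    rewrite -[0%N]/(val o) mem_natE !inE oL andbT.
    by apply/negP => /(subsetP SD); rewrite inE ltnn andbF.
  by rewrite mul1r; apply: eq_bigl => i; rewrite leq0n andbT.
have lt c : c \in L -> (c <= lam a.+1)%N -> forall S, S \subset above c D ->
    completions a.+1 (row_out a.+1 (mem_nat (crosses L c S)) u)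
    = \sum_(S2 : {set 'I_n} | S2 \subset below c D)
        (Zsum a ((upto c L :\: S2) :|: far a.+1) + Zsum a ((below c L :\: S2) :|: far a.+1)).
  move=> Lc cl S SD.
  have st' := next_state a_n st (ltn0Sn a) Lc cl SD.
  rewrite (IH _ _ _ (ltnW a_n) st'); last first.
    by move=> i; apply: (row_out_tail a_n _ tail) => _ /mem_natP[j <- /(crosses_reg a_n st Lc cl SD)[]].
  rewrite setUC sum_subsetU; last first.
    by rewrite disjoints_subset; apply/subsetP => i; rewrite !inE; apply: contraTneq => ->; rewrite ltnn andbF.
  apply: eq_bigr => S2 S2D; rewrite sum_subset1 setU0.
  have S2c i : i \in S2 -> (i < c)%N by move=> /(subsetP S2D); rewrite inE => /andP[].
  congr (Zsum a _ + Zsum a _); apply/setP => i; rewrite !inE.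
    have [iS|//] := boolP (i \in S2); have := S2c _ iS; case: (ltnP (lam a.+1) i) => //; lia.
  have [->|ne] := eqVneq i c.
    by rewrite ltnn andbF orbT /= ltnNge cl andbF.
  rewrite orbF leq_eqVlt (inj_eq val_inj) (negPf ne) /=.
  have [iS|//] := boolP (i \in S2); have := S2c _ iS; case: (ltnP (lam a.+1) i) => //; lia.
under eq_bigr => c /andP[Lc cl].
  under eq_bigr => S SD do rewrite (lt c Lc cl S SD).
  over.
rewrite [RHS]/=.
under [RHS]eq_bigr => S SD.
  rewrite (eq_bigl (fun c => [&& c \in L, (c <= lam a.+1)%N & c \notin S])); last first.
    by move=> c; rewrite !inE; case: (c \in S); rewrite ?andbF ?andbT.
  over.
rewrite (exchange_big_dep (fun c => (c \in L) && (c <= lam a.+1)%N)) /=; last first.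
  by move=> S c _ /and3P[-> ->].
apply: eq_bigr => c /andP[Lc cl].
(* A subset of [D] without [c] splits into ignored crosses of this row, above [c], and ignored
   crosses of later rows, below [c]. *)
rewrite [RHS](eq_bigl (fun S : {set 'I_n} => S \subset above c D :|: below c D)); last first.
  move=> S /=; rewrite Lc cl /=; apply/andP/subsetP => [[/subsetP H cS] i iS|H].
    have := H i iS; rewrite !inE => -> /=.
    by case: (ltngtP c i) => // E; rewrite (_ : c = i) ?iS // in cS; apply: val_inj.
  split; first by apply/subsetP => i /H; rewrite !inE => /orP[] /andP[].
  by apply/negP => /H; rewrite !inE ltnn andbF.
rewrite sum_subsetU; last first.
  rewrite disjoints_subset; apply/subsetP => i; rewrite inE => /andP[_ ci].
  by rewrite !inE ltnNge (ltnW ci) andbF.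
apply: eq_bigr => S1 S1D; rewrite big_distrr /=; apply: eq_bigr => S2 S2D.
have S2c i : i \in S2 -> (i < c)%N by move=> /(subsetP S2D); rewrite inE => /andP[].
have S1c i : i \in S1 -> (c < i)%N by move=> /(subsetP S1D); rewrite inE => /andP[].
congr (_ * (Zsum a _ + Zsum a _)).
- apply: eq_bigl => i; rewrite !inE negb_or.
  case: (boolP (i \in S2)) => [iS|_]; last by rewrite ?andbT ?orbF.
  by rewrite [(c <= i)%N]leqNgt (S2c _ iS) !andbF.
- apply/setP => i; rewrite !inE negb_or.
  case: (boolP (i \in S1)) => [/S1c ci|_]; last by rewrite /= ?andbA.
  by rewrite [(i <= c)%N]leqNgt ci !andbF.
- apply/setP => i; rewrite !inE negb_or.
  case: (boolP (i \in S1)) => [/S1c ci|_]; last by rewrite /= ?andbA.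
  by rewrite [(i < c)%N]ltnNge (ltnW ci) !andbF.
Qed.

Lemma initial_state :
  state w pos lam n (unsettled [set: 'I_n]) (mem_nat (set0 : {set 'I_n})) (addn^~ n).
Proof.
have LT i : unsettled [set: 'I_n] i.
  rewrite /unsettled; have [//|i_n] := leqP n i.
  by rewrite -[i]/(val (Ordinal i_n)) mem_natE inE orbT.
have D0 i : mem_nat (set0 : {set 'I_n}) i = false.
  by apply/mem_natP => -[x _]; rewrite inE.
have pos_ge i : pos (i + n)%N = (i + n)%N.
  by rewrite -[in LHS](w_ge (leq_addl i n)) wK.
split=> //.
- by move=> i; rewrite D0.
- by move=> i; rewrite LT.
- by move=> i j /addIn.
- by move=> i; rewrite leq_addl.
- by move=> v nv; exists (v - n)%N; rewrite subnK.
- by move=> i j _ _; rewrite !pos_ge ltn_add2r.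
- by move=> i _; rewrite pos_ge -[X in (X < _)%N]addn0 ltn_add2l.
- by move=> e; rewrite LT.
- by move=> e _ _; rewrite D0.
- by case=> // e _ _ _; rewrite /= LT ltn_add2r.
Qed.

Lemma completions_all : completions n (addn^~ n) = Zsum n.-1 [set: 'I_n].
Proof.
have st := initial_state; move: (st); have nE : n = n.-1.+1 by rewrite prednK.
rewrite [X in state _ _ _ X]nE => st'.
rewrite [X in completions X]nE (completionsE _ st'); last 2 first.
- by rewrite prednK.
- by move=> i _; rewrite -nE.
rewrite (big_pred1 set0) ?setD0 // => S; exact: subset0.
Qed.

End Sum.

(** * Tracing the strands *)

Section Simulation.
Variable n : nat.
Implicit Types (u A : nat -> nat) (P : {set box n}) (ign : bool).

Definition label (x : nat) : strand n := insub x.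

Lemma label_inj x y : x < n -> y < n -> label x = label y -> x = y.
Proof. by rewrite /label => xn yn; rewrite !insubT => -[]. Qed.

(** The log contains no more than the arrangement does: a pair of strands is logged exactly when it
    is inverted. By the third clause a strand smaller than [a] that enters later occurs in no logged
    pair. *)
Definition log_spec a A (log : seq {set strand n}) : Prop :=
  [/\ injective A,
      forall i j, i < j -> A i < n -> A j < n ->
        ([set label (A i); label (A j)] \in log) = (A j < A i),
      forall s (x : 'I_n), s \in log -> Some x \in s -> a <= x
    & uniq log].

Definition swap_at b A : nat -> nat :=
  fun i => if i == b then A b.+1 else if i == b.+1 then A b else A i.

Lemma log_spec_ext a A A' log : A =1 A' -> log_spec a A log -> log_spec a A' log.
Proof.
move=> E [H1 H2 H3 H4]; split=> //.
- by move=> i j; rewrite -!E; apply: H1.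
- by move=> i j; rewrite -!E; apply: H2.
Qed.

Lemma set2_label_eq x y x' y' : x < n -> y < n -> x' < n -> y' < n ->
  [set label x; label y] = [set label x'; label y'] ->
  (x = x' /\ y = y') \/ (x = y' /\ y = x').
Proof.
move=> xn yn xn' yn' E.
have mem z p q : z < n -> p < n -> q < n -> label z \in [set label p; label q] -> z = p \/ z = q.
  by move=> zn pn qn; rewrite !inE => /orP[] /eqP /label_inj -> //; [left|right].
have hx : x = x' \/ x = y' by apply: mem => //; rewrite -E !inE eqxx.
have hy : y = x' \/ y = y' by apply: mem => //; rewrite -E !inE eqxx orbT.
have hx' : x' = x \/ x' = y by apply: mem => //; rewrite E !inE eqxx.
have hy' : y' = x \/ y' = y by apply: mem => //; rewrite E !inE eqxx orbT.
lia.
Qed.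

Lemma log_spec_swap a A log b : log_spec a A log -> a <= A b -> a <= A b.+1 ->
  A b < n -> A b.+1 < n -> A b < A b.+1 ->
  log_spec a (swap_at b A) ([set label (A b); label (A b.+1)] :: log).
Proof.
move=> [H1 H2 H3 H4] ab ab' bn bn' lt.
pose sg i := if i == b then b.+1 else if i == b.+1 then b else i.
have AE i : swap_at b A i = A (sg i) by rewrite /swap_at /sg; do 2?case: eqP.
have sgI : injective sg.
  by move=> i j; rewrite /sg; do 2?[case: eqP]; do 2?[case: eqP]; lia.
split.
- by move=> i j; rewrite !AE => /H1/sgI.
- move=> i j ij; rewrite !AE => i_n j_n; rewrite inE.
  case: (boolP ((i == b) && (j == b.+1))) => [/andP[/eqP Ei /eqP Ej]|ne].
    by rewrite Ei Ej /sg !eqxx (gtn_eqF (ltnSn b)) setUC eqxx /= lt.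
  have nij : sg i < sg j by move: ne; rewrite /sg; do 4?case: eqP; lia.
  rewrite H2 //; case: eqP => [E|//]; exfalso.
  have [[/H1 E1 /H1 E2]|[/H1 E1 /H1 E2]] := set2_label_eq i_n j_n bn bn' E.
    by move: E1 E2 ne; rewrite /sg; do 4?case: eqP; lia.
  by move: nij; rewrite E1 E2; lia.
- move=> s x; rewrite inE => /orP[/eqP->|]; last exact: H3.
  rewrite !inE => /orP[]/eqP; rewrite /label insubT => -[->] //.
- rewrite /= H4 andbT H2 //; lia.
Qed.

Definition row_set P a : {set 'I_n} := [set b : 'I_n | [exists c in P, (c.1 == a :> nat) && (c.2 == b)]].

Lemma mem_row_set P (a b : 'I_n) : (b \in row_set P a) = ((a, b) \in P).
Proof.
rewrite inE; apply/exists_inP/idP => [[[a' b'] H /= /andP[/eqP/val_inj <- /eqP <-]]//|H].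
by exists (a, b) => //=; rewrite !eqxx.
Qed.

Lemma mem_nat_row_set P (a b : 'I_n) : mem_nat (row_set P a) b = ((a, b) \in P).
Proof. by rewrite mem_natE mem_row_set. Qed.

Lemma foldl_rev_drop (T : Type) (f : T -> 'I_n -> T) (s : T) (a : 'I_n) :
  foldl f s (rev (drop a (enum 'I_n))) = f (foldl f s (rev (drop a.+1 (enum 'I_n)))) a.
Proof. by rewrite drop_enum rev_cons foldl_rcons. Qed.

(** The strands along the broken line between visited and unvisited tiles: the outputs of the first
    [b] columns, the strand about to enter column [b], then the inputs of the other columns, shifted
    by one place. *)
Definition arr a (C : pred nat) u b : nat -> nat :=
  fun i => if i < b then row_out a C u i else if i == b then carry a C u b else u i.-1.

Section OneRow.
Variables (P : {set box n}) (a : 'I_n) (u : nat -> nat).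
Let C := mem_nat (row_set P a).
Hypotheses (Ptri : forall b, C b -> (b + a).+1 < n)
  (uI : injective u) (u_ge : forall i, a < u i)
  (tail : forall i, n - a.+1 <= i -> u i = i + a.+1).

(** The tail columns already hold all numbers from [n] on, and [u] is injective. So strands without
    a proper label never meet a cross. *)
Lemma real_u b : (b + a).+1 < n -> u b < n.
Proof.
move=> ban; rewrite ltnNge; apply/negP => nu.
have E : u (u b - a.+1) = u b by rewrite tail; lia.
by have := uI E; lia.
Qed.

Lemma carry_ge b : a <= carry a C u b.
Proof. by elim: b => //= b IH; case: ifP => // _; apply/ltnW/u_ge. Qed.

Lemma real_carry b : (b + a).+1 < n -> carry a C u b < n.
Proof.
elim: b => [|b IH] ban; first exact: ltn_ord.
rewrite carryS; case: ifP => _; first by apply: IH; lia.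
by apply: real_u; lia.
Qed.

Lemma arr0 : arr a C u 0 =1 fun i => if i is i'.+1 then u i' else a.
Proof. by case=> [|i]. Qed.

(** Along the broken line an elbow changes nothing, and neither does an ignored cross; a real cross
    exchanges two neighbours. *)
Lemma arrS b : arr a C u b.+1 =1
  if C b && (carry a C u b < u b) then swap_at b (arr a C u b) else arr a C u b.
Proof.
move=> i; case: (boolP (C b && (carry a C u b < u b))) => H;
  rewrite /swap_at /arr carryS ?H ?(negPf H) ltnS; case: (ltngtP i b) => ib //.
- by case: eqP => // E; move: ib; rewrite E; lia.
- by rewrite ltnn eqxx.
- have -> : (b.+1 < b) = false by lia.
  by rewrite gtn_eqF // ib /row_out H.
- by case: eqP => // ->.
- by rewrite ib /row_out (negPf H).
Qed.

Lemma arr_inj b : injective (arr a C u b).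
Proof.
elim: b => [|b IH].
  move=> i j; rewrite (arr0 i) (arr0 j); case: i => [|i]; case: j => [|j] // E.
  - by have := u_ge j; lia.
  - by have := u_ge i; lia.
  - by rewrite (uI E).
move=> i j; rewrite (arrS b i) (arrS b j); case: ifP => _; last exact: IH.
rewrite /swap_at; case: (eqVneq i b) => ib; case: (eqVneq j b) => jb; first by move=> _; rewrite ib.
all: case: (eqVneq i b.+1) => ib'; case: (eqVneq j b.+1) => jb' /IH; lia.
Qed.

Lemma row_out_inj : injective (row_out a C u).
Proof.
move=> i j E; have := @arr_inj (maxn i j).+1 i j.
by rewrite /arr !ltnS leq_maxl leq_maxr; apply.
Qed.

Lemma row_out_ge i : a <= row_out a C u i.
Proof. by rewrite /row_out; case: ifP => _; [exact/ltnW/u_ge | exact: carry_ge]. Qed.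

Lemma row_tail i : n - a <= i -> row_out a C u i = i + a.
Proof. exact: row_out_tail (ltn_ord a) Ptri tail. Qed.

Variables (ign : bool) (v : {ffun 'I_n -> strand n}) (log : seq {set strand n}).
Hypotheses (vE : forall b : 'I_n, v b = label (u b))
  (logE : log_spec a.+1 u log)
  (real : ign \/ forall b, C b -> carry a C u b < u b).

Lemma row_log0 : log_spec a (arr a C u 0) log.
Proof.
apply: log_spec_ext (fsym arr0) _; case: logE => H1 H2 H3 H4; split=> //.
- by move=> [|i] [|j] // E; [have := u_ge j | have := u_ge i | rewrite (uI E)]; lia.
- move=> [|i] [|j] //= ij i_n j_n; last exact: H2.
  rewrite [RHS]ltnNge (ltnW (u_ge j)); apply/negP => /H3 H.
  have : a < a by apply: H; rewrite !inE /label valK eqxx.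
  by rewrite ltnn.
- by move=> s x /H3 H /H /ltnW.
Qed.

Lemma trace_row_sim (b : nat) : b <= n ->
  exists log', log_spec a (arr a C u b) log' /\
    foldl (trace_tile ign P) (Some a, v, log) [seq (a, b') | b' <- take b (enum 'I_n)]
    = (label (carry a C u b),
       [ffun b' : 'I_n => label (if b' < b then row_out a C u b' else u b')], log').
Proof.
elim: b => [|b IH] bn.
  exists log; split; first exact: row_log0.
  rewrite take0 /= /label valK; congr (_, _, _).
  by apply/ffunP => b'; rewrite ffunE vE.
have [log' [L E]] := IH (ltnW bn).
pose bo : 'I_n := Ordinal bn.
rewrite (take_nth bo) ?size_enum_ord // map_rcons foldl_rcons E (nth_ord_enum bo bo).
rewrite /trace_tile ffunE /= ltnn -mem_nat_row_set -/C.
have [Cb|nCb] := boolP (C b); last first.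
  exists log'; split; first by apply: log_spec_ext L => i; rewrite arrS (negPf nCb).
  rewrite /=; congr (_, _, _).
  apply/ffunP => b'; rewrite !ffunE ltnS; case: (ltngtP b' b) => [b'b|bb'|b'b].
  - by rewrite -val_eqE /= (ltn_eqF b'b).
  - by rewrite -val_eqE /= (gtn_eqF bb').
  - by rewrite -val_eqE /= b'b eqxx /row_out (negPf nCb).
have tri := Ptri Cb; have ub := real_u tri; have cb := real_carry tri.
have [H1 H2 H3 H4] := L.
have Ab : arr a C u b b = carry a C u b by rewrite /arr ltnn eqxx.
have Ab' : arr a C u b b.+1 = u b by rewrite /arr ltnNge leqnSn /= gtn_eqF.
have inlog : ([set label (carry a C u b); label (u b)] \in log') = (u b < carry a C u b).
  by have := H2 b b.+1; rewrite Ab Ab'; apply.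
have ne : carry a C u b != u b.
  by apply/eqP => E'; have := H1 b b.+1; rewrite Ab Ab' => /(_ E'); lia.
rewrite /= inlog.
have [lt|ge] := ltnP (carry a C u b) (u b).
  rewrite ltnNge (ltnW lt) andbF /=.
  exists ([set label (carry a C u b); label (u b)] :: log'); split.
    apply: log_spec_ext (_ : swap_at b (arr a C u b) =1 _) _; first by move=> i; rewrite arrS Cb lt.
    rewrite -Ab -Ab'; apply: log_spec_swap => //; rewrite ?Ab ?Ab' //; first exact: carry_ge.
    exact/ltnW/u_ge.
  rewrite /= ?lt; congr (_, _, _); apply/ffunP => b'; rewrite !ffunE ltnS.
  by case: (ltngtP b' b) => // ->; rewrite /row_out Cb lt.
case: real => [-> | /(_ b Cb)]; last by lia.
have lt' : u b < carry a C u b by rewrite ltn_neqAle eq_sym ne.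
rewrite lt' /=.
exists log'; split; first by apply: log_spec_ext L => i; rewrite arrS Cb ltnNge ge.
congr (_, _, _).
apply/ffunP => b'; rewrite !ffunE ltnS; case: (ltngtP b' b) => [b'b|bb'|b'b].
- by rewrite -val_eqE /= (ltn_eqF b'b).
- by rewrite -val_eqE /= (gtn_eqF bb').
- by rewrite -val_eqE /= b'b eqxx /row_out Cb ltnNge ge.
Qed.

Lemma trace_row_out : exists log', log_spec a (row_out a C u) log' /\
  trace_row ign P (v, log) a = ([ffun b' : 'I_n => label (row_out a C u b')], log').
Proof.
have [log' [[H1 H2 H3 H4] E]] := trace_row_sim (leqnn n).
have outn i : row_out a C u i < n -> i < n.
  by move=> h; rewrite ltnNge; apply/negP => ni; move: h; rewrite row_tail; lia.
exists log'; split.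
  split=> //; first exact: row_out_inj.
  move=> i j ij i_n j_n; have := H2 i j ij.
  by rewrite /arr (outn _ i_n) (outn _ j_n); apply.
rewrite /trace_row; move: E; rewrite take_oversize ?size_enum_ord // => ->.
by congr (_, _); apply/ffunP => b'; rewrite !ffunE ltn_ord.
Qed.

End OneRow.

Fixpoint rows_done P d : nat -> nat :=
  if d is d'.+1 then row_out (n - d) (mem_nat (row_set P (n - d))) (rows_done P d') else addn^~ n.

Lemma triangle_row P a : P \subset triangle n -> forall b, mem_nat (row_set P a) b -> (b + a).+1 < n.
Proof.
move=> /subsetP sP b /mem_natP[x <-]; rewrite inE => /exists_inP[[a' b'] /sP].
by rewrite inE /= => h /andP[/eqP <- /eqP <-]; rewrite addnC.
Qed.

(** Under this condition no cross is ever ignored, so the trace with [ign] false follows the same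
    numerical model. This is how the bottom pipe dream is shown to be reduced. *)
Definition all_real P : Prop := forall (a : 'I_n) b, mem_nat (row_set P a) b ->
  carry a (mem_nat (row_set P a)) (rows_done P (n - a.+1)) b < rows_done P (n - a.+1) b.

Lemma trace_sim ign P d : P \subset triangle n -> ign \/ all_real P -> d <= n ->
  [/\ injective (rows_done P d), forall i, n - d <= rows_done P d i,
    forall i, d <= i -> rows_done P d i = i + (n - d)
   & exists log, log_spec (n - d) (rows_done P d) log /\
    foldl (trace_row ign P) ([ffun=> None], [::]) (rev (drop (n - d) (enum 'I_n)))
    = ([ffun b : 'I_n => label (rows_done P d b)], log)].
Proof.
move=> sP hr; elim: d => [|d IH] dn.
  rewrite subn0; split=> //=.
  - by move=> i j /addIn.
  - by move=> i; rewrite leq_addl.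
  exists [::]; split.
    split=> //; first by move=> i j /addIn.
    by move=> i j _; lia.
  rewrite drop_oversize ?size_enum_ord //=; congr (_, _); apply/ffunP => b.
  by rewrite !ffunE /label insubF //; lia.
have [I G T [log [L E]]] := IH (ltnW dn).
have an : n - d.+1 < n by lia.
pose a : 'I_n := Ordinal an.
have aE : n - d = a.+1 by rewrite /a /=; lia.
have dE : n - a.+1 = d by rewrite /a /=; lia.
have tri : forall b, mem_nat (row_set P a) b -> (b + a).+1 < n by apply: triangle_row.
rewrite aE in G T L E.
have T' i : n - a.+1 <= i -> rows_done P d i = i + a.+1 by rewrite dE; apply: T.
have real : ign \/ forall b, mem_nat (row_set P a) b ->
    carry a (mem_nat (row_set P a)) (rows_done P d) b < rows_done P d b.
  by case: hr => [|hr]; [left | right=> b; have := hr a b; rewrite dE].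
rewrite /= -[n - d.+1]/(a : nat); split.
- exact: row_out_inj.
- by move=> i; apply: row_out_ge.
- by move=> i di; apply: row_tail => //; rewrite /a /=; lia.
rewrite foldl_rev_drop E.
by apply: trace_row_out => // b; rewrite ffunE.
Qed.

Lemma traceE ign P : P \subset triangle n -> ign \/ all_real P ->
  exists log, log_spec 0 (rows_done P n) log /\
    trace ign P = ([ffun b : 'I_n => label (rows_done P n b)], log).
Proof.
move=> sP hr; have [_ _ _ [log [L E]]] := trace_sim sP hr (leqnn n).
by rewrite subnn in L E; exists log; split=> //; rewrite /trace -E drop0.
Qed.

Lemma PipesE (w : 'S_n) P : (P \in Pipes w) =
  (P \subset triangle n) && [forall b : 'I_n, rows_done P n b == w b].
Proof.
rewrite inE; case: (boolP (P \subset triangle n)) => //= sP.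
have [log [_ ->]] := traceE sP (or_introl (isT : true)).
apply: eq_forallb => b /=; rewrite ffunE /label.
apply/eqP/eqP => [|->]; last by rewrite valK.
by case: insubP => // x _ <- [->].
Qed.

Lemma reduced_all_real P : P \subset triangle n -> all_real P -> reduced_pd P.
Proof.
move=> sP hr; rewrite /reduced_pd.
by have [log [[_ _ _ U] ->]] := traceE sP (or_intror hr : false \/ _).
Qed.

Fixpoint run P k (u : nat -> nat) : nat -> nat :=
  if k is a.+1 then run P a (row_out a (mem_nat (row_set P a)) u) else u.

Lemma run_rows_done P k : k <= n -> run P k (rows_done P (n - k)) = rows_done P n.
Proof.
elim: k => [|k IH] kn; first by rewrite subn0.
rewrite /= -(IH (ltnW kn)) (_ : n - k = (n - k.+1).+1) /=; last by lia.
by rewrite (_ : n - (n - k.+1).+1 = k) //; lia.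
Qed.

Lemma eq_run P P' k u : (forall a, a < k -> row_set P a = row_set P' a) -> run P k u = run P' k u.
Proof.
elim: k u => [//|k IH] u E /=; rewrite (E k) //; apply: IH => a ak.
by apply: E; apply: ltnW.
Qed.

End Simulation.

(** * From single rows to whole pipe dreams *)

Section CompletionsSum.
Local Open Scope ring_scope.
Variables (n : nat) (K : comNzRingType) (w : nat -> nat) (wt : nat -> {set 'I_n} -> K).
Implicit Types (P : {set box n}).

Definition upper_triangle k : {set box n} := [set c in triangle n | (c.1 < k)%N].
Definition in_row (a : 'I_n) (C : {set 'I_n}) : {set box n} := [set (a, b) | b in C].

Lemma mem_in_row a C (c : box n) : (c \in in_row a C) = (c.1 == a) && (c.2 \in C).
Proof.
apply/imsetP/andP => [[b bC ->]//|[/eqP E cC]]; exists c.2 => //.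
by rewrite -E -surjective_pairing.
Qed.

Lemma completions_sum k u : (k <= n)%N -> completions w wt k u =
  \sum_(P : {set box n} | P \subset upper_triangle k)
    (\prod_(a < k) wt a (row_set P a)) * [forall i : 'I_n, run P k u i == w i]%:R.
Proof.
elim: k u => [|k IH] u kn.
  rewrite (big_pred1 set0) ?big_ord0 ?mul1r // => P; rewrite /= -subset0.
  by rewrite (_ : upper_triangle 0 = set0) //; apply/setP => c; rewrite !inE ltn0 andbF.
pose a : 'I_n := Ordinal kn.
pose T : {set 'I_n} := [set b : 'I_n | (b + k).+1 < n]%N.
have -> : upper_triangle k.+1 = upper_triangle k :|: in_row a T.
  apply/setP => c; rewrite !inE mem_in_row !inE -val_eqE /= (ltnS c.1) (leq_eqVlt c.1).
  by case: eqP => [->|_]; rewrite ?ltnn ?andbT ?andbF ?orbF //= addnC.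
rewrite sum_subsetU; last first.
  rewrite disjoints_subset; apply/subsetP => c; rewrite !inE mem_in_row => /andP[_ ck].
  by rewrite -val_eqE /= (ltn_eqF ck).
rewrite exchange_big /= (reindex_onto (in_row a) (fun S => row_set S k)) /=; last first.
  move=> S /subsetP sS; apply/setP => c; rewrite mem_in_row.
  apply/andP/idP => [[/eqP E]|cS].
    by rewrite -[k]/(a : nat) mem_row_set -E -surjective_pairing.
  have := sS c cS; rewrite mem_in_row => /andP[/eqP E _]; rewrite E eqxx; split=> //.
  by rewrite -[k]/(a : nat) mem_row_set -E -surjective_pairing.
have rowC C : row_set (in_row a C) k = C.
  by apply/setP => b; rewrite -[k]/(a : nat) mem_row_set mem_in_row /= eqxx.
apply: eq_big => [C|C tC].
  rewrite rowC eqxx andbT; apply/forall_inP/subsetP => [H c|H b bC].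
    by rewrite !mem_in_row => /andP[-> /H]; rewrite inE.
  by have := H (a, b); rewrite !mem_in_row eqxx bC inE => /(_ isT).
rewrite IH ?(ltnW kn) // big_distrr /=; apply: eq_bigr => P sP.
have rowk : row_set (P :|: in_row a C) k = C.
  apply/setP => b; rewrite -[k]/(a : nat) mem_row_set inE mem_in_row /= eqxx /=.
  case: (boolP ((a, b) \in P)) => //= abP.
  by have := subsetP sP _ abP; rewrite inE /= ltnn andbF.
have rowlt i : (i < k)%N -> row_set (P :|: in_row a C) i = row_set P i.
  move=> ik; pose i' : 'I_n := Ordinal (ltn_trans ik kn).
  apply/setP => b; rewrite -[i]/(i' : nat) !mem_row_set inE mem_in_row /=.
  by rewrite -val_eqE /= (ltn_eqF ik) orbF.
rewrite big_ord_recr /= rowk (eq_run _ rowlt).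
have E : \prod_(i < k) wt i (row_set (P :|: in_row a C) i) = \prod_(i < k) wt i (row_set P i).
  by apply: eq_bigr => i _; rewrite rowlt.
by rewrite E mulrCA mulrA.
Qed.

End CompletionsSum.

(** * Reductions of noncrossing forests *)

Ltac removed_cases := first [by apply: Or31 | by apply: Or32 | by apply: Or33].

Section Forests.
Local Open Scope ring_scope.
Variable m : nat.
Local Notation edge := ('I_m * 'I_m)%type.
Implicit Types (F G b c : {set edge}) (i j k l : 'I_m) (vs : seq 'I_m).

(** The third clause is acyclicity in a local form: no edge under [(i, k)] leads across the gap
    after [g], so no path under it joins [i] to [k]. In this form it is inherited by subsets and
    easy to follow through a reduction. *)
Definition good_forest F : Prop :=
  [/\ forall i k, (i, k) \in F -> (i < k)%N,
      forall i j k l, (i < j)%N -> (j < k)%N -> (k < l)%N ->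
        (i, k) \in F -> (j, l) \in F -> False
    & forall i k, (i, k) \in F -> exists g : nat, [/\ (i <= g)%N, (g < k)%N &
        forall p q, (p, q) \in F -> (p, q) <> (i, k) -> (i <= p)%N -> (q <= k)%N ->
          (q <= g)%N \/ (g < p)%N]].

Definition is_top F j i k : Prop :=
  [/\ (i, j) \in F, (j, k) \in F,
      forall i', (i', j) \in F -> (i <= i')%N
    & forall k', (j, k') \in F -> (k' <= k)%N].

Definition no_pair F j : Prop := forall i k, (i, j) \in F -> (j, k) \in F -> False.

Definition upd F (e : edge) b : {set edge} := e |: (F :\: b).

Lemma good_forest_sub F G : G \subset F -> good_forest F -> good_forest G.
Proof.
move=> /subsetP sGF [inc nc gap]; split.
- by move=> i k /sGF /inc.
- by move=> i j k l ij jk kl /sGF iF /sGF; apply: nc iF.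
- move=> i k /sGF /gap [g [ig gk H]]; exists g; split=> // p q /sGF; exact: H.
Qed.

(** Both edges would have to avoid the gap under [(i, k)], but together they bridge it. Hence the
    variable created by a reduction is not yet present, and monomials stay squarefree. *)
Lemma good_forest_no_triangle F i j k :
  good_forest F -> (i, j) \in F -> (j, k) \in F -> (i, k) \notin F.
Proof.
case=> inc nc gap ijF jkF; apply/negP => ikF.
have [g [ig gk H]] := gap _ _ ikF.
have ij := inc _ _ ijF; have jk := inc _ _ jkF.
have [|] : (j <= g)%N \/ (g < i)%N.
- by apply: H (ijF) _ _ _ => //; [case=> /(congr1 val)/= ? ; lia | lia].
- have : (k <= g)%N \/ (g < j)%N.
    by apply: H (jkF) _ _ _ => //; [case=> /(congr1 val)/= ? ; lia | lia].
  by lia.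
- by lia.
Qed.

Lemma exists_top F j : no_pair F j \/ exists i k, is_top F j i k.
Proof.
case: (boolP [exists i, (i, j) \in F]) => [/existsP[i0 Hi0]|/existsPn H]; last first.
  by left=> i k ijF; move: (H i); rewrite ijF.
case: (boolP [exists k, (j, k) \in F]) => [/existsP[k0 Hk0]|/existsPn H]; last first.
  by left=> i k _ jkF; move: (H k); rewrite jkF.
right.
case: (@arg_minnP _ i0 (fun i => (i, j) \in F) (fun i => i : nat) Hi0) => i iF Hi.
case: (@arg_maxnP _ k0 (fun k => (j, k) \in F) (fun k => k : nat) Hk0) => k kF Hk.
by exists i, k; split.
Qed.

(** It suffices to remove one of the two edges. The new edge inherits the gap of the removed one,
    since each edge below it stays on one side of [j]. Under any other edge, [(i, j)] and [(j, k)]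
    share [j] and so lie on the same side of its gap, and [(i, k)] with them. *)
Lemma good_forest_upd F j i k b :
  good_forest F -> is_top F j i k -> (i, j) \in b \/ (j, k) \in b ->
  good_forest (upd F (i, k) b).
Proof.
move=> gF top hb.
suff H : forall e, e = (i, j) \/ e = (j, k) -> good_forest (upd F (i, k) [set e]).
  case: hb => hb; [apply: good_forest_sub (H _ (or_introl erefl))
                  | apply: good_forest_sub (H _ (or_intror erefl))];
    apply: setUS; apply: setDS; by rewrite sub1set.
move=> {b hb} e he; have [inc nc gap] := gF; have [ijF jkF mini maxk] := top.
have ij := inc _ _ ijF; have jk := inc _ _ jkF.
have ikF := good_forest_no_triangle gF ijF jkF.
have memE p q : (p, q) \in upd F (i, k) [set e] ->
   (p = i /\ q = k) \/ ((p, q) \in F /\ (p, q) <> e).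
  rewrite !inE => /orP[/eqP[-> ->]|/andP[/eqP ne pq]]; by [left|right].
have nij : (i, j) <> (j, k) by case=> /(congr1 val)/= ? _; lia.
split.
- by move=> p q /memE[[-> ->]|[/inc]] //; lia.
- move=> p q r s pq qr rs /memE[[pi rk]|[prF _]] /memE[[qi sk]|[qsF _]].
  + by rewrite rk sk in rs; lia.
  + rewrite rk in qr rs; rewrite pi in pq.
    have [jq|] := ltnP j q; first exact: (nc j q k s).
    rewrite leq_eqVlt => /orP[/eqP/val_inj E|qj].
      by have := maxk s; rewrite -E => /(_ qsF); lia.
    by apply: (nc i q j s) qsF => //; lia.
  + rewrite qi in pq qr; rewrite sk in rs.
    have [rj|] := ltnP r j; first exact: (nc p i r j).
    rewrite leq_eqVlt => /orP[/eqP/val_inj E|jr].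
      by have := mini p; rewrite E => /(_ prF); lia.
    by apply: (nc p j r k) jkF => //; lia.
  + exact: (nc p q r s) qsF.
- move=> p q /memE[[-> ->]|[pqF ne]].
  + have [g1 [ig1 g1j H1]] := gap _ _ ijF; have [g2 [jg2 g2k H2]] := gap _ _ jkF.
    (* An edge under [(i, k)] that straddles [j] crosses [(i, j)] or [(j, k)], unless it is [(i, k)]
       itself, which is absent. *)
    have split_edge r s : (r, s) \in F -> (i <= r)%N -> (s <= k)%N ->
        (s <= j)%N \/ (j <= r)%N.
      move=> rsF ir sk; have rs := inc _ _ rsF.
      have [?|sj] := leqP s j; first by left.
      have [?|rj] := leqP j r; first by right.
      exfalso; have [ir'|] := ltnP i r; first exact: (nc i r j s) rsF.
      move=> ri; have E : r = i by apply/val_inj/eqP; rewrite eqn_leq ri ir.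
      subst r; have [sk'|] := ltnP s k; first exact: (nc i j s k).
      move=> ks; have E : s = k by apply/val_inj/eqP; rewrite eqn_leq sk ks.
      by subst s; rewrite rsF in ikF.
    case: he memE => -> memE.
    * exists g1; split=> //; first by lia.
      move=> r s /memE[[-> ->] //|[rsF rsne]] _ ir sk.
      have [sj|jr] := split_edge _ _ rsF ir sk; last by lia.
      exact: H1.
    * exists g2; split=> //; first by lia.
      move=> r s /memE[[-> ->] //|[rsF rsne]] _ ir sk.
      have [sj|jr] := split_edge _ _ rsF ir sk; first by lia.
      exact: H2.
  + have [g [pg gq H]] := gap _ _ pqF; exists g; split=> // r s.
    move=> /memE[[-> ->]|[rsF _]] ne' pr sq; last exact: H.
    have [E1|/eqP n1] := eqVneq (i, j) (p, q).
      by case: E1 => _ E; rewrite -E in sq; lia.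
    have [E2|/eqP n2] := eqVneq (j, k) (p, q).
      by case: E2 => E _; rewrite -E in pr; lia.
    have := H _ _ ijF n1 pr; have := H _ _ jkF n2; lia.
Qed.

Lemma upd_comm F e1 e2 b c : e1 \notin c -> e2 \notin b ->
  upd (upd F e1 b) e2 c = upd (upd F e2 c) e1 b.
Proof.
move=> h1 h2; apply/setP => e; rewrite !inE.
have [->|_] := eqVneq e e1; first by rewrite h1 orbT.
have [->|_] := eqVneq e e2; first by rewrite h2.
by rewrite /= andbCA.
Qed.

Definition degree (P : pred edge) F : nat := #|[set e in F | P e]|.

Lemma degree_upd (P : pred edge) F e f b : ~~ P e -> f \in F -> f \in b -> P f ->
  (degree P (upd F e b) < degree P F)%N.
Proof.
move=> Pe fF fb Pf; apply: proper_card; apply/properP; split.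
  apply/subsetP => x; rewrite !inE => /andP[/orP[/eqP->|/andP[_ ->]] //].
  by rewrite (negPf Pe).
by exists f; rewrite !inE ?fF ?Pf // fb andbT orbF; apply: contra Pe => /eqP <-.
Qed.

Variables (K : comNzRingType) (ev : seq 'I_m -> {set edge} -> K).

Definition ev_sum j i k vs F : K :=
  ev vs (upd F (i, k) [set (j, k)]) + ev vs (upd F (i, k) [set (i, j)])
  + ev vs (upd F (i, k) [set (i, j); (j, k)]).

Hypothesis ev_none : forall j vs F, good_forest F -> no_pair F j ->
  ev (j :: vs) F = ev vs F.
Hypothesis ev_step : forall j vs F i k, good_forest F -> is_top F j i k ->
  ev (j :: vs) F = ev_sum j i k (j :: vs) F.

Definition incident j : pred edge := fun e => (e.1 == j) || (e.2 == j).

Definition removed j i k b : Prop :=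
  [\/ b = [set (j, k)], b = [set (i, j)] | b = [set (i, j); (j, k)]].

Lemma removed_in j i k b : removed j i k b -> (i, j) \in b \/ (j, k) \in b.
Proof. by case=> ->; rewrite !inE ?eqxx ?orbT; [right|left|left]. Qed.

Lemma removed_sub j i k b e : removed j i k b -> e \in b -> e = (i, j) \/ e = (j, k).
Proof.
case=> ->; rewrite !inE; [move/eqP=> ->|move/eqP=> ->|case/orP=> /eqP ->];
  by [left|right].
Qed.

Lemma eq_ev_sum j i k vs vs' F F' :
  (forall b, removed j i k b -> ev vs (upd F (i, k) b) = ev vs' (upd F' (i, k) b)) ->
  ev_sum j i k vs F = ev_sum j i k vs' F'.
Proof. by move=> H; rewrite /ev_sum !H; [|removed_cases..]. Qed.

Lemma degree_step j i k F b (P : pred edge) : good_forest F -> is_top F j i k ->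
  removed j i k b -> ~~ P (i, k) -> (forall e, incident j e -> P e) ->
  (degree P (upd F (i, k) b) < degree P F)%N.
Proof.
move=> gF [ijF jkF _ _] /removed_in hb Pik sP.
by case: hb => hb; [apply: (degree_upd (f := (i, j))) | apply: (degree_upd (f := (j, k)))];
  rewrite // sP // /incident /= eqxx ?orbT.
Qed.

Lemma no_incident_top j i k F : good_forest F -> is_top F j i k -> ~~ incident j (i, k).
Proof.
move=> [inc _ _] [/inc ij /inc jk _ _]; rewrite /incident /= negb_or -!val_eqE /=; lia.
Qed.

(** A reduction at [k] creates an edge into [j] only if [(k, j)] was present, and one out of [j]
    only if [(j, k)] was. So no pair ever arises at [j]. *)
Lemma ev_no_in_or_out j k vs F : good_forest F -> k != j ->
  (forall i, (i, j) \notin F) \/ (forall l, (j, l) \notin F) ->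
  ev (k :: j :: vs) F = ev (k :: vs) F.
Proof.
have [n] := ubnP (degree (incident k) F); elim: n F => // n IH F ltn gF kj H.
have npF G : (forall i, (i, j) \notin G) \/ (forall l, (j, l) \notin G) -> no_pair G j.
  by case=> HG p q; [move/negP: (HG p)|move/negP: (HG q)].
have [np|[i [l top]]] := exists_top F k.
  by rewrite ev_none // ev_none ?[in RHS]ev_none //; exact: npF.
rewrite !(ev_step _ gF top); apply: eq_ev_sum => b hb.
have nP := no_incident_top gF top.
apply: IH => //.
- exact: leq_trans (degree_step gF top hb nP (fun _ h => h)) ltn.
- exact: good_forest_upd gF top (removed_in hb).
case: top => ikF klF _ _.
case: H => H; [left=> p|right=> p]; rewrite !inE negb_or (negPf (H _)) andbF andbT.
  by apply/eqP => -[_ E]; move/negP: (H k); rewrite E.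
by apply/eqP => -[E _]; move/negP: (H k); rewrite E.
Qed.

(* A topmost pair at j not involving k survives the reductions at k. *)
Lemma ev_step_through j k vs F i l : good_forest F -> is_top F j i l ->
  i != k -> l != k -> k != j ->
  ev (k :: j :: vs) F = ev_sum j i l (k :: j :: vs) F.
Proof.
have [n] := ubnP (degree (incident k) F); elim: n F => // n IH F ltn gF top ik lk kj.
have gup b : removed j i l b -> good_forest (upd F (i, l) b).
  by move=> hb; apply: good_forest_upd gF top (removed_in hb).
have [ijF jlF mini maxl] := top; have [inc nc _] := gF.
have [np|[p [q topk]]] := exists_top F k.
  rewrite ev_none // (ev_step _ gF top); apply: eq_ev_sum => b hb.
  rewrite [RHS]ev_none //; first exact: gup.
  move=> p q; rewrite !inE !xpair_eqE => /orP[/andP[_ /eqP E]|/andP[_ pk]].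
    by rewrite -E eqxx in lk.
  move=> /orP[/andP[/eqP E _]|/andP[_ kq]]; last exact: np pk kq.
  by rewrite -E eqxx in ik.
have [pkF kqF minp maxq] := topk.
have nP := no_incident_top gF topk.
have np := inc _ _ pkF; have nq := inc _ _ kqF.
have cin c e : removed k p q c -> e \in c -> incident k e.
  by move=> hc /(removed_sub hc) [->|->]; rewrite /incident /= eqxx ?orbT.
have nij : ~~ incident k (i, j).
  by rewrite /incident /= negb_or ik eq_sym kj.
have njl : ~~ incident k (j, l) by rewrite /incident /= negb_or lk eq_sym kj.
have nil : ~~ incident k (i, l) by rewrite /incident /= negb_or lk ik.
have gupk c : removed k p q c -> good_forest (upd F (p, q) c).
  by move=> hc; apply: good_forest_upd gF topk (removed_in hc).
rewrite (ev_step _ gF topk).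
(* A new edge at [j] reaching beyond the topmost pair would come from an edge that crosses [(i, j)]
   or [(j, l)]. *)
have topc c : removed k p q c -> is_top (upd F (p, q) c) j i l.
  move=> hc; split.
  - by rewrite !inE ijF andbT; apply/orP; right; apply: contra nij; apply: cin.
  - by rewrite !inE jlF andbT; apply/orP; right; apply: contra njl; apply: cin.
  - move=> i'; rewrite !inE => /orP[/eqP[-> E]|/andP[_ /mini //]].
    subst q; have ik' := mini _ kqF.
    have ikl : (i < k)%N by rewrite ltn_neqAle val_eqE ik.
    by rewrite leqNgt; apply/negP => pi; apply: (nc p i k j).
  - move=> l'; rewrite !inE => /orP[/eqP[E ->]|/andP[_ /maxl //]].
    subst p; have kl' := maxl _ pkF.
    have kl : (k < l)%N by rewrite ltn_neqAle val_eqE eq_sym lk.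
    by rewrite leqNgt; apply/negP => lq; apply: (nc j k l q).
have pqb b : removed j i l b -> (p, q) \notin b.
  move=> hb; apply/negP => /(removed_sub hb) [] [E1 E2]; subst p q.
    by have := good_forest_no_triangle gF pkF kqF; rewrite ijF.
  by have := good_forest_no_triangle gF pkF kqF; rewrite jlF.
have ilc c : removed k p q c -> (i, l) \notin c.
  by move=> hc; apply: contra nil; apply: cin.
have E b : removed j i l b -> ev (k :: j :: vs) (upd F (i, l) b)
    = ev_sum k p q (k :: j :: vs) (upd F (i, l) b).
  move=> hb; apply: ev_step; first exact: gup.
  have bin e : e \in b -> incident k e = false.
    by move=> /(removed_sub hb) [->|->]; apply: negbTE.
  split.
  - by rewrite !inE pkF andbT; apply/orP; right; apply/negP => /bin; rewrite /incident /= eqxx orbT.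
  - by rewrite !inE kqF andbT; apply/orP; right; apply/negP => /bin; rewrite /incident /= eqxx.
  - move=> i'; rewrite !inE => /orP[/eqP[_ E]|/andP[_ /minp //]].
    by rewrite E eqxx in lk.
  - move=> l'; rewrite !inE => /orP[/eqP[E _]|/andP[_ /maxq //]].
    by rewrite E eqxx in ik.
have IHc c : removed k p q c -> ev (k :: j :: vs) (upd F (p, q) c)
    = ev_sum j i l (k :: j :: vs) (upd F (p, q) c).
  move=> hc; apply: IH => //; [|exact: gupk|exact: topc].
  exact: leq_trans (degree_step gF topk hc nP (fun _ h => h)) ltn.
rewrite {1}/ev_sum !IHc; [|removed_cases..].
rewrite {4}/ev_sum !E; [|removed_cases..].
have U b c : removed j i l b -> removed k p q c ->
    upd (upd F (p, q) c) (i, l) b = upd (upd F (i, l) b) (p, q) c.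
  by move=> hb hc; apply: upd_comm; [exact: pqb | exact: ilc].
rewrite /ev_sum !U; try removed_cases.
ring.
Qed.


Section Diamond.
Variables (F : {set edge}) (i j k l : 'I_m) (vs : seq 'I_m).
Hypotheses (gF : good_forest F) (topj : is_top F j i k) (topk : is_top F k j l).

Let P : pred edge := predU (incident j) (incident k).
(** The forests met in both orders: the path from [i] through [j] and [k] to [l] is replaced by
    [(i, l)] and a set [X], in the end a proper subset of the path. *)
Let B (X : {set edge}) : {set edge} :=
  (i, l) |: (X :|: (F :\: [set (i, j); (j, k); (k, l)])).

Let ijF : (i, j) \in F. Proof. by case: topj. Qed.
Let jkF : (j, k) \in F. Proof. by case: topj. Qed.
Let klF : (k, l) \in F. Proof. by case: topk. Qed.
Let ij : (i < j)%N. Proof. by case: gF => inc _ _; exact: inc. Qed.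
Let jk : (j < k)%N. Proof. by case: gF => inc _ _; exact: inc. Qed.
Let kl : (k < l)%N. Proof. by case: gF => inc _ _; exact: inc. Qed.
Let ikF : (i, k) \in F = false.
Proof. exact/negbTE/(good_forest_no_triangle gF ijF jkF). Qed.
Let jlF : (j, l) \in F = false.
Proof. exact/negbTE/(good_forest_no_triangle gF jkF klF). Qed.
Let ik : (i < k)%N. Proof. exact: ltn_trans jk. Qed.
Let jl : (j < l)%N. Proof. exact: ltn_trans kl. Qed.
Let il : (i < l)%N. Proof. exact: ltn_trans jl. Qed.
Let neq_lt (x y : 'I_m) : (x < y)%N -> ((x == y) = false) * ((y == x) = false).
Proof. by move=> xy; rewrite -!val_eqE /= (ltn_eqF xy) (gtn_eqF xy). Qed.
Let neqs := (neq_lt ij, neq_lt jk, neq_lt kl, neq_lt ik, neq_lt jl, neq_lt il).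
Let mems := (ijF, jkF, klF, ikF, jlF).

Ltac edge_case := rewrite ?inE ?xpair_eqE ?neqs ?mems ?eqxx ?andbT ?andbF ?orbT ?orbF.
Ltac edges := apply/setP; let e := fresh "e" in intro e; rewrite !inE;
  case: (eqVneq e (i, j)) => [->|_]; [by edge_case|];
  case: (eqVneq e (j, k)) => [->|_]; [by edge_case|];
  case: (eqVneq e (k, l)) => [->|_]; [by edge_case|];
  case: (eqVneq e (i, k)) => [->|_]; [by edge_case|];
  case: (eqVneq e (j, l)) => [->|_]; [by edge_case|];
  case: (eqVneq e (i, l)) => [->|_]; by edge_case.

Let BE1 : upd (upd F (i, k) [set (j, k)]) (i, l) [set (k, l)] = B [set (i, j); (i, k)].
Proof. edges. Qed.
Let BE2 : upd (upd F (i, k) [set (j, k)]) (i, l) [set (i, k)] = B [set (i, j); (k, l)].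
Proof. edges. Qed.
Let BE3 : upd (upd F (i, k) [set (j, k)]) (i, l) [set (i, k); (k, l)] = B [set (i, j)].
Proof. edges. Qed.
Let BE4 : upd (upd F (i, k) [set (i, j)]) (i, l) [set (k, l)] = B [set (j, k); (i, k)].
Proof. edges. Qed.
Let BE5 : upd (upd F (i, k) [set (i, j)]) (i, l) [set (i, k)] = B [set (j, k); (k, l)].
Proof. edges. Qed.
Let BE6 : upd (upd F (i, k) [set (i, j)]) (i, l) [set (i, k); (k, l)] = B [set (j, k)].
Proof. edges. Qed.
Let BE7 : upd (upd F (i, k) [set (i, j); (j, k)]) (i, l) [set (k, l)] = B [set (i, k)].
Proof. edges. Qed.
Let BE8 : upd (upd F (i, k) [set (i, j); (j, k)]) (i, l) [set (i, k)] = B [set (k, l)].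
Proof. edges. Qed.
Let BE9 : upd (upd F (i, k) [set (i, j); (j, k)]) (i, l) [set (i, k); (k, l)] = B set0.
Proof. edges. Qed.

Let BF1 : upd (upd F (j, l) [set (k, l)]) (i, l) [set (j, l)] = B [set (i, j); (j, k)].
Proof. edges. Qed.
Let BF2 : upd (upd F (j, l) [set (k, l)]) (i, l) [set (i, j)] = B [set (j, k); (j, l)].
Proof. edges. Qed.
Let BF3 : upd (upd F (j, l) [set (k, l)]) (i, l) [set (i, j); (j, l)] = B [set (j, k)].
Proof. edges. Qed.
Let BF4 : upd (upd F (j, l) [set (j, k)]) (i, l) [set (j, l)] = B [set (i, j); (k, l)].
Proof. edges. Qed.
Let BF5 : upd (upd F (j, l) [set (j, k)]) (i, l) [set (i, j)] = B [set (j, l); (k, l)].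
Proof. edges. Qed.
Let BF6 : upd (upd F (j, l) [set (j, k)]) (i, l) [set (i, j); (j, l)] = B [set (k, l)].
Proof. edges. Qed.
Let BF7 : upd (upd F (j, l) [set (j, k); (k, l)]) (i, l) [set (j, l)] = B [set (i, j)].
Proof. edges. Qed.
Let BF8 : upd (upd F (j, l) [set (j, k); (k, l)]) (i, l) [set (i, j)] = B [set (j, l)].
Proof. edges. Qed.
Let BF9 : upd (upd F (j, l) [set (j, k); (k, l)]) (i, l) [set (i, j); (j, l)] = B set0.
Proof. edges. Qed.

Let BG1 : upd (B [set (i, j); (j, k)]) (i, k) [set (j, k)] = B [set (i, j); (i, k)].
Proof. edges. Qed.
Let BG2 : upd (B [set (i, j); (j, k)]) (i, k) [set (i, j)] = B [set (j, k); (i, k)].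
Proof. edges. Qed.
Let BG3 : upd (B [set (i, j); (j, k)]) (i, k) [set (i, j); (j, k)] = B [set (i, k)].
Proof. edges. Qed.
Let BH1 : upd (B [set (j, k); (k, l)]) (j, l) [set (k, l)] = B [set (j, k); (j, l)].
Proof. edges. Qed.
Let BH2 : upd (B [set (j, k); (k, l)]) (j, l) [set (j, k)] = B [set (j, l); (k, l)].
Proof. edges. Qed.
Let BH3 : upd (B [set (j, k); (k, l)]) (j, l) [set (j, k); (k, l)] = B [set (j, l)].
Proof. edges. Qed.

Let topj' b : removed j i k b -> is_top (upd F (i, k) b) k i l.
Proof.
move=> hb; have [_ _ minj _] := topk; have [_ _ _ maxl] := topk.
have klb : (k, l) \notin b.
  by apply/negP => /(removed_sub hb) [] [/eqP]; rewrite neqs.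
split.
- by rewrite !inE eqxx.
- by rewrite !inE klF klb orbT.
- move=> i'; rewrite !inE => /orP[/eqP[-> //]|/andP[_ /minj]].
  by move=> h; apply: leq_trans h; apply: ltnW.
- by move=> l'; rewrite !inE => /orP[/eqP[/eqP]|/andP[_ /maxl //]]; rewrite neqs.
Qed.

Let topk' b : removed k j l b -> is_top (upd F (j, l) b) j i l.
Proof.
move=> hb; have [_ _ mini maxk] := topj.
have ijb : (i, j) \notin b.
  by apply/negP => /(removed_sub hb) [] [/eqP]; rewrite neqs.
split.
- by rewrite !inE ijF ijb orbT.
- by rewrite !inE eqxx.
- by move=> i'; rewrite !inE => /orP[/eqP[_ /eqP]|/andP[_ /mini //]]; rewrite neqs.
- move=> l'; rewrite !inE => /orP[/eqP[-> //]|/andP[_ /maxk]].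
  by move=> h; apply: leq_trans h _; apply: ltnW.
Qed.

Let gj b : removed j i k b -> good_forest (upd F (i, k) b).
Proof. by move=> hb; apply: good_forest_upd gF topj (removed_in hb). Qed.
Let gk b : removed k j l b -> good_forest (upd F (j, l) b).
Proof. by move=> hb; apply: good_forest_upd gF topk (removed_in hb). Qed.
Let gjk b c : removed j i k b -> removed k i l c ->
  good_forest (upd (upd F (i, k) b) (i, l) c).
Proof. by move=> hb hc; apply: good_forest_upd (gj hb) (topj' hb) (removed_in hc). Qed.
Let gkj b c : removed k j l b -> removed j i l c ->
  good_forest (upd (upd F (j, l) b) (i, l) c).
Proof. by move=> hb hc; apply: good_forest_upd (gk hb) (topk' hb) (removed_in hc). Qed.

Let topB1 : is_top (B [set (i, j); (j, k)]) j i k.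
Proof.
have [_ _ mini maxk] := topj; split; rewrite /B.
- by rewrite !inE eqxx orbT.
- by rewrite !inE eqxx !orbT.
- move=> i'; rewrite !inE !xpair_eqE !neqs !andbF /= eqxx !andbT orbF.
  by move=> /orP[/eqP-> //|/andP[_ /mini]].
- move=> k'; rewrite !inE !xpair_eqE !neqs !eqxx /= .
  by move=> /orP[/eqP-> //|/andP[_ /maxk]].
Qed.
Let topB2 : is_top (B [set (j, k); (k, l)]) k j l.
Proof.
have [_ _ mini maxk] := topk; split; rewrite /B.
- by rewrite !inE !eqxx /= ?orbT.
- by rewrite !inE !eqxx /= ?orbT.
- move=> i'; rewrite !inE !xpair_eqE !neqs !andbF /= eqxx !andbT ?orbF.
  by move=> /orP[/eqP-> //|/andP[_ /mini]].
- move=> k'; rewrite !inE !xpair_eqE !neqs !eqxx /= .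
  by move=> /orP[/eqP-> //|/andP[_ /maxk]].
Qed.

Let degB (X : {set edge}) : X \subset [set (i, j); (j, k); (k, l)] ->
  ~~ ([set (i, j); (j, k); (k, l)] \subset X) -> (degree P (B X) < degree P F)%N.
Proof.
move=> /subsetP sX /subsetPn[x xN xX].
have Px : P x by move: xN; rewrite !inE => /orP[/orP[]|] /eqP->;
  rewrite /P /= /incident /= eqxx ?orbT.
have xF : x \in F by move: xN; rewrite !inE => /orP[/orP[]|] /eqP->.
apply: proper_card; apply/properP; split.
  apply/subsetP => y; rewrite inE => /andP[yB Py]; rewrite inE Py andbT.
  move: yB; rewrite !inE => /orP[/eqP E|/orP[/sX|/andP[] //]].
    by move: Py; rewrite E /P /= /incident /= !neqs.
  by rewrite !inE => /orP[/orP[]|] /eqP->; rewrite ?mems.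
exists x; first by rewrite inE xF.
rewrite inE Px andbT !inE (negPf xX) orFb.
move: xN; rewrite !inE => /orP[/orP[]|] /eqP->; by rewrite !xpair_eqE !neqs !eqxx /= ?orbT.
Qed.

(** Either order yields nine forests. With [j] first, the three that contain [(i, k)] recombine to
    the reduction at [j] of the forest with [X] consisting of [(i, j)] and [(j, k)]; with [k] first,
    those containing [(j, l)] do so for [(j, k)] and [(k, l)]. Both times the sum over the seven
    proper subsets of the path is left. *)
Lemma diamond :
  (forall G, good_forest G -> (degree P G < degree P F)%N ->
     ev (j :: k :: vs) G = ev (k :: j :: vs) G) ->
  ev (j :: k :: vs) F = ev (k :: j :: vs) F.
Proof.
move=> IH.
have nij : i != j by rewrite neqs.
have nlj : l != j by rewrite neqs.
have nik : i != k by rewrite neqs.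
have nlk : l != k by rewrite neqs.
have njk : j != k by rewrite neqs.
have nkj : k != j by rewrite neqs.
have stj b : removed j i k b -> ev (j :: k :: vs) (upd F (i, k) b)
    = ev_sum k i l (j :: k :: vs) (upd F (i, k) b).
  by move=> hb; apply: ev_step_through (gj hb) (topj' hb) nij nlj njk.
have stk b : removed k j l b -> ev (k :: j :: vs) (upd F (j, l) b)
    = ev_sum j i l (k :: j :: vs) (upd F (j, l) b).
  by move=> hb; apply: ev_step_through (gk hb) (topk' hb) nik nlk nkj.
have L : ev (j :: k :: vs) F = ev (j :: k :: vs) (B [set (i, j); (j, k)])
   + ev (j :: k :: vs) (B [set (i, j); (k, l)]) + ev (j :: k :: vs) (B [set (i, j)])
   + ev (j :: k :: vs) (B [set (j, k); (k, l)]) + ev (j :: k :: vs) (B [set (j, k)])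
   + ev (j :: k :: vs) (B [set (k, l)]) + ev (j :: k :: vs) (B set0).
  rewrite (ev_step _ gF topj) {1}/ev_sum !stj; [|removed_cases..].
  have -> : ev (j :: k :: vs) (B [set (i, j); (j, k)])
      = ev_sum j i k (j :: k :: vs) (B [set (i, j); (j, k)]).
    by apply: ev_step topB1; rewrite -BF1; apply: gkj; removed_cases.
  rewrite /ev_sum BE1 BE2 BE3 BE4 BE5 BE6 BE7 BE8 BE9 BG1 BG2 BG3; ring.
have R : ev (k :: j :: vs) F = ev (k :: j :: vs) (B [set (i, j); (j, k)])
   + ev (k :: j :: vs) (B [set (i, j); (k, l)]) + ev (k :: j :: vs) (B [set (i, j)])
   + ev (k :: j :: vs) (B [set (j, k); (k, l)]) + ev (k :: j :: vs) (B [set (j, k)])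
   + ev (k :: j :: vs) (B [set (k, l)]) + ev (k :: j :: vs) (B set0).
  rewrite (ev_step _ gF topk) {1}/ev_sum !stk; [|removed_cases..].
  have -> : ev (k :: j :: vs) (B [set (j, k); (k, l)])
      = ev_sum k j l (k :: j :: vs) (B [set (j, k); (k, l)]).
    by apply: ev_step topB2; rewrite -BE5; apply: gjk; removed_cases.
  rewrite /ev_sum BF1 BF2 BF3 BF4 BF5 BF6 BF7 BF8 BF9 BH1 BH2 BH3; ring.
have H (X : {set edge}) : good_forest (B X) -> X \subset [set (i, j); (j, k); (k, l)] ->
    ~~ ([set (i, j); (j, k); (k, l)] \subset X) ->
    ev (j :: k :: vs) (B X) = ev (k :: j :: vs) (B X).
  by move=> gB sX nX; apply: IH gB (degB sX nX).
rewrite L R !H //; try by rewrite ?subUset ?sub1set !inE ?xpair_eqE ?neqs ?eqxx.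
all: try by rewrite ?sub0set ?subUset ?sub1set !inE ?xpair_eqE ?neqs ?eqxx.
all: first [exact: sub0set | by rewrite -BE9; apply: gjk; removed_cases | by rewrite -BE8; apply: gjk; removed_cases
  | by rewrite -BE6; apply: gjk; removed_cases | by rewrite -BE5; apply: gjk; removed_cases
  | by rewrite -BE3; apply: gjk; removed_cases | by rewrite -BE2; apply: gjk; removed_cases
  | by rewrite -BF1; apply: gkj; removed_cases].
Qed.
End Diamond.

(** If the topmost pair at one vertex avoids the other vertex, then [ev_step_through] lets it be
    reduced first in both orders, and fewer edges at [j] and [k] remain. Vertices without a pair
    stay so; the last case is a path through both, that is [diamond]. *)
Lemma ev_swap_lt j k vs F : good_forest F -> (j < k)%N ->
  ev (j :: k :: vs) F = ev (k :: j :: vs) F.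
Proof.
set P := predU (incident j) (incident k).
have [n] := ubnP (degree P F); elim: n F => // n IH F ltn gF jk.
have jnk : j != k by rewrite -val_eqE neq_ltn jk.
have knj : k != j by rewrite eq_sym.
have [inc _ _] := gF.
have lower v i l b : is_top F v i l -> removed v i l b -> ~~ P (i, l) ->
    (forall e, incident v e -> P e) ->
    ev (j :: k :: vs) (upd F (i, l) b) = ev (k :: j :: vs) (upd F (i, l) b).
  move=> top hb nP sP; apply: IH => //.
    exact: leq_trans (degree_step gF top hb nP sP) ltn.
  exact: good_forest_upd gF top (removed_in hb).
have in_or_out v : no_pair F v ->
    (forall i, (i, v) \notin F) \/ (forall l, (v, l) \notin F).
  move=> np; case: (boolP [exists i, (i, v) \in F]) => [/existsP[i iv]|/existsPn]; last by left.
  by right=> l; apply/negP; apply: np iv.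
have [np|[i [l topj]]] := exists_top F j.
  by rewrite ev_none // ev_no_in_or_out //; exact: in_or_out.
have [ijF jlF _ maxl] := topj; have ij := inc _ _ ijF; have jl := inc _ _ jlF.
have ik : i != k by rewrite -val_eqE neq_ltn (ltn_trans ij jk).
have [lk|lk] := eqVneq l k; last first.
  rewrite (ev_step _ gF topj) [RHS](ev_step_through _ gF topj) //.
  apply: eq_ev_sum => b hb; apply: (lower _ _ _ _ topj hb).
    by rewrite /P /= negb_or (no_incident_top gF topj) /incident /= negb_or ik lk.
  by move=> e; rewrite /P /= => ->.
subst l.
have [np|[p [q topk]]] := exists_top F k.
  by rewrite [RHS]ev_none // ev_no_in_or_out //; exact: in_or_out.
have [pkF kqF minp _] := topk; have pk := inc _ _ pkF; have kq := inc _ _ kqF.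
have qj : q != j by rewrite -val_eqE neq_ltn (ltn_trans jk kq) orbT.
have [pj|pj] := eqVneq p j; last first.
  rewrite [RHS](ev_step _ gF topk) (ev_step_through _ gF topk) //.
  apply: eq_ev_sum => b hb; apply: (lower _ _ _ _ topk hb).
    by rewrite /P /= negb_or (no_incident_top gF topk) /incident /= negb_or pj qj.
  by move=> e; rewrite /P /= => ->; rewrite orbT.
subst p; apply: (diamond (i := i) (l := q)) => //.
by move=> G gG dG; apply: IH => //; apply: leq_trans dG ltn.
Qed.


Lemma ev_swap j k vs F : good_forest F -> ev (j :: k :: vs) F = ev (k :: j :: vs) F.
Proof.
move=> gF; case: (ltngtP j k) => [jk|kj|/val_inj-> //]; first exact: ev_swap_lt.
by rewrite -ev_swap_lt.
Qed.

Lemma ev_cons_eq j vs vs' F : good_forest F ->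
  (forall G, good_forest G -> ev vs G = ev vs' G) -> ev (j :: vs) F = ev (j :: vs') F.
Proof.
move=> gF E; have [n] := ubnP (degree (incident j) F).
elim: n F gF => // n IH F gF ltn.
have [np|[i [k top]]] := exists_top F j; first by rewrite !ev_none // E.
rewrite !(ev_step _ gF top); apply: eq_ev_sum => b hb; apply: IH.
  exact: good_forest_upd gF top (removed_in hb).
exact: leq_trans (degree_step gF top hb (no_incident_top gF top) (fun _ h => h)) ltn.
Qed.

Lemma ev_rev vs F : good_forest F -> ev (rev vs) F = ev vs F.
Proof.
elim: vs F => [//|j vs IH] F gF.
rewrite rev_cons -(@ev_cons_eq j (rev vs) vs) //; last first.
elim: {IH vs} (rev vs) F gF => [//|k vs IH] F gF /=.
rewrite [RHS]ev_swap //; apply: ev_cons_eq => //.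
Qed.

End Forests.

(** * From reductions of polynomials to reductions of forests *)

Section ReduceLinear.
Import BigEnough.
Local Open Scope ring_scope.
Variable m : nat.
Local Notation edge := ('I_m * 'I_m)%type.
Local Notation E i j := (mxvec_index i j).
Implicit Types (p q : {mpoly {poly rat}[m * m]}) (j : 'I_m) (vs : seq 'I_m).

(** The support of a polynomial varies with it; a common bound on the degrees gives a fixed index
    set, over which linearity is visible. *)
Lemma reduce_atE p j k : (msize p <= k)%N ->
  reduce_at p j = \sum_(M : 'X_{1..(m * m) < k}) p@_M *: reduce_monomial (mdeg M) j M.
Proof.
move=> le_pk; set I : subFinType _ := 'X_{1..(m * m) < k}.
rewrite /reduce_at (big_mksub I) ?msupp_uniq //=; first last.
  by move=> x /msize_mdeg_lt /leq_trans; apply.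
by rewrite big_rmcond //= => M /memN_msupp_eq0 ->; rewrite scale0r.
Qed.

Lemma reduce_atD p q j : reduce_at (p + q) j = reduce_at p j + reduce_at q j.
Proof.
pose_big_enough k.
  rewrite !(@reduce_atE _ _ k) // -big_split; apply: eq_bigr => M _ /=.
  by rewrite mcoeffD scalerDl.
by close.
Qed.

Lemma reduce_atZ c p j : reduce_at (c *: p) j = c *: reduce_at p j.
Proof.
pose_big_enough k.
  rewrite !(@reduce_atE _ _ k) // scaler_sumr; apply: eq_bigr => M _ /=.
  by rewrite mcoeffZ scalerA.
by close.
Qed.

Lemma reduce_atX M j : reduce_at 'X_[M] j = reduce_monomial (mdeg M) j M.
Proof. by rewrite /reduce_at msuppX big_seq1 mcoeffX eqxx scale1r. Qed.

Lemma foldl_reduceD p q vs :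
  foldl (@reduce_at m) (p + q) vs = foldl (@reduce_at m) p vs + foldl (@reduce_at m) q vs.
Proof. by elim: vs p q => //= j vs IH p q; rewrite reduce_atD IH. Qed.

Lemma foldl_reduceZ c p vs :
  foldl (@reduce_at m) (c *: p) vs = c *: foldl (@reduce_at m) p vs.
Proof. by elim: vs p => //= j vs IH p; rewrite reduce_atZ IH. Qed.

Definition set_mnm (F : {set edge}) : 'X_{1..m * m} := (\sum_(e in F) U_(E e.1 e.2))%MM.

Lemma mxvec_index_eq (e f : edge) : (E e.1 e.2 == E f.1 f.2) = (e == f).
Proof.
apply/eqP/eqP => [|-> //]; rewrite /mxvec_index => /cast_ord_inj /enum_rank_inj.
by rewrite -!surjective_pairing.
Qed.

Lemma set_mnmE F i j : set_mnm F (E i j) = ((i, j) \in F).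
Proof.
rewrite /set_mnm mnm_sumE.
rewrite (eq_bigr (fun e => ((i, j) == e) : nat)) => [|e _]; last first.
  by rewrite mnm1E (mxvec_index_eq e (i, j)) eq_sym.
case: (boolP ((i, j) \in F)) => ijF.
  rewrite (bigD1 (i, j)) //= eqxx big1 // => e /andP[_ ne].
  by rewrite eq_sym (negPf ne).
by rewrite big1 // => e eF; case: eqP => // Ee; rewrite Ee eF in ijF.
Qed.

Lemma mdeg_set_mnm F : mdeg (set_mnm F) = #|F|.
Proof.
by rewrite /set_mnm mdeg_sum (eq_bigr (fun=> 1%N)) ?sum1_card // => e _; rewrite mdeg1.
Qed.

Lemma in_nbrs_set_mnm F i j : good_forest F -> (i \in in_nbrs (set_mnm F) j) = ((i, j) \in F).
Proof.
case=> inc _ _; rewrite inE set_mnmE lt0b.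
by case: (boolP ((i, j) \in F)) => [/inc ->|]; rewrite ?andbF.
Qed.

Lemma out_nbrs_set_mnm F j k : good_forest F -> (k \in out_nbrs (set_mnm F) j) = ((j, k) \in F).
Proof.
case=> inc _ _; rewrite inE set_mnmE lt0b.
by case: (boolP ((j, k) \in F)) => [/inc ->|]; rewrite ?andbF.
Qed.

Lemma topmost_set_mnm_none F j : good_forest F -> no_pair F j -> topmost (set_mnm F) j = None.
Proof.
move=> gF np; rewrite /topmost; case: pickP => // -[i k] /= /and4P[].
by rewrite in_nbrs_set_mnm // out_nbrs_set_mnm // => ijF jkF; have := np _ _ ijF jkF.
Qed.

Lemma topmost_set_mnm F j i k : good_forest F -> is_top F j i k ->
  topmost (set_mnm F) j = Some (i, k).
Proof.
move=> gF [ijF jkF mini maxk]; rewrite /topmost; case: pickP => [[i' k'] /=|/(_ (i, k))/=].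
  rewrite in_nbrs_set_mnm // out_nbrs_set_mnm // => /and4P[ij' jk' /forall_inP H1 /forall_inP H2].
  congr (Some (_, _)); apply/val_inj/eqP; rewrite eqn_leq.
    by rewrite mini // H1 // in_nbrs_set_mnm.
  by rewrite maxk // H2 // out_nbrs_set_mnm.
rewrite in_nbrs_set_mnm // out_nbrs_set_mnm // ijF jkF /= => /negbT/negP[]; apply/andP; split.
  by apply/forall_inP => i'; rewrite in_nbrs_set_mnm //; apply: mini.
by apply/forall_inP => k'; rewrite out_nbrs_set_mnm //; apply: maxk.
Qed.

Section Step.
Variables (F : {set edge}) (i j k : 'I_m).
Hypotheses (gF : good_forest F) (top : is_top F j i k).
Let N := (set_mnm F - U_(E i j) - U_(E j k) + U_(E i k))%MM.

Let facts : [/\ (i, j) \in F, (j, k) \in F, (i, k) \notin F & (i < j < k)%N].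
Proof.
case: top (gF) => ijF jkF _ _ [inc _ _]; split => //.
  exact: good_forest_no_triangle gF ijF jkF.
by rewrite (inc _ _ ijF) (inc _ _ jkF).
Qed.

Let neqs : ((i == j) = false) * ((j == i) = false) * ((j == k) = false) * ((k == j) = false).
Proof.
case: facts => _ _ _ /andP[ij jk].
by rewrite -!val_eqE /= (ltn_eqF ij) (gtn_eqF ij) (ltn_eqF jk) (gtn_eqF jk).
Qed.

Let ijF : (i, j) \in F. Proof. by case: facts. Qed.
Let jkF : (j, k) \in F. Proof. by case: facts. Qed.
Let ikF : (i, k) \notin F. Proof. by case: facts. Qed.

Ltac step := apply/mnmP; let x := fresh "x" in let p := fresh "p" in let q := fresh "q" in
  intro x; destruct (mxvec_indexP x) as [p q];
  rewrite !(mnmDE, mnmBE, mnm1E) !set_mnmE;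
  rewrite !(mxvec_index_eq (_, _) (_, _)) !inE;
  rewrite ![(_, _) == (p, q)]eq_sym;
  case: (eqVneq (p, q) (i, j)) => [->|_]; [by rewrite ijF !xpair_eqE !neqs ?andbF ?eqxx|];
  case: (eqVneq (p, q) (j, k)) => [->|_]; [by rewrite jkF !xpair_eqE !neqs ?andbF ?eqxx|];
  case: (eqVneq (p, q) (i, k)) => [->|_]; [by rewrite (negPf ikF)|];
  by rewrite ?subn0 ?addn0.

Lemma set_mnm_upd1 : (N + U_(E i j))%MM = set_mnm (upd F (i, k) [set (j, k)]).
Proof. step. Qed.
Lemma set_mnm_upd2 : (N + U_(E j k))%MM = set_mnm (upd F (i, k) [set (i, j)]).
Proof. step. Qed.
Lemma set_mnm_upd3 : N = set_mnm (upd F (i, k) [set (i, j); (j, k)]).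
Proof. step. Qed.

End Step.

(** Each reduction at [j] lowers the number of edges there, so any fuel not below this number gives
    the same result. *)
Lemma reduce_monomial_fuel f f' j F : good_forest F ->
  (degree (incident j) F <= f)%N -> (degree (incident j) F <= f')%N ->
  reduce_monomial f j (set_mnm F) = reduce_monomial f' j (set_mnm F).
Proof.
elim: f f' F => [|f IH] f' F gF.
  rewrite leqn0 => /eqP d0 _; case: (exists_top F j) => [np|[i [k [ijF _ _ _]]]].
    by case: f' => [|f'] //=; rewrite topmost_set_mnm_none.
  by have /card0_eq/(_ (i, j)) := d0; rewrite !inE ijF /incident /= eqxx orbT.
move=> df df'; case: (exists_top F j) => [np|[i [k top]]].
  by case: f' {df'} => [|f'] /=; rewrite topmost_set_mnm_none.
have nP := no_incident_top gF top.
have lt b : removed j i k b -> (degree (incident j) (upd F (i, k) b) < degree (incident j) F)%N.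
  by move=> hb; apply: degree_step gF top hb nP _.
have g b : removed j i k b -> good_forest (upd F (i, k) b).
  by move=> hb; apply: good_forest_upd gF top (removed_in hb).
case: f' df' => [|f'] df'.
  by have := lt _ (Or31 _ _ erefl); rewrite ltnNge (leq_trans df').
rewrite /= (topmost_set_mnm gF top) set_mnm_upd1 // set_mnm_upd2 // set_mnm_upd3 //.
congr (_ + _ + _ *: _); apply: IH; try (by apply: g; removed_cases);
  rewrite -ltnS; apply: leq_trans (lt _ _) _ => //; removed_cases.
Qed.

Section Evaluation.
Variables (K : comNzRingType) (Phi : {additive {mpoly {poly rat}[m * m]} -> K})
  (val : edge -> K).
Hypotheses (PhiZ : forall p, Phi (@beta *: p) = - Phi p)
  (PhiX : forall F, Phi 'X_[set_mnm F] = \prod_(e in F) val e).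

(* The sign makes every coefficient of the reduction rule equal to 1. *)
Definition ev_tree vs (F : {set edge}) : K :=
  (-1) ^+ #|F| * Phi (foldl (@reduce_at m) 'X_[set_mnm F] vs).

Lemma ev_tree_nil F : ev_tree [::] F = \prod_(e in F) - val e.
Proof. by rewrite /ev_tree /= PhiX -prodrN. Qed.

Lemma ev_tree_none j vs F : good_forest F -> no_pair F j ->
  ev_tree (j :: vs) F = ev_tree vs F.
Proof.
move=> gF np; rewrite /ev_tree /= reduce_atX.
by case: (mdeg _) => [|f] //=; rewrite topmost_set_mnm_none.
Qed.

Lemma card_upd (F : {set edge}) e (b : {set edge}) : e \notin F -> b \subset F -> #|upd F e b| = (#|F| - #|b|).+1.
Proof.
move=> eF bF; rewrite /upd cardsU1 !inE (negPf eF) andbF add1n; congr _.+1.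
by rewrite cardsD (setIidPr bF).
Qed.

Lemma ev_tree_step j vs F i k : good_forest F -> is_top F j i k ->
  ev_tree (j :: vs) F = ev_sum ev_tree j i k (j :: vs) F.
Proof.
move=> gF top; have [ijF jkF _ _] := top.
have ikF := good_forest_no_triangle gF ijF jkF.
have nP := no_incident_top gF top.
have [inc _ _] := gF.
have cF : (1 < #|F|)%N.
  have -> : 2%N = #|[set (i, j); (j, k)]|.
    rewrite cards2 xpair_eqE -val_eqE (ltn_eqF (inc _ _ ijF)) //.
  by apply: subset_leq_card; rewrite subUset !sub1set ijF.
have lt b : removed j i k b -> (degree (incident j) (upd F (i, k) b) < degree (incident j) F)%N.
  by move=> hb; apply: degree_step gF top hb nP _.
have g b : removed j i k b -> good_forest (upd F (i, k) b).
  by move=> hb; apply: good_forest_upd gF top (removed_in hb).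
have dF G : (degree (incident j) G <= #|G|)%N.
  by apply/subset_leq_card/subsetP => e; rewrite inE => /andP[].
have [c1 c2 c3] : [/\ #|upd F (i, k) [set (j, k)]| = #|F|, #|upd F (i, k) [set (i, j)]| = #|F|
    & #|upd F (i, k) [set (i, j); (j, k)]| = #|F|.-1].
  rewrite !card_upd ?subUset ?sub1set ?ijF ?jkF // !cards1 cards2.
  rewrite xpair_eqE -val_eqE (ltn_eqF (inc _ _ ijF)) /=; by split; move: cF; move: #|F| => c cF; lia.
rewrite /ev_sum /ev_tree /= !reduce_atX !mdeg_set_mnm c1 c2 c3.
have -> : #|F| = #|F|.-1.+1 by lia.
rewrite [in LHS]/= (topmost_set_mnm gF top) set_mnm_upd1 // set_mnm_upd2 // set_mnm_upd3 //.
(* The recursive calls run with fuel [#|F|.-1], whereas reducing their monomials afresh takes the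
   degrees, [#|F|] twice and [#|F|.-1] once. *)
have E b : removed j i k b -> forall f, (#|F|.-1 <= f)%N ->
    reduce_monomial #|F|.-1 j (set_mnm (upd F (i, k) b))
    = reduce_monomial f j (set_mnm (upd F (i, k) b)).
  move=> hb f hf; have := lt b hb; have := dF F => h1 h2.
  by apply: reduce_monomial_fuel; [exact: g | lia | lia].
rewrite (E _ (Or31 _ _ erefl) #|F|.-1.+1) // (E _ (Or32 _ _ erefl) #|F|.-1.+1) //.
rewrite !foldl_reduceD foldl_reduceZ !raddfD /= PhiZ !mulrDr exprS.
ring.
Qed.

End Evaluation.
End ReduceLinear.

(** * Edges that take no further part *)

Section Inert.
Local Open Scope ring_scope.
Variables (m : nat) (K : comNzRingType) (ev : seq 'I_m -> {set 'I_m * 'I_m} -> K)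
  (yv : 'I_m * 'I_m -> K).
Hypotheses
  (ev_nil : forall F, ev [::] F = \prod_(e in F) yv e)
  (ev_none : forall j vs F, good_forest F -> no_pair F j -> ev (j :: vs) F = ev vs F)
  (ev_step : forall j vs F i k, good_forest F -> is_top F j i k ->
     ev (j :: vs) F = ev_sum ev j i k (j :: vs) F).

(** The edge enters no later pair: not as the outgoing edge, since [i] is not to be reduced any
    more, and not as the incoming one, since [k] is not either or has no outgoing edge. Reductions
    elsewhere do not change this. *)
Lemma ev_inert vs F i k : good_forest F -> (i, k) \in F -> i \notin vs ->
  k \notin vs \/ (forall l, (k, l) \notin F) ->
  ev vs F = yv (i, k) * ev vs (F :\ (i, k)).
Proof.
elim: vs F => [|v vs IHvs] F gF ikF; first by move=> _ _; rewrite !ev_nil (big_setD1 (i, k)).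
rewrite inE negb_or => /andP[iv ivs].
have [n] := ubnP (degree (incident v) F); elim: n F gF ikF => // n IH F gF ikF ltn hk.
have gF' : good_forest (F :\ (i, k)) by apply: good_forest_sub gF; exact: subsetDl.
have [np|[p [q top]]] := exists_top F v.
  rewrite !ev_none //; last by move=> p q; rewrite !inE => /andP[_ pv] /andP[_]; exact: np pv.
  by apply: IHvs => //; case: hk => [|H]; [rewrite inE negb_or => /andP[_]; left|right].
have [pvF vqF minp maxq] := top.
have ne1 : (p, v) != (i, k).
  apply/eqP => -[_ E]; case: hk => [|H]; first by rewrite -E mem_head.
  by have := H q; rewrite -E vqF.
have ne2 : (v, q) != (i, k) by apply: contra iv => /eqP[->].
have pqF := good_forest_no_triangle gF pvF vqF.
have ne3 : (p, q) != (i, k) by apply: contraNneq pqF => ->.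
have top' : is_top (F :\ (i, k)) v p q.
  split; rewrite ?inE ?ne1 ?ne2 //.
    by move=> p'; rewrite inE => /andP[_ /minp].
  by move=> q'; rewrite inE => /andP[_ /maxq].
rewrite (ev_step _ gF top) (ev_step _ gF' top').
have E b : removed v p q b -> ev (v :: vs) (upd F (p, q) b)
    = yv (i, k) * ev (v :: vs) (upd (F :\ (i, k)) (p, q) b).
  move=> hb.
  have ikb : (i, k) \notin b.
    by apply/negP => /(removed_sub hb) [] E; rewrite -E eqxx in ne1 ne2.
  rewrite IH; last first.
  - case: hk => [|H]; [by left|right=> l].
    rewrite !inE negb_or (negPf (H l)) andbF andbT.
    by apply/eqP => -[E _]; have := H v; rewrite E pvF.
  - exact: leq_trans (degree_step gF top hb (no_incident_top gF top) (fun _ h => h)) ltn.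
  - by rewrite !inE ikF ikb orbT.
  - exact: good_forest_upd gF top (removed_in hb).
  congr (_ * ev _ _); apply/setP => e; rewrite !inE.
  have [->|_] := eqVneq e (i, k); first by rewrite eq_sym (negPf ne3) andbF.
  by [].
rewrite /ev_sum !E ?mulrDr //; removed_cases.
Qed.

End Inert.

(** * Reduction along the vertices *)

Section Transfer.
Local Open Scope ring_scope.
Variables (n : nat) (K : comNzRingType) (lam : nat -> nat) (yb : nat -> nat -> K).
Local Notation Z := (@Zsum n K lam yb).

Lemma mem_nat_set (P : pred nat) i : (i < n)%N -> mem_nat [set x : 'I_n | P x] i = P i.
Proof. by move=> i_n; rewrite -[i]/(val (Ordinal i_n)) mem_natE inE. Qed.

(** Row 0 requires column 0, and a lost column 0 is never restored, as [far] contains positive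
    columns only. *)
Lemma Zsum_no0 a (L : {set 'I_n}) : (0 < n)%N -> mem_nat L 0%N = false -> Z a L = 0.
Proof.
move=> n0; elim: a L => [|a IH] L L0 /=; first by rewrite L0 mul0r.
rewrite big1 // => c _.
have H (M : {set 'I_n}) : M \subset L -> mem_nat (M :|: far n lam a.+1) 0%N = false.
  move=> ML; rewrite -[0%N]/(val (Ordinal n0)) mem_natE !inE /= ltn0 orbF.
  by apply/negP => /(subsetP ML); rewrite -mem_natE /= L0.
by rewrite !IH ?addr0 ?mulr0 //; apply: H; apply/subsetP => i; rewrite inE => /andP[].
Qed.

Variables (a b : nat) (I : pred nat).
Hypotheses (b_n : (b < n)%N) (I_b : forall i, I i -> (i < b)%N).

(* [delannoy_rec d e] sums over the Delannoy paths from row a - d and column b - e to (a, b). *)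
Fixpoint delannoy_rec (d : nat) : nat -> K :=
  if d is d'.+1 then
    fix Qe e := if e is e'.+1 then
        if I (b - e'.+1)%N then
          yb (a - d'.+1)%N (b - e'.+1)%N * (delannoy_rec d' e'.+1 + Qe e' + delannoy_rec d' e')
        else Qe e'
      else yb (a - d'.+1)%N b * delannoy_rec d' 0%N
  else fun e => \prod_(i < b | I i && (b - e <= i)%N) yb a i.

Definition delannoy r s : K := delannoy_rec (a - r)%N (b - s)%N.

Lemma delannoy_last r : (r < a)%N -> delannoy r b = yb r b * delannoy r.+1 b.
Proof.
move=> ra; rewrite /delannoy subnn (_ : a - r = (a - r.+1).+1)%N; last by lia.
by rewrite /= (_ : a - (a - r.+1).+1 = r)%N //; lia.
Qed.

Lemma delannoy_in r s : (r < a)%N -> I s ->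
  delannoy r s = yb r s * (delannoy r.+1 s + delannoy r s.+1 + delannoy r.+1 s.+1).
Proof.
move=> ra Is; have sb := I_b Is; rewrite /delannoy (_ : a - r = (a - r.+1).+1)%N; last by lia.
rewrite (_ : b - s = (b - s.+1).+1)%N; last by lia.
rewrite /= (_ : a - (a - r.+1).+1 = r)%N; last by lia.
by rewrite (_ : b - (b - s.+1).+1 = s)%N ?Is //; lia.
Qed.

Lemma delannoy_out r s : (r < a)%N -> (s < b)%N -> ~~ I s -> delannoy r s = delannoy r s.+1.
Proof.
move=> ra sb Is; rewrite /delannoy (_ : a - r = (a - r.+1).+1)%N; last by lia.
rewrite (_ : b - s = (b - s.+1).+1)%N /=; last by lia.
by rewrite (_ : b - (b - s.+1).+1 = s)%N ?(negPf Is) //; lia.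
Qed.

Lemma delannoy_bottom s : (s <= b)%N -> delannoy a s = \prod_(i < b | I i && (s <= i)%N) yb a i.
Proof. by move=> sb; rewrite /delannoy subnn /= subKn. Qed.

Definition open_col : pred nat := fun i => I i || (i == b).
(** The continuations of a path that passes from column [v] into row [r] by a vertical or a diagonal
    step. *)
Definition delannoy_pair r v : K := delannoy r v + (if (v < b)%N then delannoy r v.+1 else 0).
Definition row_prod r p v : K := \prod_(e < b.+1 | open_col e && (p <= e <= v)%N) yb r e.
Definition zset p : {set 'I_n} := [set i : 'I_n | open_col i && (i < p)%N || (b < i)%N].

Lemma row_prod_head r p v : open_col p -> (p <= v)%N -> (v <= b)%N -> row_prod r p v = yb r p * row_prod r p.+1 v.
Proof.
move=> Lp pv vb; have pb : (p < b.+1)%N by lia.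
rewrite /row_prod (bigD1 (Ordinal pb)) /= ?Lp ?leqnn //=; congr (_ * _); apply: eq_bigl => e.
rewrite -val_eqE /=; case: (open_col e) => //=; lia.
Qed.

Lemma row_prod_skip r p v : ~~ open_col p -> row_prod r p v = row_prod r p.+1 v.
Proof.
move=> Lp; apply: eq_bigl => e; case: (eqVneq (e : nat) p) => [->|ne].
  by rewrite (negPf Lp).
by case: (open_col e) => //=; lia.
Qed.

Lemma row_prod_empty r p v : (v < p)%N -> row_prod r p v = 1.
Proof. by move=> vp; rewrite /row_prod big_pred0 // => e; case: (open_col e) => //=; lia. Qed.

(** The paths are sorted by the column [v] in which they leave row [r]; [row_prod] is the weight of
    the stretch within that row. *)
Lemma delannoy_row r p : (r < a)%N -> (p <= b)%N ->
  \sum_(v < b.+1 | open_col v && (p <= v)%N) row_prod r p v * delannoy_pair r.+1 v = delannoy r p.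
Proof.
move=> ra; have [d] := ubnP (b - p); elim: d p => // d IH p ltd pb.
have pb1 : (p < b.+1)%N by lia.
have [Ep|np] := eqVneq p b.
  rewrite Ep (big_pred1 (Ordinal (ltnSn b))) /=; last first.
    move=> v; rewrite /= -val_eqE /= /open_col; have := ltn_ord v; case: eqP => [->|ne]; last by case: (I v) => //=; lia.
    by rewrite !leqnn orbT.
  have Lbb : open_col b by rewrite /open_col eqxx orbT.
  by rewrite row_prod_head // row_prod_empty // mulr1 /delannoy_pair ltnn addr0 -delannoy_last.
have pb' : (p < b)%N by lia.
have IHp : \sum_(v < b.+1 | open_col v && (p.+1 <= v)%N) row_prod r p.+1 v * delannoy_pair r.+1 v = delannoy r p.+1.
  by apply: IH; lia.
case: (boolP (I p)) => Ip; last first.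
  have nL : ~~ open_col p by rewrite /open_col (negPf Ip).
  rewrite delannoy_out // -IHp; apply: eq_big => [v|v _]; last by rewrite row_prod_skip.
  case: (eqVneq (v : nat) p) => [->|ne]; first by rewrite (negPf nL).
  by case: (open_col v) => //=; lia.
have Lp : open_col p by rewrite /open_col Ip.
rewrite (bigD1 (Ordinal pb1)) /= ?Lp ?leqnn // row_prod_head // row_prod_empty // mulr1.
rewrite (eq_big (fun v : 'I_b.+1 => open_col v && (p.+1 <= v)%N)
  (fun v => yb r p * (row_prod r p.+1 v * delannoy_pair r.+1 v))); last 2 first.
- by move=> v; rewrite -val_eqE /=; case: (open_col v) => //=; lia.
- move=> v; rewrite -val_eqE /= => /andP[/andP[Lv pv] _].
  by rewrite row_prod_head ?mulrA //; have := ltn_ord v; lia.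
rewrite -big_distrr /= IHp (delannoy_in ra Ip) /delannoy_pair pb'; ring.
Qed.

Lemma sum_ord_set (P : pred nat) (F : nat -> K) :
  \sum_(c : 'I_n | P c && (c <= b)%N) F c = \sum_(v < b.+1 | P v) F v.
Proof.
by rewrite (big_ord_widen_cond n P F) //; apply: eq_bigl => c.
Qed.

Lemma prod_ord_set (P : pred nat) (F : nat -> K) :
  \prod_(c : 'I_n | P c && (c <= b)%N) F c = \prod_(v < b.+1 | P v) F v.
Proof.
by rewrite (big_ord_widen_cond n P F) //; apply: eq_bigl => c.
Qed.

Variable t : nat.
Hypotheses (ta : (t < a)%N) (lamE : forall r, (t < r <= a)%N -> lam r = b)
  (yb1 : forall r e, (t < r <= a)%N -> (b < e)%N -> yb r e = 1) (yb_ab : yb a b = 1)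
  (b_gt0 : (0 < b)%N).

Definition Zrow r p : K := Z r (zset p).

Lemma Zrow0 r : Zrow r 0%N = 0.
Proof.
have n0 : (0 < n)%N by lia.
apply: Zsum_no0 => //; rewrite -[0%N]/(val (Ordinal n0)) mem_natE inE /=.
by rewrite andbF.
Qed.

Lemma Zrow_skip r p : ~~ open_col p -> Zrow r p.+1 = Zrow r p.
Proof.
move=> Lp; congr (Z r _); apply/setP => i; rewrite !inE ltnS leq_eqVlt.
by case: (eqVneq (i : nat) p) => [->|//]; rewrite (negPf Lp).
Qed.

Lemma Zrow_rec r q : (t <= r < a)%N -> open_col q -> (q <= b)%N ->
  Zrow r.+1 q.+1 = \sum_(p < b.+1 | open_col p && (p <= q)%N) row_prod r.+1 p q * (Zrow r p.+1 + Zrow r p).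
Proof.
move=> tra Lq qb; have lE : lam r.+1 = b by apply: lamE; lia.
rewrite {1}/Zrow /= lE.
rewrite -(sum_ord_set (fun p => open_col p && (p <= q)%N)
  (fun p => row_prod r.+1 p q * (Zrow r p.+1 + Zrow r p))).
apply: eq_big => [c|c].
  rewrite inE ltnS; case: (leqP c b) => cb; rewrite ?andbF // !andbT.
  by rewrite orbF.
rewrite inE ltnS => /andP[]; case: (ltnP b c) => cb; first by lia.
rewrite orbF => /andP[Lc cq] _; congr (_ * (Z r _ + Z r _)).
- rewrite (bigID (fun e : 'I_n => e <= b)%N) /= [X in _ * X]big1 ?mulr1; last first.
    by move=> e /andP[_ eb]; apply: yb1; lia.
  rewrite -[RHS](prod_ord_set (fun e => open_col e && (c <= e <= q)%N)).
  apply: eq_bigl => e; rewrite inE ltnS.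
  by case: (ltnP b e) => eb; rewrite ?andbF // orbF !andbT -!andbA [(e <= q)%N && _]andbC.
- apply/setP => i; rewrite !inE !ltnS lE.
  by case: (open_col i) => /=; lia.
- apply/setP => i; rewrite !inE !ltnS lE.
  by case: (open_col i) => /=; lia.
Qed.

(** Summation by parts: the shift by one column passes from one factor to the other. No boundary
    term appears, because [Zrow r 0] vanishes, and columns that are not open change neither
    factor. *)
Lemma shift_sum r r' : (r' <= a)%N ->
  \sum_(p < b.+1 | open_col p) (Zrow r p.+1 + Zrow r p) * delannoy r' p
  = \sum_(v < b.+1 | open_col v) Zrow r v.+1 * delannoy_pair r' v.
Proof.
move=> ra; rewrite /delannoy_pair.
under eq_bigr => p _ do rewrite mulrDl.
under [RHS]eq_bigr => p _ do rewrite mulrDr.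
rewrite !big_split /=; congr (_ + _).
have Qskip p : (p < b)%N -> ~~ open_col p -> delannoy r' p = delannoy r' p.+1.
  move=> pb Lp; have nI : ~~ I p by apply: contra Lp; rewrite /open_col => ->.
  move: ra; rewrite leq_eqVlt => /orP[/eqP->|ra]; last exact: delannoy_out.
  rewrite !delannoy_bottom ?(ltnW pb) //; apply: eq_bigl => i.
  by case: (eqVneq (i : nat) p) => [->|ne]; [rewrite (negPf nI) | case: (I i) => //=; lia].
rewrite [RHS](eq_bigr (fun v : 'I_b.+1 =>
   if (v < b)%N then Zrow r v.+1 * delannoy r' v.+1 else 0)); last first.
  by move=> v _; case: ifP; rewrite ?mulr0.
rewrite [RHS]big_mkcond big_ord_recr /= ltnn if_same addr0.
have E : \sum_(p < b.+1) Zrow r p * delannoy r' p = \sum_(p < b) Zrow r p.+1 * delannoy r' p.+1.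
  by rewrite big_ord_recl /= Zrow0 mul0r add0r.
rewrite (bigID (fun p : 'I_b.+1 => open_col p)) /= in E.
rewrite [RHS](bigID (fun p : 'I_b => open_col p)) /= in E.
have E2 : \sum_(p < b.+1 | ~~ open_col p) Zrow r p * delannoy r' p
    = \sum_(p < b | ~~ open_col p) Zrow r p.+1 * delannoy r' p.+1.
  rewrite big_mkcond big_ord_recr /= {2}/open_col eqxx orbT /= addr0 -big_mkcond /=.
  by apply: eq_bigr => p Lp; rewrite Zrow_skip // Qskip.
rewrite E2 in E; rewrite (addIr _ E) -big_mkcond; apply: eq_big => [p|p _] /=.
  by [].
by rewrite ltn_ord.
Qed.

(** The sum with [Zrow r] and [delannoy_pair r.+1] is the same for all rows [r] of the block: one
    step of the recursion for [Zsum], then [shift_sum] and [delannoy_row], lower [r] by one. As all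
    these rows have length [b], no column is restored on the way. *)
Lemma transfer :
  Z a (zset b.+1) = \sum_(v < b.+1 | open_col v) Zrow t v.+1 * delannoy_pair t.+1 v.
Proof.
have Lbb : open_col b by rewrite /open_col eqxx orbT.
have base : Z a (zset b.+1) = \sum_(v < b.+1 | open_col v) Zrow a.-1 v.+1 * delannoy_pair a v.
  rewrite -shift_sum // -[Z a _]/(Zrow a b.+1).
  have aE : a = a.-1.+1 by lia.
  rewrite {1}aE Zrow_rec //; last by lia.
  rewrite -aE; apply: eq_big => [p|p /andP[Lp pb]]; first by rewrite -ltnS ltn_ord andbT.
  (* In the bottom row the factor of column [b] is 1, so the product over the open columns from [p]
     on is the Delannoy value there. *)
  rewrite mulrC delannoy_bottom //; congr (_ * _); rewrite /row_prod big_mkcond big_ord_recr /=.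
  rewrite Lbb pb leqnn yb_ab mulr1 -big_mkcond /=; apply: eq_bigl => e.
  by rewrite /open_col (ltn_eqF (ltn_ord e)) orbF (ltnW (ltn_ord e)) andbT.
rewrite base.
suff H d r : (a - r <= d)%N -> (t <= r < a)%N ->
    \sum_(v < b.+1 | open_col v) Zrow a.-1 v.+1 * delannoy_pair a v = \sum_(v < b.+1 | open_col v) Zrow r v.+1 * delannoy_pair r.+1 v.
  by apply: (H (a - t)%N); rewrite ?leqnn.
elim: d r => [|d IH] r; first by lia.
move=> ar tr; have [Er|nr] := eqVneq r a.-1; first by rewrite Er prednK //; lia.
rewrite (IH r.+1); [|lia|lia].
have -> : \sum_(v < b.+1 | open_col v) Zrow r.+1 v.+1 * delannoy_pair r.+2 v
   = \sum_(v < b.+1 | open_col v) \sum_(p < b.+1 | open_col p && (p <= v)%N)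
       row_prod r.+1 p v * (Zrow r p.+1 + Zrow r p) * delannoy_pair r.+2 v.
  by apply: eq_bigr => v Lv; rewrite Zrow_rec // ?mulr_suml // -ltnS.
rewrite (exchange_big_dep (fun p : 'I_b.+1 => open_col p)) /=; last by move=> v p _ /andP[].
rewrite -shift_sum; last by lia.
apply: eq_bigr => p Lp; rewrite -[delannoy r.+1 p]delannoy_row; [|lia|by rewrite -ltnS].
rewrite big_distrr /=; apply: eq_big => [v|v _]; first by rewrite Lp.
by ring.
Qed.

End Transfer.

(** * Front-to-back reduction, corner by corner *)

Section Front.
Local Open Scope ring_scope.
Variables (n m : nat) (K : comNzRingType) (ev : seq 'I_m -> {set 'I_m * 'I_m} -> K)
  (yv : 'I_m * 'I_m -> K).
Hypotheses
  (ev_nil : forall F, ev [::] F = \prod_(e in F) yv e)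
  (ev_none : forall j vs F, good_forest F -> no_pair F j -> ev (j :: vs) F = ev vs F)
  (ev_step : forall j vs F i k, good_forest F -> is_top F j i k ->
     ev (j :: vs) F = ev_sum ev j i k (j :: vs) F).

Variable lam : nat -> nat.
Hypotheses (n_gt0 : (0 < n)%N) (lam0 : lam 0%N = 0%N)
  (lam_mono : forall a, (0 < a)%N -> (lam a.+1 <= lam a)%N)
  (lam_lt : forall a, (0 < lam a)%N -> (lam a + a < n)%N).

(** The clauses are row [a] of the bottom pipe dream, row [a] of the top one, which is row [a.+1] of
    the diagram moved up, and the box at the origin. *)
Definition reg a b : bool := [|| b < lam a, 0 < b <= lam a.+1 | (a == 0) && (b == 0)]%N.
Definition row_ok a : bool := ((a == 0) || (0 < lam a))%N.
Definition corner a : bool := ((0 < a) && (lam a.+1 < lam a))%N.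

Variables (kap rho : nat -> 'I_m) (yb : nat -> nat -> K).
Hypotheses
  (rho_lt : forall a a', (a < a')%N -> row_ok a' -> (rho a' < rho a)%N)
  (kap_lt : forall b b', (b < b')%N -> (b' <= lam 1)%N -> (kap b < kap b')%N)
  (kap_lt_rho : forall a b, row_ok a -> (b <= lam 1)%N -> (kap b < rho a)%N = reg a b)
  (kap_eq_rho : forall a b, row_ok a -> (b <= lam 1)%N ->
     (kap b == rho a) = corner a && (b == lam a))
  (yvE : forall a b, reg a b -> yv (kap b, rho a) = yb a b)
  (yb1 : forall a b, ~~ reg a b -> yb a b = 1).

Lemma lam_le a a' : (0 < a)%N -> (a <= a')%N -> (lam a' <= lam a)%N.
Proof.
move=> a0; elim: a' => [|a' IH]; first by rewrite leqn0 => /eqP->.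
rewrite leq_eqVlt => /orP[/eqP->//|aa]; apply: leq_trans (lam_mono _) (IH aa); lia.
Qed.

Lemma lam_le1 a : (lam a <= lam 1)%N.
Proof. by case: a => [|a]; [rewrite lam0 | apply: lam_le]. Qed.

Lemma lam_n a : (lam a < n)%N.
Proof. by case: (posnP (lam a)) => [->//|/lam_lt]; lia. Qed.

Lemma reg_ok a b : reg a b -> row_ok a /\ (b <= lam 1)%N.
Proof.
rewrite /reg /row_ok; have := lam_le1 a; have := lam_le1 a.+1.
case: (posnP a) => [->|a0]; first by rewrite lam0; lia.
by have := lam_mono a0; lia.
Qed.

Lemma row_ok_n a : row_ok a -> (a < n)%N.
Proof. by case/orP => [/eqP->//|/lam_lt]; lia. Qed.

Lemma row_ok_lt a a' : row_ok a' -> (a <= a')%N -> row_ok a.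
Proof.
rewrite /row_ok; case: (posnP a) => [->//|a0]; case: (posnP a') => [->|_ /= l' aa]; first by lia.
by apply: leq_trans l' (lam_le a0 aa).
Qed.

Lemma reg_n a b : reg a b -> (a < n)%N /\ (b < n)%N.
Proof. by move=> /reg_ok[/row_ok_n an bl]; have := lam_n 1; split=> //; lia. Qed.

Lemma corner_ok a : corner a -> row_ok a.
Proof. by case/andP => _ h; rewrite /row_ok; apply/orP; right; lia. Qed.

Lemma rho_inj a a' : row_ok a -> row_ok a' -> rho a = rho a' -> a = a'.
Proof.
move=> h h' E; case: (ltngtP a a') => // lt.
  by have := rho_lt lt h'; rewrite E ltnn.
by have := rho_lt lt h; rewrite E ltnn.
Qed.

Lemma kap_inj b b' : (b <= lam 1)%N -> (b' <= lam 1)%N -> kap b = kap b' -> b = b'.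
Proof.
move=> h h' E; case: (ltngtP b b') => // lt.
  by have := kap_lt lt h'; rewrite E ltnn.
by have := kap_lt lt h; rewrite E ltnn.
Qed.

Implicit Types P : nat -> nat -> bool.

Definition lset P : {set 'I_m * 'I_m} :=
  [set (kap c.2, rho c.1) | c : 'I_n * 'I_n in [pred c : 'I_n * 'I_n | P c.1 c.2]].

Definition in_reg P : Prop := forall a b, P a b -> reg a b.

Lemma lsetP P e : in_reg P -> reflect (exists a b, P a b /\ e = (kap b, rho a)) (e \in lset P).
Proof.
move=> sP; apply: (iffP imsetP) => [[[a b] /= ab ->]|[a [b [ab ->]]]].
  by exists a, b.
have [an bn] := reg_n (sP _ _ ab).
by exists (Ordinal an, Ordinal bn).
Qed.

Lemma mem_lset P a b : in_reg P -> reg a b -> ((kap b, rho a) \in lset P) = P a b.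
Proof.
move=> sP rab; apply/(lsetP _ sP)/idP => [[a' [b' [Pab [Ek Er]]]]|Pab]; last by exists a, b.
have [h1 h2] := reg_ok rab; have [h3 h4] := reg_ok (sP _ _ Pab).
by rewrite (rho_inj h1 h3 Er) (kap_inj h2 h4 Ek).
Qed.

Lemma eq_lset P P' : in_reg P -> in_reg P' -> (forall a b, reg a b -> P a b = P' a b) -> lset P = lset P'.
Proof.
move=> sP sP' E; apply/setP => e; apply/(lsetP _ sP)/(lsetP _ sP') => -[a [b [Pab ->]]];
  exists a, b; split=> //.
  by rewrite -E // sP.
by rewrite E // sP'.
Qed.

Definition addsub P (k i : nat) (b : nat -> nat -> bool) : nat -> nat -> bool :=
  fun r c => (r == k) && (c == i) || ~~ b r c && P r c.

Lemma in_reg_addsub P k i b : in_reg P -> reg k i -> in_reg (addsub P k i b).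
Proof.
by move=> sP rki r c /orP[/andP[/eqP-> /eqP->]//|/andP[_ /sP]].
Qed.

Lemma lset_addsub P k i b (B : {set 'I_m * 'I_m}) : in_reg P -> reg k i ->
  (forall r c, reg r c -> ((kap c, rho r) \in B) = b r c) ->
  lset (addsub P k i b) = upd (lset P) (kap i, rho k) B.
Proof.
move=> sP rki EB; have sP' : in_reg (addsub P k i b) by exact: in_reg_addsub.
apply/setP => e; apply/(lsetP _ sP')/idP => [[r [c [H ->]]]|].
  have rrc := sP' _ _ H; rewrite !inE mem_lset // EB // xpair_eqE.
  by case/orP: H => [/andP[/eqP-> /eqP->]|->]; rewrite ?eqxx ?orbT.
rewrite !inE => /orP[/eqP->|/andP[eB /(lsetP _ sP)[r [c [Prc E]]]]].
  by exists k, i; rewrite /addsub !eqxx.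
by exists r, c; rewrite /addsub Prc -EB -?E ?eB ?orbT //; apply: sP.
Qed.

Lemma label_eq r c r' c' : reg r c -> reg r' c' ->
  ((kap c, rho r) == (kap c', rho r')) = (r == r') && (c == c').
Proof.
move=> h h'; have [h1 h2] := reg_ok h; have [h3 h4] := reg_ok h'.
apply/eqP/andP => [[Ek Er]|[/eqP-> /eqP->]//].
by rewrite (rho_inj h1 h3 Er) (kap_inj h2 h4 Ek).
Qed.

(* [P] describes the set of edges by boxes; the vertices before [v] are done. *)
Definition evB v P : K := ev (drop v (enum 'I_m)) (lset P).

Lemma eq_evB v P P' : in_reg P -> in_reg P' -> (forall a b, reg a b -> P a b = P' a b) ->
  evB v P = evB v P'.
Proof. by move=> sP sP' E; rewrite /evB (eq_lset sP sP' E). Qed.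

(** A vertex with an incoming and an outgoing edge labels a row and a column at once, which happens
    only at corners. *)
Lemma evB_skip v v' P : in_reg P -> good_forest (lset P) -> (v <= v')%N -> (v' <= m)%N ->
  (forall r, corner r -> (v <= rho r)%N -> (rho r < v')%N ->
     (forall c, ~~ P r c) \/ (forall r', ~~ P r' (lam r))) ->
  evB v P = evB v' P.
Proof.
move=> sP gP vv vm H; have [d] := ubnP (v' - v)%N; elim: d v vv H => // d IH v vv H lt.
have [->//|ne] := eqVneq v v'; have vm' : (v < m)%N by lia.
transitivity (evB v.+1 P); last first.
  by apply: IH; [lia | move=> r cr h1 h2; apply: H => //; lia | lia].
rewrite /evB -[v]/(val (Ordinal vm')) drop_enum ev_none //.
move=> i k /(lsetP _ sP)[r [c [Prc [Ei Ev]]]] /(lsetP _ sP)[r' [c' [Prc' [Ev' Ek]]]].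
have [h1 h2] := reg_ok (sP _ _ Prc); have [h3 h4] := reg_ok (sP _ _ Prc').
have : kap c' == rho r by rewrite -Ev -Ev'.
rewrite kap_eq_rho // => /andP[cr /eqP Ec].
have Er : rho r = v :> nat by rewrite -Ev.
have [||H1|H1] := H r cr; rewrite ?Er //; first by lia.
  by have := H1 c; rewrite Prc.
by have := H1 r'; rewrite -Ec Prc'.
Qed.

Lemma evB_inert v P r c : in_reg P -> good_forest (lset P) -> P r c -> (kap c < v)%N ->
  (rho r < v)%N \/ (corner r -> forall r', ~~ P r' (lam r)) ->
  evB v P = yb r c * evB v (fun r' c' => P r' c' && ~~ ((r' == r) && (c' == c))).
Proof.
move=> sP gP Prc kv H; have rrc := sP _ _ Prc; have [h1 h2] := reg_ok rrc.
rewrite /evB (@ev_inert _ _ _ yv ev_nil ev_none ev_step _ _ (kap c) (rho r)) //.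
- rewrite yvE //; congr (_ * ev _ _).
  have sP' : in_reg (fun r' c' => P r' c' && ~~ ((r' == r) && (c' == c))).
    by move=> r' c' /andP[/sP].
  apply/setP => e; rewrite !inE; apply/andP/(lsetP _ sP').
    case=> ne /(lsetP _ sP)[r' [c' [P' E]]]; exists r', c'; split=> //; rewrite P' /=.
    by move: ne; rewrite E label_eq //; apply: sP.
  case=> r' [c' [/andP[P' ne] ->]]; rewrite label_eq ?sP // ne; split=> //.
  by rewrite mem_lset // sP.
- by rewrite mem_lset.
- by rewrite mem_drop_enum -ltnNge.
- case: H => H; [left; by rewrite mem_drop_enum -ltnNge | right=> l].
  apply/negP => /(lsetP _ sP)[r' [c' [P' [E _]]]].
  have [h3 h4] := reg_ok (sP _ _ P').
  have : kap c' == rho r by rewrite -E.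
  rewrite kap_eq_rho // => /andP[cr /eqP Ec]; have := H cr r'.
  by rewrite -Ec P'.
Qed.

Section Corner.
Variable a : nat.
Hypothesis ca : corner a.
Let b := lam a.
Let j := rho a.

Lemma corner_label : kap b = rho a.
Proof. by apply/eqP; rewrite kap_eq_rho ?corner_ok ?lam_le1 // ca eqxx. Qed.

(** Edges into the vertex of a corner are boxes of row [a], edges out of it boxes of column [b]. The
    topmost pair is the leftmost box of the row with the uppermost box of the column, and the new
    edge is the fourth box of the rectangle they span. *)
Lemma evB_step P k i : in_reg P -> good_forest (lset P) -> P a i -> P k b ->
  (forall i', P a i' -> (i <= i')%N) -> (forall k', P k' b -> (k <= k')%N) ->
  let d1 := (fun r c => (r == k) && (c == b)) in
  let d2 := (fun r c => (r == a) && (c == i)) in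
  let P1 := addsub P k i d1 in
  let P2 := addsub P k i d2 in
  let P3 := addsub P k i (fun r c => d2 r c || d1 r c) in
  [/\ evB j P = evB j P1 + evB j P2 + evB j P3, reg k i,
      good_forest (lset P1), good_forest (lset P2) & good_forest (lset P3)].
Proof.
move=> sP gP Pai Pkb mini mink d1 d2 P1 P2 P3.
have rai := sP _ _ Pai; have rkb := sP _ _ Pkb.
have [oka il] := reg_ok rai; have [okk bl] := reg_ok rkb.
have rki : reg k i.
  rewrite -kap_lt_rho //; apply: ltn_trans (_ : j < _)%N; first by rewrite kap_lt_rho.
  by rewrite /j -corner_label kap_lt_rho.
have top : is_top (lset P) j (kap i) (rho k).
  split.
  - by rewrite /j mem_lset.
  - by rewrite /j -corner_label mem_lset.
  - move=> x /(lsetP _ sP)[r [c [Prc [-> E]]]].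
    have [h1 h2] := reg_ok (sP _ _ Prc).
    have Er := rho_inj oka h1 E; rewrite -Er in Prc.
    have := mini c Prc; rewrite leq_eqVlt => /orP[/eqP->//|lt].
    by apply/ltnW/kap_lt.
  - move=> x /(lsetP _ sP)[r [c [Prc [E ->]]]].
    have [h1 h2] := reg_ok (sP _ _ Prc).
    rewrite /j -corner_label in E; have Ec := kap_inj bl h2 E; rewrite -Ec in Prc.
    have := mink r Prc; rewrite leq_eqVlt => /orP[/eqP->//|lt].
    by apply/ltnW/rho_lt.
have E1 r c : reg r c -> ((kap c, rho r) \in [set (j, rho k)]) = d1 r c.
  by move=> rc; rewrite inE /j -corner_label label_eq.
have E2 r c : reg r c -> ((kap c, rho r) \in [set (kap i, j)]) = d2 r c.
  by move=> rc; rewrite inE /j label_eq.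
have E3 r c : reg r c -> ((kap c, rho r) \in [set (kap i, j); (j, rho k)]) = d2 r c || d1 r c.
  by move=> rc; have := E1 r c rc; have := E2 r c rc; rewrite !inE => -> ->.
have L1 := lset_addsub sP rki E1; have L2 := lset_addsub sP rki E2.
have L3 := lset_addsub sP rki E3.
split=> //.
- rewrite /evB drop_enum (ev_step _ gP top) /ev_sum /P1 /P2 /P3.
  by rewrite -L1 -L2 -L3.
- by rewrite /P1 L1; apply: good_forest_upd gP top _; right; rewrite inE.
- by rewrite /P2 L2; apply: good_forest_upd gP top _; left; rewrite inE.
- by rewrite /P3 L3; apply: good_forest_upd gP top _; left; rewrite !inE eqxx.
Qed.

End Corner.

Section Block.
Variables (a t : nat) (I : pred nat).
Let b := lam a.
Let j := rho a.
Hypotheses (ca : corner a) (ta : (t < a)%N) (lamE : forall r, (t < r <= a)%N -> lam r = b)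
  (I_b : forall i, I i -> (i < b)%N).
Local Notation delannoy := (delannoy yb a b I).
Local Notation delannoy_pair := (delannoy_pair yb a b I).

Let delannoy_in := @delannoy_in n K yb a b I (lam_n a) I_b.
Let delannoy_last := @delannoy_last n K yb a b I (lam_n a).
Let delannoy_out := @delannoy_out n K yb a b I (lam_n a).
Let b_gt0 : (0 < b)%N. Proof. by case/andP: ca => _; rewrite -/b; lia. Qed.
Let a_ok : row_ok a. Proof. exact: corner_ok. Qed.

Lemma block_ncorner r : (t < r < a)%N -> corner r = false.
Proof. by move=> tr; rewrite /corner !lamE ?ltnn ?andbF //; lia. Qed.

Lemma reg_rowa c : I c -> reg a c.
Proof. by move=> /I_b cb; rewrite /reg cb. Qed.

Lemma reg_col r : (t <= r < a)%N -> reg r b.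
Proof. by move=> tr; rewrite /reg b_gt0 (lamE (r := r.+1)) ?leqnn ?orbT //; lia. Qed.

Lemma kapb : kap b = j. Proof. exact: corner_label ca. Qed.

Lemma kap_I c : I c -> (kap c < j)%N.
Proof. by move=> Ic; rewrite kap_lt_rho ?reg_rowa //; have := I_b Ic; have := lam_le1 a; rewrite -/b; lia. Qed.

Definition rowI s : nat -> nat -> bool := fun r c => [&& r == a, I c & (s <= c)%N].
Definition colO r0 : nat -> nat -> bool := fun r c => (r0 <= r < a)%N && (c == b).
(** A hook at the corner, made of the rest of row [a] and of column [b], together with the boxes [G]
    left to later vertices. *)
Definition low (G : nat -> nat -> bool) r0 s : nat -> nat -> bool :=
  fun r c => [|| G r c, rowI s r c | colO r0 r c].

Lemma in_reg_low G r0 s : in_reg G -> (t <= r0)%N -> in_reg (low G r0 s).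
Proof.
move=> sG tr r c /or3P[/sG//|/and3P[/eqP-> Ic _]|/andP[ra /eqP->]]; first exact: reg_rowa.
by apply: reg_col; lia.
Qed.

Lemma good_sub P P' : in_reg P -> in_reg P' -> (forall r c, P' r c -> P r c) ->
  good_forest (lset P) -> good_forest (lset P').
Proof.
move=> sP sP' sub; apply: good_forest_sub; apply/subsetP => e /(lsetP _ sP')[r [c [H ->]]].
by rewrite mem_lset // ?sub // sP'.
Qed.

(** Row [a] is exhausted, so no pair is left at the corner. The boxes of column [b] are edges ending
    in rows without a corner, and each splits off as a factor. *)
Lemma evB_colO G r0 : in_reg G -> (forall r c, G r c -> (r <= t)%N) -> (t < r0 <= a)%N ->
  good_forest (lset (low G r0 b)) -> evB j.+1 (low G r0 b) = delannoy r0 b * evB j.+1 G.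
Proof.
move=> sG Gt; have [d] := ubnP (a - r0)%N; elim: d r0 => // d IH r0 lt tr gP.
have sP := in_reg_low (s := b) sG (ltnW (proj1 (andP tr))).
have [E|ne] := eqVneq r0 a.
  rewrite E delannoy_bottom // big_pred0 ?mul1r; last first.
    by move=> i; apply/andP => -[/I_b]; lia.
  rewrite -E; apply: eq_evB => // r c _; rewrite /low /rowI /colO E.
  case Ic: (I c); rewrite ?andbF //=; first by have := I_b Ic; case: (G r c) => //=; lia.
  by case: (G r c) => //=; lia.
have tr' : (t < r0 < a)%N by lia.
have sP1 := in_reg_low (r0 := r0.+1) (s := b) sG (leqW (ltnW (proj1 (andP tr)))).
rewrite (evB_inert (r := r0) (c := b)) //; last 3 first.
- by rewrite /low /colO eqxx andbT leqnn; apply/or3P; apply: Or33; case/andP: tr'.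
- by rewrite kapb.
- by right; rewrite block_ncorner.
rewrite delannoy_last; last by lia.
rewrite -mulrA; congr (_ * _).
have E : forall r c, low G r0 b r c && ~~ ((r == r0) && (c == b)) = low G r0.+1 b r c.
  move=> r c; rewrite /low /rowI /colO; have := Gt r c.
  by case: (G r c) => [/(_ isT)|_]; case: (I c); lia.
rewrite (eq_evB _ _ sP1); last 2 first.
- by move=> r c /andP[/sP].
- by move=> r c _; apply: E.
apply: IH; [lia | lia |].
by apply: good_sub gP => // r c; rewrite -E => /andP[].
Qed.

(** A reduction shortens the column of the hook, its row, or both: these are the three steps of a
    Delannoy path. The box created lies in a row without a corner, hence is inert and gives the
    factor in [delannoy_in]. *)
Lemma evB_low G r0 s : in_reg G -> (forall r c, G r c -> (r <= t)%N /\ c <> b) ->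
  (t < r0 <= a)%N -> (s <= b)%N -> good_forest (lset (low G r0 s)) ->
  evB j (low G r0 s) = delannoy r0 s * evB j.+1 G.
Proof.
move=> sG Gt; have [d] := ubnP (a - r0 + (b - s))%N; elim: d r0 s => // d IH r0 s lt tr sb gP.
have tr0 : (t <= r0)%N by lia.
have sP := in_reg_low (s := s) sG tr0.
have [Es|ns] := eqVneq s b.
  rewrite Es in gP sP *.
  rewrite (evB_skip (v' := j.+1)) //; first by apply: evB_colO => // r c /Gt[].
  move=> r cr h1 h2; left=> c.
  have Er : r = a.
    by apply: rho_inj => //; [exact: corner_ok | apply/val_inj/eqP; rewrite eqn_leq -ltnS h2].
  rewrite Er /low /rowI /colO; apply/negP; have := Gt a c.
  by case: (G a c) => [/(_ isT)[]|_]; [lia | case Ic: (I c); [have := I_b Ic|]; lia].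
case: (boolP (I s)) => Is; last first.
  have E r c : low G r0 s r c = low G r0 s.+1 r c.
    rewrite /low /rowI; case: (eqVneq c s) => [->|ne]; first by rewrite (negPf Is) !andbF.
    by congr [|| _, _ | _]; case: (I c); lia.
  have sP1 := in_reg_low (s := s.+1) sG tr0.
  have -> : delannoy r0 s = delannoy r0 s.+1.
    case/andP: tr => _; rewrite leq_eqVlt => /orP[/eqP->|ra]; last by apply: delannoy_out => //; lia.
    rewrite !delannoy_bottom //; try lia; apply: eq_bigl => i.
    by case: (eqVneq (i : nat) s) => [->|ne]; [rewrite (negPf Is) | case: (I i) => //=; lia].
  rewrite (eq_evB _ sP sP1) //; apply: IH => //; try lia.
  by rewrite -(eq_lset sP sP1).
have sb' := I_b Is.
have [Er|nr] := eqVneq r0 a.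
  have sP1 := in_reg_low (s := s.+1) sG tr0.
  have E r c : low G r0 s r c && ~~ ((r == a) && (c == s)) = low G r0 s.+1 r c.
    rewrite /low /rowI /colO Er; have := Gt r c.
    by case: (G r c) => [/(_ isT)[]|_]; case: (I c); lia.
  rewrite (evB_inert (r := a) (c := s)) //; last 3 first.
  - by rewrite /low /rowI eqxx Is leqnn orbT.
  - exact: kap_I.
  - right=> _ r'; rewrite /low /rowI /colO Er; apply/negP; have := Gt r' b.
    case: (G r' b) => [/(_ isT)[_]//|_].
    by case Ib : (I (lam a)); [have := I_b Ib; rewrite -/b ltnn | rewrite !andbF /=; lia].
  rewrite (eq_evB _ _ sP1); last 2 first.
  - by move=> r c /andP[/sP].
  - by move=> r c _; apply: E.
  rewrite IH //; [|lia|by apply: good_sub gP => // r c; rewrite -E => /andP[]].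
  rewrite mulrA; congr (_ * _); rewrite Er !delannoy_bottom //.
  rewrite [RHS](bigD1 (Ordinal sb')) ?Is ?leqnn //=; congr (_ * _); apply: eq_bigl => i.
  by rewrite -val_eqE /=; case: (I i) => //=; lia.
have tr' : (t < r0 < a)%N by lia.
have Pas : low G r0 s a s by rewrite /low /rowI eqxx Is leqnn orbT.
have Prb : low G r0 s r0 b by rewrite /low /colO eqxx leqnn; case/andP: tr' => _ ->; rewrite !orbT.
have [|| -> rrs g1 g2 g3] := evB_step ca sP gP Pas Prb.
- move=> i'; rewrite /low /rowI /colO; have := Gt a i'.
  by case: (G a i') => [/(_ isT)[]|_]; case: (I i'); lia.
- move=> k'; rewrite /low /rowI /colO; have := Gt k' b.
  case: (G k' b) => [/(_ isT)[_]//|_].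
  by case Ib : (I (lam a)); [have := I_b Ib; rewrite -/b ltnn | lia].
have main r1 s1 (del : nat -> nat -> bool) :
    (forall r c, (low G r1 s1 r c = ~~ del r c && low G r0 s r c)) -> ~~ low G r1 s1 r0 s ->
    (r0 <= r1 <= a)%N -> (s <= s1 <= b)%N -> (a - r1 + (b - s1) < d)%N ->
    good_forest (lset (addsub (low G r0 s) r0 s del)) ->
    evB j (addsub (low G r0 s) r0 s del) = yb r0 s * (delannoy r1 s1 * evB j.+1 G).
  move=> E nlow hr hs lt' g.
  have sA : in_reg (addsub (low G r0 s) r0 s del) by exact: in_reg_addsub.
  have sL : in_reg (low G r1 s1) by apply: in_reg_low => //; lia.
  rewrite (evB_inert (r := r0) (c := s)) //; last 3 first.
  - by rewrite /addsub !eqxx.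
  - exact: kap_I.
  - by right; rewrite block_ncorner.
  congr (_ * _); rewrite (eq_evB _ _ sL); last 2 first.
  - by move=> r c /andP[/sA].
  - move=> r c _; rewrite /addsub -E.
    case: (boolP ((r == r0) && (c == s))) => [/andP[/eqP-> /eqP->]|_]; last by rewrite andbT.
    by rewrite andbF (negPf nlow).
  apply: IH => //; [lia|lia|].
  apply: good_sub g => // r c; rewrite /addsub E => ->; exact: orbT.
have nG : G r0 s = false by apply/negP => /Gt[]; lia.
rewrite delannoy_in //; last by lia.
rewrite (main r0.+1 s _ _ _ _ _ _ g1); cycle 1.
- move=> r c; rewrite /low /rowI /colO; have := Gt r c.
  by case: (G r c) => [/(_ isT)[]|_]; case: (I c); lia.
- by rewrite /low /rowI /colO nG; lia.
- lia.
- lia.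
- lia.
rewrite (main r0 s.+1 _ _ _ _ _ _ g2); cycle 1.
- move=> r c; rewrite /low /rowI /colO; have := Gt r c.
  by case: (G r c) => [/(_ isT)[]|_]; case: (I c); lia.
- by rewrite /low /rowI /colO nG; lia.
- lia.
- lia.
- lia.
rewrite (main r0.+1 s.+1 _ _ _ _ _ _ g3); cycle 1.
- move=> r c; rewrite /low /rowI /colO; have := Gt r c.
  by case: (G r c) => [/(_ isT)[]|_]; case: (I c); lia.
- by rewrite /low /rowI /colO nG; lia.
- lia.
- lia.
- lia.
ring.
Qed.

Variable N : nat -> nat -> bool.
Hypotheses (sN : in_reg N) (Nt : forall r c, N r c -> (r <= t)%N /\ (b < c)%N).
Local Notation open_col := (open_col b I).

(** The uppermost box [(t, b)] is treated apart, because reductions with it create boxes in row [t],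
    which may have a corner of its own. Here the columns before [s] have already been moved from row
    [a] to row [t]. *)
Definition topP s : nat -> nat -> bool :=
  fun r c => [|| [&& r == t, I c & (c < s)%N], rowI s r c, colO t r c | N r c].
Definition widened v : nat -> nat -> bool :=
  fun r c => [&& r == t, open_col c & (c <= v)%N] || N r c.

Lemma reg_rowt c : open_col c -> reg t c.
Proof.
move=> /orP[Ic|/eqP->]; last by apply: reg_col; rewrite leqnn.
have cb := I_b Ic; have l1 := lam_le1 a.
rewrite -kap_lt_rho; [|exact: row_ok_lt a_ok (ltnW ta)|by apply: leq_trans (ltnW cb) _].
exact: ltn_trans (kap_I Ic) (rho_lt ta a_ok).
Qed.

Lemma in_reg_widened v : in_reg (widened v).
Proof. by move=> r c /orP[/and3P[/eqP-> /reg_rowt]|/sN]. Qed.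

Lemma in_reg_topP s : in_reg (topP s).
Proof.
move=> r c /or4P[/and3P[/eqP-> Ic _]|/and3P[/eqP-> Ic _]|/andP[ra /eqP->]|/sN//].
- by apply: reg_rowt; rewrite /open_col Ic.
- exact: reg_rowa.
- exact: reg_col.
Qed.

(** The pair of [(a, s)] and [(t, b)] creates [(t, s)]. If only [(a, s)] goes, the same situation
    recurs at the next column. If [(t, b)] goes, alone or with [(a, s)], an ordinary hook from row
    [t.+1] on remains; these two cases form [delannoy_pair]. *)
Lemma evB_top s : (s <= b)%N -> good_forest (lset (topP s)) ->
  evB j (topP s) = \sum_(v < b.+1 | open_col v && (s <= v)%N) evB j.+1 (widened v) * delannoy_pair t.+1 v
  /\ forall v, open_col v -> (s <= v <= b)%N -> good_forest (lset (widened v)).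
Proof.
have [d] := ubnP (b - s)%N; elim: d s => // d IH s lt sb gP.
have sP := @in_reg_topP s.
have [Es|ns] := eqVneq s b.
  rewrite Es in gP sP *; split; last first.
    move=> v _ vb; have -> : v = b by lia.
    apply: good_sub (@in_reg_widened b) _ gP => // r c.
    rewrite /widened /topP /colO /open_col => /orP[/and3P[/eqP-> /orP[Ic|/eqP->] _]|->].
    - by rewrite eqxx Ic (I_b Ic).
    - by rewrite !eqxx leqnn ta /= !orbT.
    - by rewrite !orbT.
  rewrite (evB_skip (v' := j.+1)) //; last first.
    move=> r cr h1 h2; left=> c.
    have Er : r = a.
      by apply: rho_inj => //; [exact: corner_ok | apply/val_inj/eqP; rewrite eqn_leq -ltnS h2].
    rewrite Er /topP /rowI /colO; apply/negP; have := @Nt a c.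
    by case: (N a c) => [/(_ isT)[]|_]; [lia | case Ic: (I c); [have := I_b Ic|]; lia].
  have sL : in_reg (low (widened b) t.+1 b) by apply: in_reg_low => //; exact: in_reg_widened.
  have E r c : topP b r c = low (widened b) t.+1 b r c.
    rewrite /topP /low /widened /rowI /colO /open_col.
    by case: (N r c); case Ic : (I c); rewrite ?orbT ?orbF //=; [have := I_b Ic|]; lia.
  rewrite (eq_evB _ sP sL) // evB_colO //; first last.
  - by rewrite -(eq_lset sP sL).
  - by rewrite ltnSn.
  - by move=> r c /orP[/and3P[/eqP-> _ _]//|/Nt[]].
  - exact: in_reg_widened.
  rewrite (big_pred1 (Ordinal (ltnSn b))) /=; last first.
    move=> v; rewrite /= -val_eqE /= /open_col; have := ltn_ord v; case: eqP => [->|ne].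
      by rewrite !leqnn orbT.
    by case: (I v) => //=; lia.
  by rewrite /delannoy_pair ltnn addr0 mulrC.
have sb' : (s < b)%N by lia.
have sP1 := @in_reg_topP s.+1.
case: (boolP (I s)) => Is; last first.
  have E r c : topP s r c = topP s.+1 r c.
    rewrite /topP /rowI; case: (eqVneq c s) => [->|ne]; first by rewrite (negPf Is) !andbF.
    by case: (I c); case: (N r c); case: (colO t r c); lia.
  have [||| ET gW] := IH s.+1 => //; [lia|by rewrite -(eq_lset sP sP1)|].
  rewrite (eq_evB _ sP sP1) // ET; split; last first.
    move=> v Lv sv; apply: gW => //; have [E'|ne] := eqVneq v s; last by lia.
    by move: Lv; rewrite E' /open_col (negPf Is) (negPf ns).
  apply: eq_bigl => v; case: (eqVneq (v : nat) s) => [->|ne].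
    by rewrite ltnn andbF /open_col (negPf Is) (negPf ns).
  by congr (_ && _); lia.
have Pas : topP s a s by rewrite /topP /rowI eqxx Is leqnn orbT.
have Ptb : topP s t b by apply/or4P/Or43; rewrite /colO leqnn ta eqxx.
have [|| -> rts g1 g2 g3] := evB_step ca sP gP Pas Ptb.
- move=> i'; rewrite /topP /rowI /colO; have := @Nt a i'.
  by case: (N a i') => [/(_ isT)[]|_]; case: (I i'); lia.
- move=> k'; rewrite /topP /rowI /colO; have := @Nt k' b.
  case: (N k' b) => [/(_ isT)[_]//|_]; first by rewrite ltnn.
  by case Ib : (I (lam a)); [have := I_b Ib; rewrite -/b ltnn | lia].
have sW := @in_reg_widened s.
have Wt r c : widened s r c -> (r <= t)%N /\ c <> b.
  by move=> /orP[/and3P[/eqP-> _ cs]|/Nt[]]; lia.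
have sA del : in_reg (addsub (topP s) t s del) by exact: in_reg_addsub.
have E1 r c : addsub (topP s) t s (fun r c => (r == t) && (c == b)) r c = low (widened s) t.+1 s r c.
  rewrite /addsub /topP /low /widened /rowI /colO /open_col; have := @Nt r c.
  case: (eqVneq c s) => [->|ne]; rewrite ?Is.
    by case: (N r s) => [/(_ isT)[]|_]; lia.
  by case: (N r c) => [/(_ isT)[]|_]; case Ic : (I c); try have := I_b Ic; lia.
have E2 r c : addsub (topP s) t s (fun r c => (r == a) && (c == s)) r c = topP s.+1 r c.
  rewrite /addsub /topP /rowI /colO; have := @Nt r c.
  case: (eqVneq c s) => [->|ne]; rewrite ?Is.
    by case: (N r s) => [/(_ isT)[]|_]; lia.
  by case: (N r c) => [/(_ isT)[]|_]; case Ic : (I c); try have := I_b Ic; lia.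
have E3 r c : addsub (topP s) t s (fun r c => (r == a) && (c == s) || (r == t) && (c == b)) r c
    = low (widened s) t.+1 s.+1 r c.
  rewrite /addsub /topP /low /widened /rowI /colO /open_col; have := @Nt r c.
  case: (eqVneq c s) => [->|ne]; rewrite ?Is.
    by case: (N r s) => [/(_ isT)[]|_]; lia.
  by case: (N r c) => [/(_ isT)[]|_]; case Ic : (I c); try have := I_b Ic; lia.
have sL1 : in_reg (low (widened s) t.+1 s) by exact: in_reg_low.
have sL3 : in_reg (low (widened s) t.+1 s.+1) by exact: in_reg_low.
rewrite (eq_evB _ (sA _) sL1) // (eq_evB _ (sA _) sP1) // (eq_evB _ (sA _) sL3) //.
rewrite (eq_lset (sA _) sL1) // in g1; rewrite (eq_lset (sA _) sP1) // in g2.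
rewrite (eq_lset (sA _) sL3) // in g3.
have [||| ET gW] := IH s.+1 => //; first by lia.
split; last first.
  move=> v Lv sv; have [->|ne] := eqVneq v s; last by apply: gW => //; lia.
  by apply: good_sub sW _ g1 => // r c; rewrite /low => ->.
rewrite !evB_low ?ltnSn // ET.
have sb1 : (s < b.+1)%N by lia.
rewrite [in RHS](bigD1 (Ordinal sb1)) /=; last by rewrite /open_col Is leqnn.
rewrite /delannoy_pair sb' [in RHS](eq_bigl (fun v : 'I_b.+1 => open_col v && (s < v)%N)); last first.
  by move=> v; rewrite -val_eqE /=; case: (open_col v) => //=; lia.
by rewrite mulrDr [_ * evB _ _]mulrC [delannoy _ s.+1 * _]mulrC; ring.
Qed.

End Block.

(** The boxes of the region whose lower neighbour is not a cross of the bottom pipe dream. They turn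
    out to be the places of the dropped dots. *)
Definition treeP : nat -> nat -> bool := fun r c => reg r c && (lam r.+1 <= c)%N.

Lemma in_reg_treeP : in_reg treeP. Proof. by move=> r c /andP[]. Qed.

Lemma evB_end P : in_reg P -> evB m P = \prod_(c : 'I_n * 'I_n | P c.1 c.2) yb c.1 c.2.
Proof.
move=> sP; rewrite /evB drop_oversize ?size_enum_ord // ev_nil /lset big_imset /=.
  by apply: eq_bigr => c /sP /yvE.
move=> [r c] [r' c']; rewrite !inE /= => /sP H /sP H' /eqP.
by rewrite label_eq // => /andP[/eqP/val_inj-> /eqP/val_inj->].
Qed.

Lemma evB_row0 (V : pred nat) : (forall c, V c -> (c <= lam 1)%N) ->
  good_forest (lset (fun r c => (r == 0%N) && V c)) ->
  evB (rho 0%N) (fun r c => (r == 0%N) && V c) = \prod_(c : 'I_n | V c) yb 0%N c.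
Proof.
move=> Vl gP; have sP : in_reg (fun r c => (r == 0%N) && V c).
  by move=> r c /andP[/eqP-> /Vl]; rewrite /reg lam0 => /= h; case: c h => //= c ->.
rewrite (evB_skip (v' := m)) ?(ltnW (ltn_ord _)) //; last first.
  move=> r cr h _; left=> c; have r0 : (0 < r)%N by case/andP: cr.
  by rewrite (gtn_eqF r0).
rewrite evB_end // -(pair_big_dep (fun i : 'I_n => i == 0%N :> nat) (fun (i c : 'I_n) => V c)
  (fun i c : 'I_n => yb i c)) /=.
by rewrite (big_pred1 (Ordinal n_gt0)).
Qed.

Lemma exists_block a : (0 < a)%N -> exists t, [/\ (t < a)%N,
  forall r, (t < r <= a)%N -> lam r = lam a & (t == 0%N) || (lam a < lam t)%N].
Proof.
elim: a => // a IH _; have [->|a0] := posnP a.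
  by exists 0%N; split=> // r h; congr lam; lia.
have [lt|ge] := ltnP (lam a.+1) (lam a).
  by exists a; split; [|move=> r h; congr lam; lia | rewrite lt orbT].
have E : lam a.+1 = lam a by apply/eqP; rewrite eqn_leq lam_mono.
have [t [ta H1 H2]] := IH a0; exists t; split; [lia | | by rewrite E].
move=> r h; have [->//|ne] := eqVneq r a.+1.
by rewrite E; apply: H1; lia.
Qed.

(* The edges left when the corners below row [a] have been reduced; [I] is the set of
   columns in which they have left an edge in row [a]. *)
Definition pending a (I : pred nat) : nat -> nat -> bool :=
  fun r c => (r == a) && I c || treeP r c && (r < a)%N.

(** By [evB_top] and [transfer] both sides expand over the same columns [v] with the same weights
    [delannoy_pair]. The other factors agree by induction at row [t], the next corner, or directly
    if [t] is 0. *)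
Lemma evB_corner a (I : pred nat) : corner a -> (forall i, I i -> (i < lam a)%N) -> I 0%N ->
  good_forest (lset (pending a I)) ->
  evB (rho a) (pending a I) = Zsum lam yb a (zset n (lam a) I (lam a).+1).
Proof.
have [d] := ubnP a; elim: d a I => // d IH a I lt ca I_b I0 gP.
have a0 : (0 < a)%N by case/andP: ca.
have b0 : (0 < lam a)%N by exact: I_b I0.
have [t [ta lamE topt]] := exists_block a0.
have ct : (0 < t)%N -> corner t.
  move=> t0; rewrite /corner t0 (lamE t.+1) ?ltnSn //.
  by move: topt; rewrite (gtn_eqF t0).
pose N : nat -> nat -> bool := fun r c => [&& treeP r c, (r <= t)%N & (lam a < c)%N].
have sN : in_reg N by move=> r c /and3P[/in_reg_treeP].
have Nt r c : N r c -> (r <= t)%N /\ (lam a < c)%N by case/and3P.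
have lamSt : lam t.+1 = lam a by apply: lamE; rewrite ltnSn.
have tree_t c : treeP t c = if t == 0%N then c == lam a else (lam a <= c < lam t)%N.
  rewrite /treeP /reg lamSt; have [t0|t0] := posnP t.
    by rewrite t0 lam0 /=; lia.
  rewrite /= ?orbF; move: topt; rewrite (gtn_eqF t0) /=; lia.
(* Strictly between [t] and [a] the only tree boxes are those of column [lam a]. Row [t] has one
   there too, and all others belong to [N]. *)
have pendE r c : pending a I r c = topP a t I N 0%N r c.
  rewrite /pending /topP /rowI /colO /N leq0n andbT ltn0 !andbF /=.
  have [Era|ra] := eqVneq r a; first by subst r; rewrite ltnn; case: (I c); lia.
  rewrite /= ; case: (ltngtP r a) ra => // ra _; last by rewrite !andbF; lia.
  case: (ltngtP r t) => rt /=.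
  - rewrite andbT; apply/idP/idP => [h|/andP[]//]; rewrite h /=.
    have t0 : (0 < t)%N by lia.
    have := lam_le (ltn0Sn r) rt; move: topt h; rewrite (gtn_eqF t0) /treeP /=.
    by move=> h1 /andP[_ h2] h3; lia.
  - rewrite /treeP /reg (lamE r) ?(lamE r.+1); [|lia|lia].
    lia.
  - by rewrite rt tree_t; case: ifP topt => //= _ topt; lia.
have sT := in_reg_topP ca ta lamE I_b sN.
have sP : in_reg (pending a I) by move=> r c; rewrite pendE; apply: sT.
rewrite (eq_evB _ sP (sT 0%N)) //.
have gT : good_forest (lset (topP a t I N 0)) by rewrite -(eq_lset sP (sT 0%N)).
have [|-> gW] := evB_top ca ta lamE I_b sN Nt _ gT; first by [].
have cl : (lam a.+1 < lam a)%N by case/andP: ca.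
have nreg r e : (t < r <= a)%N -> (lam a < e)%N -> ~~ reg r e.
  move=> tr le; have Er := lamE r tr; rewrite /reg Er.
  have [ra|ra] := eqVneq r a; first by rewrite ra; lia.
  by rewrite (lamE r.+1); lia.
rewrite (@transfer n K lam yb a (lam a) I (lam_n a) I_b t ta lamE) //; last 2 first.
- by move=> r e tr le; apply: yb1; apply: nreg.
- by apply: yb1; rewrite /reg; lia.
apply: eq_big => [v|v /andP[Lv _]]; first by rewrite leq0n andbT.
congr (_ * _); have vb : (v <= lam a)%N by rewrite -ltnS.
have gv := gW v Lv vb.
have sW := in_reg_widened ca ta lamE I_b sN.
have at_ : (rho a < rho t)%N by apply: rho_lt ta (corner_ok ca).
rewrite (evB_skip (v' := rho t)) //; last first.
- move=> r cr h1 h2; exfalso; have tr : (t < r)%N.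
    rewrite ltnNge; apply/negP => rt; move: h2; rewrite ltnNge.
    by move: rt; rewrite leq_eqVlt => /orP[/eqP->|rt];
      rewrite ?leqnn // ltnW // rho_lt // (row_ok_lt (corner_ok ca)) // ltnW.
  have ra : (r < a)%N.
    rewrite ltnNge; apply/negP; rewrite leq_eqVlt => /orP[/eqP E|ra].
      by rewrite -E ltnn in h1.
    by have := rho_lt ra (corner_ok cr); lia.
  by move: cr; rewrite /corner !lamE ?ltnn ?andbF //; lia.
- exact: ltnW (ltn_ord _).
rewrite /Zrow; have [t0|t0] := posnP t.
  have l1 : lam 1 = lam a by rewrite -lamSt t0.
  pose V : pred nat := fun c => open_col (lam a) I c && (c <= v)%N.
  have E r c : widened a t I N v r c = (r == 0%N) && V c.
    rewrite /widened /N /V t0; case: (ltngtP r 0%N) => // r0; first by rewrite /= !andbF.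
    by rewrite r0 -t0 tree_t t0 /= orb_idr // => /andP[/eqP->]; rewrite ltnn.
  have sV : in_reg (fun r c => (r == 0%N) && V c) by move=> r c; rewrite -E; apply: sW.
  rewrite (eq_evB _ (sW v) sV) // t0 evB_row0; last 2 first.
  - by move=> c /andP[_ cv]; rewrite l1; lia.
  - by rewrite -(eq_lset (sW v) sV).
  rewrite /= /zset (mem_nat_set (fun x => open_col (lam a) I x && (x < v.+1) || (lam a < x))%N) //.
  rewrite /open_col I0 /= mul1r.
  rewrite [RHS](bigID (fun e : 'I_n => e <= lam a)%N) /= [X in _ * X]big1 ?mulr1; last first.
    by move=> e /andP[_ el]; apply: yb1; rewrite /reg lam0 l1; lia.
  apply: eq_bigl => e; rewrite inE ltnS /V /open_col.
  by case: (I e) => /=; lia.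
have tl : (lam a < lam t)%N by move: topt; rewrite (gtn_eqF t0).
(* Row [t] now holds the boxes created in columns up to [v] besides its own tree boxes to the right
   of column [lam a]. *)
pose I' : pred nat := fun c => open_col (lam a) I c && (c <= v)%N || (lam a < c < lam t)%N.
have E r c : widened a t I N v r c = pending t I' r c.
  rewrite /widened /pending /N /I'; case: (ltngtP r t) => rt /=.
  - rewrite ?andbT ?orbF; apply/idP/idP => [/andP[]//|h]; rewrite h /=.
    have := lam_le (ltn0Sn r) rt; move: h; rewrite /treeP => /andP[_ h1] h3; lia.
  - by rewrite !andbF.
  - rewrite rt tree_t (gtn_eqF t0) andbF orbF; congr (_ || _); lia.
have sP' : in_reg (pending t I') by move=> r c; rewrite -E; apply: sW.
rewrite (eq_evB _ (sW v) sP') // IH //; [|lia|exact: ct| | |by rewrite -(eq_lset (sW v) sP')].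
- congr (Zsum _ _ t _); apply/setP => e; rewrite !inE !ltnS /I' /open_col.
  case: (I e) => /=; lia.
- move=> i /orP[/andP[_ iv]|/andP[]//]; lia.
- by rewrite /I' /open_col I0.
Qed.


(** Below the region the only possible turn is in column 0 and all factors are 1. The first summand
    has all columns again, and the second lacks column 0 and vanishes. *)
Lemma Zsum_top a l : (forall r, (l < r)%N -> lam r = 0%N) -> (l <= a)%N ->
  Zsum lam yb a [set: 'I_n] = Zsum lam yb l [set: 'I_n].
Proof.
move=> H; elim: a => [|a IH]; first by rewrite leqn0 => /eqP->.
rewrite leq_eqVlt => /orP[/eqP->//|la]; rewrite -IH //.
have l1 : lam a.+1 = 0%N by exact: H.
have l2 : lam a.+2 = 0%N by apply: H; lia.
pose o := Ordinal n_gt0.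
rewrite [LHS]/= l1 (big_pred1 o); last first.
  by move=> c; rewrite /= inE leqn0 -val_eqE.
rewrite big1 ?mul1r; last by move=> e _; apply: yb1; rewrite /reg l1 l2; lia.
rewrite [X in _ + X]Zsum_no0 // ?addr0; last first.
  by rewrite -[0%N]/(nat_of_ord o) mem_natE !inE /= ?l1.
congr (Zsum _ _ _ _); apply/setP => e; rewrite !inE l1 /=.
by case: (nat_of_ord e).
Qed.

Lemma ev_front : good_forest (lset treeP) ->
  ev (enum 'I_m) (lset treeP) = Zsum lam yb n.-1 [set: 'I_n].
Proof.
move=> gT; rewrite -[enum 'I_m]drop0 -[LHS]/(evB 0 treeP).
have skip l : (forall r, (l < r)%N -> lam r = 0%N) -> row_ok l ->
    evB 0 treeP = evB (rho l) treeP.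
  move=> H okl; apply: evB_skip => //; [exact: in_reg_treeP | exact: ltnW (ltn_ord _) |].
  move=> r cr _ lt; exfalso; have lr : (l < r)%N.
    rewrite ltnNge; apply/negP; rewrite leq_eqVlt => /orP[/eqP E|rl].
      by rewrite E ltnn in lt.
    by have := rho_lt rl okl; lia.
  by move: cr; rewrite /corner (H r lr) ltn0 andbF.
have [l1|l1] := posnP (lam 1).
  have H r : (0 < r)%N -> lam r = 0%N by move=> r0; have := lam_le1 r; lia.
  rewrite (skip 0%N) // (@Zsum_top _ 0%N) //.
  have E r c : treeP r c = (r == 0%N) && (c == 0%N).
    rewrite /treeP /reg (H r.+1) //; have [->|r0] := posnP r; first by rewrite lam0; lia.
    by rewrite (H r) //; lia.
  have sV : in_reg (fun r c => (r == 0%N) && (c == 0%N)).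
    by move=> r c; rewrite -E; apply: in_reg_treeP.
  rewrite (eq_evB _ in_reg_treeP sV) // (evB_row0 (V := fun c => c == 0%N)); last 2 first.
  - by move=> c /eqP->.
  - by rewrite -(eq_lset in_reg_treeP sV).
  rewrite /= (mem_nat_set predT) // mul1r.
  rewrite [RHS](bigD1 (Ordinal n_gt0)) ?inE //= [X in _ = _ * X]big1 ?mulr1; last first.
    move=> e; rewrite -val_eqE /= => /andP[_ e0]; apply: yb1; rewrite /reg lam0 l1 (negPf e0).
    by case: (nat_of_ord e) e0.
  by rewrite (big_pred1 (Ordinal n_gt0)).
have ex : exists r, (0 < lam r)%N by exists 1%N.
have ub r : (0 < lam r)%N -> (r <= n)%N by move=> /lam_lt; lia.
case: (ex_maxnP ex ub) => l l0 maxl.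
have H r : (l < r)%N -> lam r = 0%N.
  by move=> lr; apply/eqP; rewrite -leqn0 leqNgt; apply/negP => /maxl; lia.
have lpos : (0 < l)%N by apply: maxl.
have cl : corner l by rewrite /corner lpos H.
have ln : (l <= n.-1)%N by have := lam_lt l0; lia.
rewrite (skip l) //; last exact: corner_ok.
rewrite (@Zsum_top _ l) //.
pose I : pred nat := fun c => (c < lam l)%N.
have E r c : treeP r c = pending l I r c.
  rewrite /pending /treeP; case: (ltngtP r l) => rl.
  - by rewrite andbT.
  - by rewrite andbF /reg (H r) // (H r.+1) //; lia.
  - by rewrite rl /reg (H l.+1) // /I ?andbF ?orbF /=; lia.
have sP : in_reg (pending l I) by move=> r c; rewrite -E; apply: in_reg_treeP.
rewrite (eq_evB _ in_reg_treeP sP) // evB_corner //; last by rewrite -(eq_lset in_reg_treeP sP).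
congr (Zsum _ _ _ _); apply/setP => e; rewrite !inE /open_col /I ltnS.
by case: (ltngtP e (lam l)).
Qed.

End Front.

(** * Dominant permutations and their trees *)

Lemma card_ord_lt n k : k <= n -> #|[set y : 'I_n | y < k]| = k.
Proof.
move=> kn; rewrite cardsE; have := @sum1_card _ (fun y : 'I_n => y < k).
by rewrite big_ord_narrow ?sum1_card ?card_ord // => <-.
Qed.

Lemma mem_downset n (S : {set 'I_n}) (x : 'I_n) :
  (forall y z : 'I_n, y < z -> z \in S -> y \in S) -> (x \in S) = (x < #|S|).
Proof.
move=> H; apply/idP/idP => [xS|].
  rewrite -(@card_ord_lt n x.+1) ?ltn_ord //; apply: subset_leq_card; apply/subsetP => y.
  by rewrite inE ltnS leq_eqVlt => /orP[/eqP/val_inj->//|/H]; apply.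
apply: contraTT => xS; rewrite -leqNgt -[X in _ <= X](@card_ord_lt n x) ?(ltnW (ltn_ord x)) //.
apply: subset_leq_card; apply/subsetP => y yS; rewrite inE ltnNge.
apply: contra xS; rewrite leq_eqVlt => /orP[/eqP/val_inj->//|/H]; exact.
Qed.

Lemma mem_downset_pos n (S : {set 'I_n}) (x : 'I_n) :
  (forall y : 'I_n, y \in S -> 0 < y) ->
  (forall y z : 'I_n, 0 < y -> y < z -> z \in S -> y \in S) -> (x \in S) = (0 < x <= #|S|).
Proof.
move=> pos H; have n0 : 0 < n by apply: leq_ltn_trans (ltn_ord x).
pose o : 'I_n := Ordinal n0.
have oS : o \notin S by apply/negP => /pos.
have := @mem_downset n (o |: S) x; rewrite cardsU1 oS add1n ltnS !inE => <-; last first.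
  move=> y z yz; rewrite !inE => /orP[/eqP E|zS]; first by rewrite E in yz.
  case: (posnP y) => [y0|y0]; last by rewrite (H y z) ?orbT.
  by rewrite (_ : y = o) ?eqxx //; apply: val_inj.
rewrite lt0n -(inj_eq val_inj) /=; case: (boolP (x \in S)) => [/pos|].
  by rewrite lt0n => /negPf ->.
by rewrite orbF andNb.
Qed.

Section PermNat.
Variables (n : nat) (s : 'S_n).

Definition perm_nat (i : nat) : nat := if insub i is Some x then val (s x) else i.

Lemma perm_natE (x : 'I_n) : perm_nat x = s x.
Proof. by rewrite /perm_nat valK. Qed.

Lemma perm_nat_ge i : n <= i -> perm_nat i = i.
Proof. by move=> ni; rewrite /perm_nat insubF // ltnNge ni. Qed.

End PermNat.

Lemma perm_natK n (s : 'S_n) : cancel (perm_nat s) (perm_nat s^-1%g).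
Proof.
move=> i; have [i_n|n_i] := ltnP i n; last by rewrite !perm_nat_ge.
by rewrite -[i]/(val (Ordinal i_n)) !perm_natE permK.
Qed.

Section Dominant.
Variables (n : nat) (pi : 'S_n).
Hypotheses (n_gt0 : 0 < n) (pi_dom : one_dominant pi).

Local Notation w := (perm_nat pi).
Local Notation pos := (perm_nat pi^-1%g).

Definition lam a : nat := #|[set b : 'I_n | (b < pos a) && (a < w b)]|.

Lemma wK : cancel w pos. Proof. exact: perm_natK. Qed.
Lemma posK : cancel pos w. Proof. by rewrite -[X in cancel _ (perm_nat X)]invgK; exact: perm_natK. Qed.

Lemma w0 : w 0 = 0.
Proof. by rewrite -[X in w X]/(val (Ordinal n_gt0)) perm_natE; apply: (proj1 pi_dom). Qed.

Lemma perm_nat_lt i : i < n -> w i < n.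
Proof. by move=> i_n; rewrite -[i]/(val (Ordinal i_n)) perm_natE. Qed.

Lemma avoid i j k : 0 < i -> i < j -> j < k -> ~~ ((w i < w k) && (w k < w j)).
Proof.
move=> i0 ij jk; have [kn|nk] := ltnP k n; last first.
  rewrite (perm_nat_ge _ nk) negb_and -!leqNgt; case: (ltnP j n) => [/perm_nat_lt|nj].
    by move=> h; apply/orP; right; lia.
  by rewrite (perm_nat_ge _ nj) (ltnW jk) orbT.
have jn := ltn_trans jk kn; have i_n := ltn_trans ij jn.
rewrite -[i]/(val (Ordinal i_n)) -[j]/(val (Ordinal jn)) -[k]/(val (Ordinal kn)) !perm_natE.
by apply: (proj2 pi_dom).
Qed.

Lemma lam_bound a : a < n -> lam a + a < n.
Proof.
move=> a_n; have H : #|[set b : 'I_n | a < pi b]| = n - a.+1.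
  have -> : [set b : 'I_n | a < pi b] = pi @^-1: ~: [set v : 'I_n | v < a.+1].
    by apply/setP => b; rewrite !inE ltnS -ltnNge.
  rewrite card_preimset; last exact: perm_inj.
  by rewrite cardsCs setCK card_ord (card_ord_lt a_n).
suff : lam a <= n - a.+1 by lia.
rewrite -H; apply: subset_leq_card; apply/subsetP => b; rewrite !inE perm_natE.
by case/andP.
Qed.

Lemma pos_lt a : a < n -> pos a < n.
Proof. by move=> an; rewrite -[a]/(val (Ordinal an)) perm_natE. Qed.

Lemma lam_ge a : n <= a -> lam a = 0.
Proof.
move=> na; apply/eqP; rewrite cards_eq0 -subset0; apply/subsetP => b.
rewrite !inE perm_natE => /andP[_]; have := ltn_ord (pi b); lia.
Qed.

Lemma lam_lt a : 0 < lam a -> lam a + a < n.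
Proof. by case: (ltnP a n) => [/lam_bound//|/lam_ge->]. Qed.

(** A row of the diagram is an interval from column 1 on. If [0 < y < z] and [z] belonged to row [a]
    but [y] did not, then [w y], [w z], [a] at the positions [y < z < pos a] would form the pattern
    132. *)
Lemma diagE a b : (b < pos a) && (a < w b) = (0 < b <= lam a).
Proof.
have [b_n|n_b] := ltnP b n; last first.
  apply/andP/andP => [[bp aw]|[b0 bl]]; last first.
    by have := lam_lt (leq_trans b0 bl); lia.
  have [/pos_lt|na] := ltnP a n; first by lia.
  by move: bp aw; rewrite !perm_nat_ge // => /(ltn_trans _) H /H; rewrite ltnn.
have -> : (b < pos a) && (a < w b) = (Ordinal b_n \in [set b : 'I_n | (b < pos a) && (a < w b)]).
  by rewrite inE.
apply: mem_downset_pos => [y|y z y0 yz]; rewrite !inE.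
  by move=> /andP[_]; case: (posnP y) => // ->; rewrite w0.
move=> /andP[zp az]; rewrite (ltn_trans yz zp) /= ltnNge leq_eqVlt negb_or.
apply/andP; split.
  apply/eqP => E; have := congr1 pos E; rewrite wK; lia.
by have := avoid y0 yz zp; rewrite posK az andbT.
Qed.

Lemma lam0 : lam 0 = 0.
Proof.
apply/eqP; rewrite -leqn0; have := diagE 0 (lam 0).
by rewrite -[X in _ < pos X]w0 wK; lia.
Qed.

(** If [b = lam a.+1] were not a column of row [a], then [a], [w b], [a.+1] would stand in this
    order and form the pattern 132. *)
Lemma lam_mono a : 0 < a -> lam a.+1 <= lam a.
Proof.
move=> a0; have [->//|b0] := posnP (lam a.+1).
have := diagE a.+1 (lam a.+1); rewrite b0 leqnn => /andP[bp ab].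
have := diagE a (lam a.+1); rewrite b0 (ltnW ab) andbT /= => <-.
rewrite ltnNge leq_eqVlt; apply/negP => /orP[/eqP E|lt].
  by have := posK a; rewrite E; lia.
have p0 : 0 < pos a.
  by rewrite lt0n; apply/eqP => E; have := posK a; rewrite E w0; lia.
by have := avoid p0 lt bp; rewrite !posK ltnSn ab.
Qed.

Lemma card_bottom_row (a : 'I_n) : #|[set b | (a, b) \in diagram pi]| = lam a.
Proof.
apply: eq_card => b; rewrite !inE /= !perm_natE.
apply/existsP/andP => [[j /and3P[/eqP <- bj jb]]|[bp ab]].
  by rewrite permK.
by exists (pi^-1%g a); rewrite permKV eqxx bp ab.
Qed.

Lemma bottomE (c : box n) : (c \in bottom_pd pi) = (c.2 < lam c.1).
Proof. by rewrite inE card_bottom_row. Qed.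

Lemma diagramE (c : box n) : (c \in diagram pi) = (0 < c.2 <= lam c.1).
Proof.
rewrite inE /= -diagE !perm_natE.
apply/existsP/andP => [[j /and3P[/eqP <- bj jb]]|[bp ab]].
  by rewrite permK.
by exists (pi^-1%g c.1); rewrite permKV eqxx bp ab.
Qed.

Local Notation reg := (reg lam).

Lemma lam_le_lam a a' : 0 < a -> a <= a' -> lam a' <= lam a.
Proof.
move=> a0; elim: a' => [|a' IH]; first by lia.
rewrite leq_eqVlt => /orP[/eqP<-//|]; rewrite ltnS => le.
by apply: leq_trans (IH le); apply: lam_mono; lia.
Qed.

Lemma reg_lt a b : reg a b -> a < n /\ b < n.
Proof.
rewrite /reg => /or3P[h|h|/andP[/eqP-> /eqP->]//].
  by have := lam_lt (leq_ltn_trans (leq0n _) h); lia.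
have := @lam_lt a.+1; lia.
Qed.

(** The boxes of a column of the diagram fill rows from 1 on without gaps; pushed up they fill rows
    from 0 on, so row [a] is reached exactly when row [a.+1] was. *)
Lemma regionE (c : box n) : (c \in region pi) = reg c.1 c.2.
Proof.
rewrite !inE !card_bottom_row /reg -orbA; congr [|| _, _ | _].
case: c => a b /=; set S := [set _ | _].
have SE x : (x \in S) = (0 < b <= lam x) by rewrite inE diagramE.
have S0 x : x \in S -> 0 < x.
  by rewrite SE; case: (posnP x) => // ->; rewrite lam0; lia.
have SD (y z : 'I_n) : 0 < y -> y < z -> z \in S -> y \in S.
  by rewrite !SE => y0 yz /andP[-> /= h]; apply: leq_trans h (lam_le_lam y0 (ltnW yz)).
have [an|na] := ltnP a.+1 n.
  by have := mem_downset_pos (Ordinal an) S0 SD; rewrite SE /= => <-.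
rewrite (lam_ge na); apply/idP/idP => [h|]; last by lia.
have : #|S| < n.
  rewrite -[X in _ < X](card_ord n) -cardsT; apply: proper_card.
  by apply/properP; split=> //; exists (Ordinal n_gt0) => //; apply/negP => /S0.
by move: (#|S|) h => k h; lia.
Qed.

Lemma reg_left a b b' : b' <= b -> reg a b -> reg a b'.
Proof.
by rewrite /reg; case: a => [|a]; [rewrite lam0; lia | have := @lam_mono a.+1; lia].
Qed.

Lemma reg_up a a' b : a' <= a -> reg a b -> reg a' b.
Proof.
rewrite leq_eqVlt => /orP[/eqP->//|lt].
rewrite /reg; case: a' lt => [|a'] lt.
  by rewrite lam0; have := @lam_le_lam 1 a isT; have := @lam_le_lam 1 a.+1 isT; lia.
have := @lam_le_lam a'.+1 a isT; have := @lam_le_lam a'.+2 a.+1 isT; lia.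
Qed.

End Dominant.

Lemma filter_iota_interval n p q : q <= n ->
  [seq i <- iota 0 n | p <= i < q] = iota p (q - p).
Proof.
move=> qn; apply: (irr_sorted_eq ltn_trans ltnn).
- by apply: sorted_filter; [exact: ltn_trans | exact: iota_ltn_sorted].
- exact: iota_ltn_sorted.
- by move=> i; rewrite mem_filter !mem_iota; lia.
Qed.

Lemma index_map_iota (T : eqType) (key : T -> nat) (s : seq T) p k x :
  map key s = iota p k -> x \in s -> index x s + p = key x.
Proof.
move=> E xs; have lt : index x s < size s by rewrite index_mem.
have sz : size s = k by rewrite -(size_map key) E size_iota.
by rewrite addnC -[RHS](congr1 key (nth_index x xs)) -(nth_map x 0) // E nth_iota // -sz.
Qed.

(** * The boundary path and the labels of its steps *)

Section Boundary.
Variables (n : nat) (pi : 'S_n).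
Hypotheses (n_gt0 : 0 < n) (pi_dom : one_dominant pi).
Local Notation lam := (lam pi).
Local Notation reg := (reg lam).

Definition rlen a : nat := #|[set b : 'I_n | reg a b]|.
Definition hgt b : nat := #|[set a : 'I_n | reg a b]|.

Lemma rlenE a b : (b < rlen a) = reg a b.
Proof.
have [bn|nb] := ltnP b n; last first.
  transitivity false; last by apply/esym/negP => /(reg_lt n_gt0)[_]; lia.
  by apply/negbTE; rewrite -leqNgt; apply: leq_trans (max_card _) _; rewrite card_ord.
rewrite -[X in X < _]/(val (Ordinal bn)) -mem_downset ?inE // => y z yz; rewrite !inE.
exact/(reg_left n_gt0 pi_dom)/ltnW.
Qed.

Lemma hgtE a b : (a < hgt b) = reg a b.
Proof.
have [an|na] := ltnP a n; last first.
  transitivity false; last by apply/esym/negP => /(reg_lt n_gt0)[]; lia.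
  by apply/negbTE; rewrite -leqNgt; apply: leq_trans (max_card _) _; rewrite card_ord.
rewrite -[X in X < _]/(val (Ordinal an)) -mem_downset ?inE // => y z yz; rewrite !inE.
exact/(reg_up n_gt0 pi_dom)/ltnW.
Qed.

Lemma rlen_hgt a b : (b < rlen a) = (a < hgt b).
Proof. by rewrite rlenE hgtE. Qed.

Lemma rlen_le a : rlen a <= n.
Proof. by apply: leq_trans (max_card _) _; rewrite card_ord. Qed.

Lemma hgt_le b : hgt b <= n.
Proof. by apply: leq_trans (max_card _) _; rewrite card_ord. Qed.

Lemma row_lengthE (a : 'I_n) : row_length pi a = rlen a.
Proof. by apply: eq_card => b; rewrite in_set [in RHS]in_set regionE. Qed.

Lemma col_heightE (b : 'I_n) : col_height pi b = hgt b.
Proof. by apply: eq_card => a; rewrite in_set [in RHS]in_set regionE. Qed.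

(* Up to a constant, the position of a step in [boundary]. *)
Definition key (st : bstep n) : nat :=
  match st with inl b => b + (n - hgt b) | inr a => rlen a + (n - a.+1) end.

Definition chunk (a : 'I_n) : seq (bstep n) :=
  [seq inl b | b : 'I_n <- enum 'I_n & hgt b == a.+1] ++ [:: inr a].

Lemma boundaryE : boundary pi = flatten [seq chunk a | a : 'I_n <- rev (enum 'I_n) & 0 < rlen a].
Proof.
rewrite /boundary; congr flatten.
rewrite (eq_filter (fun a => congr1 _ (row_lengthE a))); apply: eq_map => a.
by rewrite /chunk; congr (map _ _ ++ _); apply: eq_filter => b; rewrite col_heightE.
Qed.

Lemma rlen_anti a a' : a <= a' -> rlen a' <= rlen a.
Proof.
move=> aa'; rewrite leqNgt; apply/negP; rewrite rlen_hgt => h.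
by have := ltnn (rlen a); rewrite rlen_hgt (leq_ltn_trans aa' h).
Qed.

Lemma map_key_chunk (a : 'I_n) :
  map key (chunk a) = iota (rlen a.+1 + (n - a.+1)) (rlen a - rlen a.+1).+1.
Proof.
have le := rlen_anti (leqnSn a).
rewrite -[(_ - _).+1]addn1 iotaD map_cat /=; congr (_ ++ [:: _]); last by lia.
have E : map val [seq b : 'I_n <- enum 'I_n | hgt b == a.+1] = iota (rlen a.+1) (rlen a - rlen a.+1).
  rewrite -(filter_iota_interval _ (rlen_le a)) -val_enum_ord filter_map; congr map.
  by apply: eq_filter => b; rewrite /= rlen_hgt leqNgt rlen_hgt; lia.
rewrite addnC iotaDl -E -!map_comp; apply/eq_in_map => b.
by rewrite mem_filter => /andP[/eqP h _] /=; rewrite h addnC.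
Qed.

Lemma map_key_rows k : k <= n ->
  map key (flatten [seq chunk a | a : 'I_n <- rev (drop k (enum 'I_n)) & 0 < rlen a])
  = iota (n - hgt 0) (rlen k + (hgt 0 - k)).
Proof.
move=> kn; rewrite -(subKn kn); elim: (n - k) (leq_subr k n) => [|d IH] dn.
  rewrite subn0 drop_oversize ?size_enum_ord //=.
  have -> : rlen n = 0 by apply/eqP; rewrite -leqn0 leqNgt rlen_hgt ltnNge hgt_le.
  by rewrite (_ : hgt 0 - n = 0) //; have := hgt_le 0; lia.
have an : n - d.+1 < n by lia.
have := IH (ltnW dn); rewrite (_ : n - d = (n - d.+1).+1); last by lia.
pose a : 'I_n := Ordinal an; rewrite -[n - d.+1]/(a : nat) => {}IH.
rewrite drop_enum rev_cons filter_rcons; have := rlen_hgt a 0; case: ltnP => r0 /esym h0.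
  rewrite map_rcons flatten_rcons map_cat IH map_key_chunk.
  rewrite (_ : rlen a + (hgt 0 - a) = rlen a.+1 + (hgt 0 - a.+1) + (rlen a - rlen a.+1).+1); last first.
    by have := rlen_anti (leqnSn a); lia.
  rewrite [RHS]iotaD; congr (_ ++ iota _ _); have := hgt_le 0; have := ltn_ord a; lia.
by have le := rlen_anti (leqnSn a); rewrite IH; congr (iota _ _); lia.
Qed.

(** Successive steps have consecutive keys, so the place of a step in the boundary is its key up to
    a shift. *)
Lemma map_key : map key (boundary pi) = iota (n - hgt 0) (rlen 0 + hgt 0).
Proof. by rewrite boundaryE -[enum 'I_n]drop0 map_key_rows // subn0. Qed.

Lemma size_boundary : size (boundary pi) = rlen 0 + hgt 0.
Proof. by rewrite -(size_map key) map_key size_iota. Qed.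

Lemma mem_boundary_inr (a : 'I_n) : (inr a \in boundary pi) = (a < hgt 0).
Proof.
rewrite boundaryE -rlen_hgt; apply/flattenP/idP => [[c /mapP[a' ]]|h].
  rewrite mem_filter => /andP[h _] ->; rewrite mem_cat inE => /orP[/mapP[]//|/eqP[->]//].
exists (chunk a); last by rewrite mem_cat inE eqxx orbT.
by apply/map_f; rewrite mem_filter h mem_rev mem_enum.
Qed.

Lemma mem_boundary_inl (b : 'I_n) : (inl b \in boundary pi) = (b < rlen 0).
Proof.
rewrite boundaryE rlen_hgt; apply/flattenP/idP => [[c /mapP[a' ]]|h].
  rewrite mem_filter => /andP[_ _] ->; rewrite mem_cat inE orbF => /mapP[b'].
  by rewrite mem_filter => /andP[/eqP E _] [->]; rewrite E.
have an : (hgt b).-1 < n by have := hgt_le b; lia.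
exists (chunk (Ordinal an)).
  apply/map_f; rewrite mem_filter mem_rev mem_enum andbT /=.
  by apply: leq_ltn_trans (leq0n b) _; rewrite rlen_hgt prednK.
rewrite mem_cat inE orbF; apply: map_f; rewrite mem_filter mem_enum andbT /=.
by rewrite prednK.
Qed.

Lemma index_boundary st : st \in boundary pi -> index st (boundary pi) + (n - hgt 0) = key st.
Proof. exact: index_map_iota map_key. Qed.

End Boundary.

Section StepLabel.
Variable A : seq bool.
Hypothesis A_prev : forall k, k < size A -> ~~ nth false A k -> (0 < k) && nth false A k.-1.

Definition nth_label k : nat := count id (take (if nth false A k then k else k.-1) A).

Lemma count_take_S k : k < size A -> count id (take k.+1 A) = count id (take k A) + nth false A k.
Proof. by move=> kA; rewrite (take_nth false) // -cats1 count_cat /= addn0. Qed.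

Lemma leq_count_take k k' : k <= k' -> count id (take k A) <= count id (take k' A).
Proof.
move=> kk'; rewrite -(subnKC kk') takeD count_cat; exact: leq_addr.
Qed.

Lemma nth_labelS k : k < size A -> (nth_label k).+1 = count id (take k.+1 A).
Proof.
move=> kA; rewrite /nth_label count_take_S //; case: (boolP (nth false A k)) => Ak; first by rewrite addn1.
have /andP[k0 Ak'] := A_prev kA Ak.
have k'A : k.-1 < size A by lia.
by rewrite -[in RHS](prednK k0) count_take_S // Ak' addn0 addn1.
Qed.

Lemma nth_label_lt k k' : k < k' -> k' < size A -> nth false A k' || (k' != k.+1) ->
  nth_label k < nth_label k'.
Proof.
move=> kk' kA' H; rewrite -ltnS !nth_labelS ?(ltn_trans kk') // (count_take_S kA').
case: (boolP (nth false A k')) H => Ak' /= H; first by rewrite addn1 ltnS leq_count_take.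
have /andP[k0 Ap] := A_prev kA' Ak'.
have k'A : k'.-1 < size A by lia.
have := count_take_S k'A; rewrite Ap prednK // addn0 addn1 => ->.
by rewrite ltnS leq_count_take //; lia.
Qed.

Lemma nth_label_bound k : k < size A -> nth_label k < count id A.
Proof. by move=> kA; rewrite nth_labelS // -[in X in _ <= X](take_size A) leq_count_take. Qed.

Lemma nth_label_merge k : nth false A k -> ~~ nth false A k.+1 -> nth_label k.+1 = nth_label k.
Proof. by rewrite /nth_label => -> /negPf->. Qed.

End StepLabel.

Section Labels.
Variables (n : nat) (pi : 'S_n).
Hypotheses (n_gt0 : 0 < n) (pi_dom : one_dominant pi).
Local Notation lam := (lam pi).
Local Notation reg := (reg lam).
Local Notation rlen := (rlen pi).
Local Notation hgt := (hgt pi).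

Definition isA (prev : option (bstep n)) (st : bstep n) : bool :=
  match st, prev with
  | inr _, _ | inl _, None => true
  | inl _, Some (inl _) => bounds_bottom pi st
  | inl _, Some (inr a) => bounds_bottom pi st && ~~ bounds_bottom pi (inr a)
  end.

Lemma size_inA_rec prev s : size (inA_rec pi prev s) = size s.
Proof. by elim: s prev => //= st s IH prev; rewrite IH. Qed.

Lemma nth_inA_rec st0 prev s k : k < size s ->
  nth false (inA_rec pi prev s) k = isA (if k is k'.+1 then Some (nth st0 s k') else prev) (nth st0 s k).
Proof. by elim: s prev k => //= st s IH prev [|k] ks //=; rewrite IH //; case: k ks. Qed.

Lemma size_inA : size (inA pi) = rlen 0 + hgt 0.
Proof. by rewrite size_inA_rec size_boundary. Qed.

Lemma key_inA st prev : st \in boundary pi ->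
  index st (boundary pi) = (index prev (boundary pi)).+1 -> prev \in boundary pi ->
  nth false (inA pi) (index st (boundary pi)) = isA (Some prev) st.
Proof.
move=> sB E pB; rewrite (nth_inA_rec st) ?index_mem // nth_index // {1}E.
by rewrite nth_index.
Qed.

(** The number of earlier steps, east plus north. For the north step of row [a] these are [rlen a]
    east steps and one north step for each lower row. *)
Definition posE b : nat := b + (hgt 0 - hgt b).
Definition posN a : nat := rlen a + (hgt 0 - a.+1).

Lemma hgt_anti b b' : b <= b' -> hgt b' <= hgt b.
Proof.
move=> bb'; rewrite leqNgt; apply/negP; rewrite -rlen_hgt // => h.
by have := ltnn (hgt b); rewrite -[in X in X = _]rlen_hgt // (leq_ltn_trans bb' h).
Qed.

Lemma index_inl (b : 'I_n) : b < rlen 0 -> index (inl b) (boundary pi) = posE b.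
Proof.
move=> b0; have := index_boundary n_gt0 pi_dom (st := inl b).
rewrite mem_boundary_inl // => /(_ b0) /=.
have := hgt_anti (leq0n b); have := hgt_le pi 0; rewrite /posE; lia.
Qed.

Lemma index_inr (a : 'I_n) : a < hgt 0 -> index (inr a) (boundary pi) = posN a.
Proof.
move=> a0; have := index_boundary n_gt0 pi_dom (st := inr a).
rewrite mem_boundary_inr // => /(_ a0) /=.
have := hgt_le pi 0; rewrite /posN; lia.
Qed.

Local Notation corner := (corner lam).

Lemma posE_posN a b : a < hgt 0 -> b < rlen 0 ->
  (posE b == (posN a).+1) = (a == hgt b) && (b == rlen a).
Proof.
move=> a0 b0; have := rlen_hgt n_gt0 pi_dom a b; have := hgt_anti (leq0n b).
have := rlen_anti n_gt0 pi_dom (leq0n a); rewrite /posE /posN => r1 h1 E.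
have {}E : (b < rlen a) <-> (a < hgt b) by rewrite E.
by apply/eqP/andP => [H|[/eqP H1 /eqP H2]]; [split; apply/eqP|]; lia.
Qed.

Lemma posE_posE b b' : b < rlen 0 -> b' < rlen 0 ->
  (posE b == (posE b').+1) = (b == b'.+1) && (hgt b == hgt b').
Proof.
move=> b0 b0'; have := hgt_anti (leq0n b); have := hgt_anti (leq0n b').
rewrite /posE => h1 h2; case: (leqP b b') => [bb'|b'b].
  by have h3 := hgt_anti bb'; apply/eqP/andP => [H|[/eqP H1 /eqP H2]]; [split; apply/eqP|]; lia.
by have h3 := hgt_anti (ltnW b'b); apply/eqP/andP => [H|[/eqP H1 /eqP H2]]; [split; apply/eqP|]; lia.
Qed.

Lemma bounds_inl (b : 'I_n) : bounds_bottom pi (inl b) = (0 < hgt b) && (b < lam (hgt b).-1).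
Proof.
rewrite /=; apply/existsP/andP => [[a]|[h0 bl]].
  by rewrite col_heightE // bottomE /= => /andP[/eqP<-].
have an : (hgt b).-1 < n by have := hgt_le pi b; lia.
by exists (Ordinal an); rewrite col_heightE // bottomE /= prednK // eqxx.
Qed.

Lemma bounds_inr (a : 'I_n) : bounds_bottom pi (inr a) = (0 < rlen a) && ((rlen a).-1 < lam a).
Proof.
rewrite /=; apply/existsP/andP => [[b]|[h0 bl]].
  by rewrite row_lengthE // bottomE /= => /andP[/eqP<-].
have bn : (rlen a).-1 < n by have := rlen_le pi a; lia.
by exists (Ordinal bn); rewrite row_lengthE // bottomE /= bl andbT prednK.
Qed.

Lemma hgt_gt0 b : b < rlen 0 -> 0 < hgt b.
Proof. by rewrite rlen_hgt. Qed.

Lemma corner_hgt a : corner a -> [/\ rlen a = lam a, hgt (lam a) = a, a < hgt 0 & lam a < rlen 0].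
Proof.
case/andP=> a0 lt; have R := rlenE n_gt0 pi_dom; have H := hgtE n_gt0 pi_dom.
have l0 : 0 < lam a by lia.
split.
- apply/eqP; rewrite eqn_leq leqNgt R /reg ltnn (gtn_eqF a0) /=.
  have := R a (lam a).-1; rewrite /reg; lia.
- apply/eqP; rewrite eqn_leq leqNgt H /reg ltnn (gtn_eqF a0) /=.
  have := H a.-1 (lam a); rewrite /reg prednK // leqnn l0 orbT; lia.
- by rewrite H /reg l0.
- by rewrite R /reg l0 lam_le_lam // ?orbT.
Qed.

Lemma inA_posN a : a < hgt 0 -> nth false (inA pi) (posN a).
Proof.
move=> a0; have an : a < n by apply: leq_trans a0 (hgt_le _ _).
have aB : inr (Ordinal an) \in boundary pi by rewrite mem_boundary_inr.
rewrite -[a]/(val (Ordinal an)) -index_inr // (nth_inA_rec (inr (Ordinal an))) ?index_mem //.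
by rewrite nth_index.
Qed.

(** An east step after an east step always bounds the bottom pipe dream. After the north step of row
    [hgt b] it is left out exactly when the last box of that row is a cross, which means that the
    row has length [lam (hgt b)]. *)
Lemma inA_posE b : b < rlen 0 ->
  ~~ nth false (inA pi) (posE b) = corner (hgt b) && (b == lam (hgt b)).
Proof.
move=> b0; have bn : b < n by apply: leq_trans b0 (rlen_le _ _).
pose st : bstep n := inl (Ordinal bn).
have stB : st \in boundary pi by rewrite mem_boundary_inl.
have Est : index st (boundary pi) = posE b by rewrite index_inl.
have h0 := hgt_gt0 b0; have R := rlenE n_gt0 pi_dom; have H := hgtE n_gt0 pi_dom.
have lH := lam_mono n_gt0 pi_dom h0.
have lH' : 0 < (hgt b).-1 -> lam (hgt b) <= lam (hgt b).-1.
  by move=> h; have := lam_mono n_gt0 pi_dom h; rewrite prednK.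
have regb := H (hgt b).-1 b; rewrite prednK // leqnn in regb; have {}regb := esym regb.
have nregb := H (hgt b) b; rewrite ltnn in nregb; have {}nregb := esym nregb.
case E : (posE b) => [|k].
  rewrite (nth_inA_rec st); last by rewrite -E -Est index_mem.
  have -> : nth st (boundary pi) 0 = st by rewrite -E -Est nth_index.
  apply/esym/negP => /andP[co /eqP bE].
  have [r1 _ h1 _] := corner_hgt co; have := posE_posN h1 b0.
  by rewrite E eqxx r1 -bE eqxx.
have kB : k < size (boundary pi) by rewrite ltnW // -E -Est index_mem.
pose p := nth st (boundary pi) k; have pB : p \in boundary pi by apply: mem_nth.
have pk : index p (boundary pi) = k.
  have U : uniq (boundary pi).
    by apply: (@map_uniq _ _ (key pi)); rewrite map_key // iota_uniq.
  by rewrite index_uniq.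
rewrite -E -Est (key_inA stB _ pB); last by rewrite pk -E.
case: (p) pB pk => [b'|a'].
  rewrite mem_boundary_inl // => b0' pk; rewrite index_inl // in pk.
  have := posE_posE b0 b0'; rewrite E pk eqxx => /esym/andP[/eqP bb' /eqP hh'].
  rewrite /isA bounds_inl h0 /=.
  have : ~~ reg (hgt b) b' by rewrite -H hh' ltnn.
  by move: regb; rewrite /corner /reg prednK //; lia.
rewrite mem_boundary_inr // => a0' pk; rewrite index_inr // in pk.
have := posE_posN a0' b0; rewrite E pk eqxx => /esym/andP[/eqP ab /eqP ba].
rewrite /isA bounds_inl bounds_inr h0 /= -ba ab.
have b1 : 0 < b by rewrite ba R -H.
by move: regb nregb; rewrite /corner /reg prednK //; lia.
Qed.

Lemma inA_prev k : k < size (inA pi) -> ~~ nth false (inA pi) k ->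
  (0 < k) && nth false (inA pi) k.-1.
Proof.
rewrite size_inA -(size_boundary n_gt0 pi_dom) => kB nA.
have n0 := n_gt0; pose st : bstep n := inl (Ordinal n_gt0).
have U : uniq (boundary pi) by apply: (@map_uniq _ _ (key pi)); rewrite map_key // iota_uniq.
have pk : index (nth st (boundary pi) k) (boundary pi) = k by rewrite index_uniq.
have : nth st (boundary pi) k \in boundary pi by apply: mem_nth.
move: pk; case: (nth _ _ _) => [b|a]; last first.
  by rewrite mem_boundary_inr // => pk h; move: nA; rewrite -pk index_inr // inA_posN.
rewrite mem_boundary_inl // => pk h; rewrite index_inl // in pk; move: nA; rewrite -pk inA_posE //.
move=> /andP[co /eqP bE]; have [r1 _ h1 _] := corner_hgt co; have := posE_posN h1 h.
by rewrite r1 -bE !eqxx => /eqP -> /=; rewrite inA_posN.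
Qed.

Definition klab b : nat := step_label pi (posE b).
Definition rlab a : nat := step_label pi (posN a).

Lemma posE_lt b : b < rlen 0 -> posE b < size (inA pi).
Proof. by rewrite size_inA /posE; lia. Qed.

Lemma posN_lt a : a < hgt 0 -> posN a < size (inA pi).
Proof. by rewrite size_inA /posN; have := rlen_anti n_gt0 pi_dom (leq0n a); lia. Qed.

Lemma klab_lt_size b : b < rlen 0 -> klab b < tree_size pi.
Proof. by move=> /posE_lt; exact: (nth_label_bound inA_prev). Qed.

Lemma rlab_lt_size a : a < hgt 0 -> rlab a < tree_size pi.
Proof. by move=> /posN_lt; exact: (nth_label_bound inA_prev). Qed.

Lemma rlab_lt a a' : a < a' -> a' < hgt 0 -> rlab a' < rlab a.
Proof.
move=> aa' a0; apply: (nth_label_lt inA_prev).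
- by have := rlen_anti n_gt0 pi_dom (ltnW aa'); rewrite /posN; lia.
- by apply: posN_lt; lia.
- by rewrite inA_posN //; lia.
Qed.

Lemma klab_lt b b' : b < b' -> b' < rlen 0 -> klab b < klab b'.
Proof.
move=> bb' b0; have h := hgt_anti (ltnW bb'); have h' := hgt_anti (leq0n b).
apply: (nth_label_lt inA_prev); [by rewrite /posE; lia | exact: posE_lt |].
case: (boolP (nth _ _ _)) => //=; rewrite inA_posE // => /andP[co /eqP bE].
rewrite posE_posE //; last by lia.
apply/negP => /andP[/eqP E /eqP hh].
have [r1 _ _ _] := corner_hgt co; have := rlen_hgt n_gt0 pi_dom (hgt b') b.
by rewrite r1 -bE bb' hh ltnn.
Qed.

(** The east step of column [b] precedes the north step of row [a] exactly when their box is in the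
    region. Labels keep the order of steps, except that the east step right after a corner's north
    step shares its label. *)
Lemma klab_rlab a b : a < hgt 0 -> b < rlen 0 ->
  (klab b < rlab a) = reg a b /\ (klab b == rlab a) = corner a && (b == lam a).
Proof.
move=> a0 b0; rewrite -(rlenE n_gt0 pi_dom); have RH := rlen_hgt n_gt0 pi_dom a b.
have h1 := hgt_anti (leq0n b); have r1 := rlen_anti n_gt0 pi_dom (leq0n a).
have [lt|ge] := ltnP b (rlen a).
  have H : klab b < rlab a.
    apply: (nth_label_lt inA_prev); [by rewrite /posE /posN; lia | exact: posN_lt |].
    by rewrite inA_posN.
  rewrite H (ltn_eqF H); split=> //; apply/esym/negP => /andP[co /eqP E].
  by have [r2 _ _ _] := corner_hgt co; move: lt; rewrite r2 E ltnn.
case: (boolP (corner a && (b == lam a))) => [/andP[co /eqP E]|nco].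
  have [r2 h2 _ _] := corner_hgt co; rewrite E in b0 *; have := posE_posN a0 b0.
  rewrite h2 r2 !eqxx => /eqP Ep.
  have <- : rlab a = klab (lam a).
    rewrite /klab Ep; apply/esym/nth_label_merge; first exact: inA_posN.
    by rewrite -Ep inA_posE // h2 co eqxx.
  by rewrite ltnn eqxx.
have H : rlab a < klab b.
  apply: (nth_label_lt inA_prev); [by rewrite /posE /posN; lia | exact: posE_lt |].
  case: (boolP (nth _ _ _)) => //=; rewrite inA_posE // posE_posN // => /andP[co /eqP E].
  by apply: contra nco => /andP[/eqP -> _]; rewrite co -E eqxx.
by rewrite (gtn_eqF H) ltnNge ltnW.
Qed.

Lemma tree_labelE (c : box n) : c \in region pi -> tree_label pi c = (klab c.2, rlab c.1).
Proof.
rewrite regionE // => H; rewrite /tree_label index_inl ?index_inr //.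
  by rewrite hgtE //; apply: reg_left H.
by rewrite rlenE //; apply: reg_up H.
Qed.

End Labels.

(** * Tree edges as boxes of the region *)

Section TreeLabels.
Variables (n : nat) (pi : 'S_n).
Hypotheses (n_gt0 : 0 < n) (pi_dom : one_dominant pi).
Local Notation lam := (lam pi).
Local Notation reg := (reg lam).
Local Notation row_ok := (row_ok lam).
Local Notation rlen := (rlen pi).
Local Notation hgt := (hgt pi).
Let lam0 := lam0 n_gt0 pi_dom.
Let lam_mono := lam_mono n_gt0 pi_dom.
Let lam_lt := @lam_lt n pi n_gt0.
Let lam_le := lam_le n_gt0 lam0 lam_mono.
Let reg_ok := reg_ok n_gt0 lam0 lam_mono.
Let row_ok_lt := row_ok_lt n_gt0 lam0 lam_mono.

Lemma lt_rlen0 b : (b < rlen 0) = (b <= lam 1).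
Proof. by rewrite rlenE // /reg lam0; lia. Qed.

Lemma lt_hgt0 a : (a < hgt 0) = row_ok a.
Proof. by rewrite hgtE // /reg /row_ok; lia. Qed.

Lemma tree_size_gt0 : 0 < tree_size pi.
Proof.
apply: leq_ltn_trans (leq0n (klab pi 0)) _.
by apply: klab_lt_size; rewrite ?lt_rlen0.
Qed.

Definition kap b : 'I_(tree_size pi) := insubd (Ordinal tree_size_gt0) (klab pi b).
Definition rho a : 'I_(tree_size pi) := insubd (Ordinal tree_size_gt0) (rlab pi a).

Lemma val_kap b : b <= lam 1 -> kap b = klab pi b :> nat.
Proof. by move=> h; rewrite /kap insubdK // unfold_in klab_lt_size // lt_rlen0. Qed.

Lemma val_rho a : row_ok a -> rho a = rlab pi a :> nat.
Proof. by move=> h; rewrite /rho insubdK // unfold_in rlab_lt_size // lt_hgt0. Qed.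

Lemma rho_lt a a' : a < a' -> row_ok a' -> rho a' < rho a.
Proof.
move=> lt h; have h' := row_ok_lt h (ltnW lt).
by rewrite !val_rho //; apply: rlab_lt; rewrite // lt_hgt0.
Qed.

Lemma kap_lt b b' : b < b' -> b' <= lam 1 -> kap b < kap b'.
Proof.
move=> lt h; have h' := leq_trans (ltnW lt) h.
by rewrite !val_kap //; apply: klab_lt; rewrite // lt_rlen0.
Qed.

Lemma kap_lt_rho a b : row_ok a -> b <= lam 1 -> (kap b < rho a) = reg a b.
Proof.
move=> ha hb; rewrite val_kap // val_rho //.
by have [] := @klab_rlab _ _ n_gt0 pi_dom a b; rewrite ?lt_hgt0 ?lt_rlen0.
Qed.

Lemma kap_eq_rho a b : row_ok a -> b <= lam 1 -> (kap b == rho a) = corner lam a && (b == lam a).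
Proof.
move=> ha hb; rewrite -val_eqE /= val_kap // val_rho //.
by have [] := @klab_rlab _ _ n_gt0 pi_dom a b; rewrite ?lt_hgt0 ?lt_rlen0.
Qed.

Lemma tree_label_box (c : box n) : c \in region pi -> tree_label pi c = (kap c.2 : nat, rho c.1 : nat).
Proof.
move=> cR; rewrite tree_labelE //; move: cR; rewrite regionE // => /(reg_ok)[h1 h2].
by rewrite val_kap // val_rho.
Qed.

Lemma phi_box (c : box n) : c \in region pi -> phi (kap c.2) (rho c.1) = Some c.
Proof.
move=> cR; rewrite /phi; case: pickP => [d /andP[dR]|/(_ c)]; last by rewrite cR tree_label_box // eqxx.
rewrite tree_label_box // => /eqP[/val_inj E1 /val_inj E2]; congr Some.
move: cR dR; rewrite !regionE // => /(reg_ok)[h1 h2] /(reg_ok)[h3 h4].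
rewrite [c]surjective_pairing [d]surjective_pairing; congr (_, _); apply: val_inj.
  exact: (rho_inj rho_lt) E2.
exact: (kap_inj kap_lt) E1.
Qed.

(** In column [b] the crosses of the bottom pipe dream fill rows 1 to [#|S|], so as many dots are
    left as fill the column from row [#|S|] down. Row [a] is among these exactly when row [a.+1] is
    not in [S]. *)
Lemma droppedE (c : box n) : (c \in dropped_dots pi) = treeP lam c.1 c.2.
Proof.
rewrite in_set regionE //; case: c => a b; rewrite /treeP /=.
case: (boolP (reg a b)) => //= rab.
have hn := hgt_le pi b; have an := ltn_ord a; have ah : a < hgt b by rewrite hgtE.
have sub (x y : nat) : y <= x -> x <= n -> #|[set i : 'I_n | (y <= i) && (i < x)]| = x - y.
  move=> yx xn; have -> : [set i : 'I_n | (y <= i) && (i < x)] = [set i : 'I_n | i < x] :\: [set i : 'I_n | i < y].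
    by apply/setP => i; rewrite !inE -leqNgt.
  rewrite cardsD (setIidPr _) ?card_ord_lt ?(leq_trans yx) //.
  by apply/subsetP => i; rewrite !inE => iy; apply: leq_trans yx.
have -> : #|[set a' : 'I_n | (a < a') && ((a', b) \in region pi)]| = hgt b - a.+1.
  by rewrite -sub //; apply: eq_card => i; rewrite in_set [in RHS]in_set regionE // hgtE.
pose S := [set a' : 'I_n | b < lam a'].
have SR (a' : 'I_n) : a' \in S -> reg a' b by rewrite inE /reg => ->.
have -> : #|[set a' | (a', b) \in dots pi]| = hgt b - #|S|.
  have -> : [set a' | (a', b) \in dots pi] = [set i : 'I_n | i < hgt b] :\: S.
    apply/setP => i; rewrite in_set -[dots pi]/(region pi :\: bottom_pd pi) [in LHS]in_setD.
    by rewrite regionE // bottomE // [in RHS]in_setD [i \in S]in_set [in RHS]in_set hgtE.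
  rewrite cardsD (setIidPr _) ?card_ord_lt //.
  by apply/subsetP => i /SR; rewrite inE hgtE.
have S0 (x : 'I_n) : x \in S -> 0 < x.
  by rewrite inE; case: (posnP x) => // ->; rewrite lam0.
have SD (y z : 'I_n) : 0 < y -> y < z -> z \in S -> y \in S.
  by rewrite !inE => y0 yz h; apply: leq_trans h (lam_le y0 (ltnW yz)).
have Sn : #|S| <= hgt b.
  rewrite -[X in _ <= X](card_ord_lt hn); apply: subset_leq_card.
  by apply/subsetP => i /SR; rewrite inE hgtE.
have -> : (hgt b - a.+1 < hgt b - #|S|) = (#|S| <= a) by move: (#|S|) Sn => k; lia.
have [an1|na] := ltnP a.+1 n.
  by have := mem_downset_pos (Ordinal an1) S0 SD; rewrite inE /= => E; rewrite leqNgt -E -leqNgt.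
have : #|S| < n.
  rewrite -[X in _ < X](card_ord n) -cardsT; apply: proper_card.
  by apply/properP; split=> //; exists (Ordinal n_gt0) => //; apply/negP => /S0.
by rewrite lam_ge //; move: (#|S|) => k; lia.
Qed.

Lemma treeE : tree pi = lset n kap rho (treeP lam).
Proof.
apply/setP => e; rewrite in_set; apply/exists_inP/imsetP => [[c]|[c]].
  rewrite droppedE => cT /eqP E; exists c => //; move: E.
  rewrite tree_label_box; last by rewrite regionE //; case/andP: cT.
  by case: e => i j /= [/val_inj -> /val_inj ->].
move=> cT ->; exists c; rewrite ?droppedE //.
by rewrite tree_label_box // regionE //; case/andP: cT.
Qed.

(** The boxes of the region that are not tree edges become the crosses of the bottom pipe dream when
    moved down by one row. *)
Lemma card_tree : #|tree pi| + #|bottom_pd pi| = #|region pi|.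
Proof.
pose Tb : {set box n} := [set c : box n | treeP lam c.1 c.2].
have -> : #|tree pi| = #|Tb|.
  rewrite treeE /lset card_in_imset; first by apply: eq_card => c; rewrite [in RHS]in_set.
  move=> [c1 c2] [d1 d2] /= /andP[cR _] /andP[dR _] E; apply/eqP.
  have := label_eq n_gt0 lam0 lam_mono rho_lt kap_lt cR dR; rewrite E eqxx => /esym/andP[h1 h2].
  by rewrite xpair_eqE -!val_eqE /= h1 h2.
rewrite -(cardsID Tb (region pi)); congr (_ + _).
  apply: eq_card => c; rewrite in_setI regionE // [c \in Tb]in_set; apply/idP/andP => [h|[]//].
  by split=> //; case/andP: h.
apply/esym; have lt1 (c : box n) : c.2 < lam c.1.+1 -> c.1.+1 < n.
  by move=> h; rewrite ltnNge; apply/negP => /(lam_ge pi n_gt0) E; rewrite E in h.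
pose up (c : box n) : box n := (insubd c.1 c.1.+1, c.2).
have upE (c : box n) : c.2 < lam c.1.+1 -> (up c).1 = c.1.+1 :> nat.
  by move=> /lt1 h; rewrite /up /= insubdK.
have inD (c : box n) : (c \in region pi :\: Tb) = (c.2 < lam c.1.+1).
  rewrite in_setD regionE // [c \in Tb]in_set /treeP; case: c => a b /=.
  case: (ltnP b) => h /=; last by rewrite andbT andNb.
  rewrite andbF /= /reg; move: h; have := @lam_mono a; case: (posnP a) => [->|]; lia.
rewrite -(card_in_imset (f := up)); last first.
  move=> [c1 c2] [d1 d2]; rewrite !inD => hc hd E.
  have := upE _ hc; rewrite E upE // => -[/esym/val_inj /= ->].
  by have [_ ->] := E.
apply: eq_card => c; rewrite bottomE //; apply/imsetP/idP => [[d]|h].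
  by rewrite inD => h ->; rewrite upE.
have c0 : 0 < c.1 by case: (posnP c.1) h => // ->; rewrite lam0.
have pn : c.1.-1 < n by have := ltn_ord c.1; lia.
have h' : c.2 < lam (Ordinal pn).+1 by rewrite /= prednK.
exists (Ordinal pn, c.2); first by rewrite inD.
by case: c h c0 pn h' => c1 c2 /= h c0 pn h'; congr (_, _); apply: val_inj; rewrite [RHS]upE //= prednK.
Qed.

Lemma good_tree : good_forest (tree pi).
Proof.
have inR a b : treeP lam a b -> reg a b by case/andP.
have P e := lsetP n_gt0 lam0 lam_mono lam_lt kap rho e inR.
rewrite treeE; split.
- move=> i k /P[a [b [/inR r [-> ->]]]]; have [h1 h2] := reg_ok r.
  by rewrite kap_lt_rho.
- move=> i j k l ij jk kl /P[a [b [/andP[r1 t1] [Ei Ek]]]] /P[a' [b' [/andP[r2 t2] [Ej El]]]].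
  have [h1 h2] := reg_ok r1; have [h3 h4] := reg_ok r2.
  rewrite Ei Ej in ij; rewrite Ej Ek in jk; rewrite Ek El in kl.
  have bb : b < b'.
    rewrite ltnNge leq_eqVlt; apply/negP => /orP[/eqP E|/kap_lt-/(_ h2)]; last by lia.
    by rewrite E ltnn in ij.
  have aa : a' < a.
    rewrite ltnNge leq_eqVlt; apply/negP => /orP[/eqP E|/rho_lt-/(_ h3)]; last by lia.
    by rewrite E ltnn in kl.
  have : reg a b' by rewrite -kap_lt_rho.
  have := lam_le (isT : 0 < a'.+1) aa; have := @lam_mono a; rewrite /reg; lia.
- move=> i k /P[a [b [/andP[r1 t1] [Ei Ek]]]]; have [h1 h2] := reg_ok r1.
  have nreg a' b' : a < a' -> b < b' -> ~~ reg a' b'.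
    move=> aa bb; have := lam_le (isT : 0 < a.+1) aa; have := @lam_mono a'; rewrite /reg; lia.
  (* Edges under this one come from rows from [a] on and columns from [b] on. Those of later rows
     end at [rho a.+1] at the latest. Those of row [a] start after [kap b], and also after
     [rho a.+1], since their columns have no box in row [a.+1]. *)
  exists (if row_ok a.+1 then maxn (kap b) (rho a.+1) else kap b); split.
  + by rewrite Ei; case: ifP => _; rewrite ?leq_maxl.
  + by rewrite Ek; case: ifP => [h|_]; rewrite ?gtn_max ?rho_lt // ?kap_lt_rho // r1.
  move=> p q /P[a' [b' [/andP[r2 t2] [Ep Eq]]]] ne ip qk.
  have [h3 h4] := reg_ok r2; rewrite Ei Ep in ip; rewrite Eq Ek in qk.
  have bb : b <= b' by rewrite leqNgt; apply/negP => /kap_lt-/(_ h2); lia.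
  have aa : a <= a' by rewrite leqNgt; apply/negP => /rho_lt-/(_ h1); lia.
  move: aa; rewrite leq_eqVlt => /orP[/eqP E|aa]; last first.
    left; rewrite (row_ok_lt h3 aa) Eq leq_max; apply/orP; right.
    move: aa; rewrite leq_eqVlt => /orP[/eqP->//|aa].
    by apply/ltnW/rho_lt.
  have {}bb : b < b'.
    rewrite ltn_neqAle bb andbT; apply/eqP => E'; apply: ne.
    by rewrite Ep Eq Ei Ek E E'.
  right; rewrite Ep; case: ifP => [h|_]; last exact: kap_lt.
  rewrite gtn_max kap_lt //= ltnNge leq_eqVlt val_eqE kap_eq_rho // kap_lt_rho //.
  rewrite (negPf (nreg _ _ (ltnSn a) bb)) orbF; apply/negP => /andP[_ /eqP E'].
  by move: t1; rewrite -E'; lia.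
Qed.

End TreeLabels.

(** * Codimensions *)

Section LogSize.
Variables (n : nat) (ign : bool) (P : {set box n}).

Lemma size_trace_tile s c :
  size (trace_tile ign P s c).2 <= size s.2 + (c \in P).
Proof.
by case: s => [[h v] log]; rewrite /trace_tile; case: (c \in P) => /=; rewrite ?addn0 //; case: ifP => //= _; rewrite addn1.
Qed.

Lemma size_foldl_tile s cs :
  size (foldl (trace_tile ign P) s cs).2 <= size s.2 + count (mem P) cs.
Proof.
elim: cs s => [|c cs IH] s; first by rewrite addn0.
rewrite /= addnA; apply: leq_trans (IH _) _.
by rewrite leq_add2r size_trace_tile.
Qed.

Lemma size_trace_row s a :
  size (trace_row ign P s a).2 <= size s.2 + count (mem P) [seq (a, b) | b <- enum 'I_n].
Proof.
have := size_foldl_tile (Some a, s.1, s.2) [seq (a, b) | b <- enum 'I_n].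
by rewrite /trace_row; case: (foldl _ _ _) => [[h v] log].
Qed.

Lemma size_trace_log : size (trace ign P).2 <= #|P|.
Proof.
pose cs := [seq (a, b) | a <- rev (enum 'I_n), b <- enum 'I_n].
apply: (@leq_trans (count (mem P) cs)).
  rewrite /trace /cs; set s0 := (_, _); have -> : count (mem P) [seq (a, b) | a <- rev (enum 'I_n), b <- enum 'I_n]
    = size s0.2 + count (mem P) [seq (a, b) | a <- rev (enum 'I_n), b <- enum 'I_n] by [].
  elim: (rev _) s0 => [|a r IH] s0 /=; first by rewrite addn0.
  apply: leq_trans (IH _) _; rewrite count_cat addnA leq_add2r; exact: size_trace_row.
rewrite -size_filter cardE; apply: uniq_leq_size => [|c].
  rewrite filter_uniq // allpairs_uniq ?rev_uniq ?enum_uniq // => -[a b] [a' b'] _ _ //.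
by rewrite mem_filter mem_enum => /andP[].
Qed.

End LogSize.

Section Codim.
Variables (n : nat) (pi : 'S_n).
Hypotheses (n_gt0 : 0 < n) (pi_dom : one_dominant pi).
Local Notation lam := (lam pi).
Local Notation w := (perm_nat pi).
Local Notation pos := (perm_nat pi^-1%g).
Implicit Types P : {set box n}.

(** Every inversion of [pi] is logged, and every log entry takes a cross. The box [(a, b)] of the
    bottom pipe dream comes from the diagram box [(a, b.+1)], hence from the inversion between [a]
    and [w b.+1], which [f] records. *)
Lemma card_bottom_le P : P \in Pipes pi -> #|bottom_pd pi| <= #|P|.
Proof.
move=> PP; have := PP; rewrite PipesE => /andP[sP /forallP H].
have E i : i < n -> rows_done P n i = w i.
  by move=> i_n; have /eqP := H (Ordinal i_n); rewrite -perm_natE.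
have [log [[_ inv _ U] tE]] := traceE sP (or_introl (isT : true)).
apply: leq_trans (size_trace_log true P); rewrite tE /=.
pose f (c : box n) : {set strand n} := [set label n (w c.2.+1); label n c.1].
have D (c : box n) : c \in bottom_pd pi -> (c.2.+1 < pos c.1) && (c.1 < w c.2.+1).
  by rewrite bottomE // diagE.
have wn (c : box n) : c \in bottom_pd pi -> w c.2.+1 < n.
  by move=> /D/andP[h _]; apply: perm_nat_lt; have := pos_lt pi (ltn_ord c.1); lia.
rewrite -(card_in_imset (f := f)).
  rewrite -(card_uniqP U); apply: subset_leq_card; apply/subsetP => s /imsetP[c cB ->].
  have /andP[h1 h2] := D c cB; have pn := pos_lt pi (ltn_ord c.1).
  have := inv c.2.+1 (pos c.1) h1; rewrite !E ?(ltn_trans h1) // posK.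
  by rewrite h2 => -> //; apply: wn.
move=> c d cB dB; rewrite /f => /set2_label_eq; rewrite !ltn_ord !wn // => /(_ isT isT isT isT).
have /andP[h1 h2] := D c cB; have /andP[h3 h4] := D d dB.
case=> [[E1 E2]|]; last by lia.
have := congr1 pos E1; rewrite !wK => -[E3].
by case: c d {cB dB h1 h2 h3 h4 E1} E2 E3 => c1 c2 [d1 d2] /= /val_inj -> /val_inj ->.
Qed.

Lemma mem_nat_bottom (a : 'I_n) : mem_nat (row_set (bottom_pd pi) a) =1 (fun i => i < lam a).
Proof.
move=> i; have [i_n|n_i] := ltnP i n.
  by rewrite -[i]/(val (Ordinal i_n)) mem_nat_row_set bottomE.
rewrite mem_nat_ge //; apply/esym/negbTE; rewrite -leqNgt.
have [->//|/(lam_lt n_gt0)] := posnP (lam a); lia.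
Qed.

Lemma bottom_sub : bottom_pd pi \subset triangle n.
Proof.
apply/subsetP => c; rewrite bottomE // in_set => h.
have := lam_lt n_gt0 (leq_ltn_trans (leq0n _) h); lia.
Qed.

Lemma bottom_row_out (a : 'I_n) u :
  row_out a (mem_nat (row_set (bottom_pd pi) a)) u =1 row_out a (row_crosses (lam a) predT pred0) u.
Proof. by apply: eq_row_out => i; rewrite mem_nat_bottom /row_crosses orbF. Qed.

(** The bottom pipe dream makes the largest turn [c = lam a] in each row and has no ignored cross;
    no column gets settled on the way, and [L] remains everything. *)
Lemma bottom_state d : d < n ->
  exists D, state w pos lam (n - d) predT D (rows_done (bottom_pd pi) d).
Proof.
elim: d => [|d IH] dn.
  exists (mem_nat (set0 : {set 'I_n})); rewrite subn0.
  apply: state_ext (initial_state lam n_gt0 (wK pi) (@perm_nat_ge _ pi)) => // i.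
  rewrite /unsettled; have [//|i_n] := leqP n i.
  by rewrite -[i]/(val (Ordinal i_n)) mem_natE inE orbT.
have [D st] := IH (ltnW dn); have an : n - d.+1 < n by lia.
pose a : 'I_n := Ordinal an; have aE : n - d = a.+1 by rewrite /a /=; lia.
have a0 : 0 < a by rewrite /a /=; lia.
rewrite aE in st.
have none i : (pred0 : pred nat) i -> D i /\ lam a < i by [].
have st' := valid_state (wK pi) (@posK _ pi) (w0 n_gt0 pi_dom) (diagE n_gt0 pi_dom)
  (lam_mono n_gt0 pi_dom) st (c := lam a) (S := pred0) isT (leqnn _) none a0.
exists (next_D (lam a) D).
apply: state_ext st' => // [i|i].
  by rewrite /next_L /=; case: leqP.
by rewrite -bottom_row_out.
Qed.

Lemma bottom_in_Pipes : bottom_pd pi \in Pipes pi.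
Proof.
rewrite PipesE bottom_sub; apply/forallP => b; apply/eqP.
have n1 : n.-1 < n by lia.
have [D st] := bottom_state n1; have E : n - n.-1 = 1 by lia.
rewrite E in st; pose o : 'I_n := Ordinal n_gt0.
have -> : rows_done (bottom_pd pi) n = rows_done (bottom_pd pi) n.-1.+1 by rewrite prednK.
rewrite -perm_natE /= prednK // subnn.
rewrite -[0]/(o : nat) bottom_row_out.
by apply: (valid_final (wK pi) (@posK _ pi) (w0 n_gt0 pi_dom) (diagE n_gt0 pi_dom) st).
Qed.

(** Along its crosses a row carries only its own strand [a], which is smaller than all strands from
    below. *)
Lemma bottom_reduced : reduced_pd (bottom_pd pi).
Proof.
apply: reduced_all_real bottom_sub _ => a b; rewrite mem_nat_bottom => bl.
have [|_ ge _ _] := trace_sim bottom_sub (or_introl (isT : true)) (_ : n - a.+1 <= n).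
  exact: leq_subr.
have gt i : a < rows_done (bottom_pd pi) (n - a.+1) i by have := ge i; have := ltn_ord a; lia.
have -> : carry a (mem_nat (row_set (bottom_pd pi) a)) (rows_done (bottom_pd pi) (n - a.+1)) b = a.
  elim: b bl => // b IH bl; rewrite carryS IH ?(ltnW bl) // mem_nat_bottom (ltnW bl) gt //.
exact: gt.
Qed.

(** The largest facets belong to the pipe dreams with fewest crosses, and the bottom one is among
    them. So the codimension counts the crosses in excess of it. *)
Lemma codim_elbows P : P \in Pipes pi -> codimPD pi (elbows P) + #|bottom_pd pi| = #|P|.
Proof.
have card_elbows Q : Q \in Pipes pi -> #|elbows Q| + #|Q| = #|triangle n|.
  rewrite inE => /andP[/setIidPr sQ _].
  by rewrite /elbows -(cardsID Q (triangle n)) sQ addnC.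
move=> PP; have E : \max_(G in PD pi) #|G| = #|triangle n| - #|bottom_pd pi|.
  apply/eqP; rewrite eqn_leq; apply/andP; split.
    apply/bigmax_leqP => G; rewrite in_set => /exists_inP[Q QP /andP[_ /subset_leq_card le]].
    apply: leq_trans le _; have := card_elbows Q QP; have := card_bottom_le QP; lia.
  rewrite -(card_elbows _ bottom_in_Pipes) addnK.
  apply: (@leq_bigmax_cond _ (mem (PD pi)) (fun G : {set box n} => #|G|)).
  rewrite -[mem _ _]/(elbows (bottom_pd pi) \in PD pi) in_set.
  apply/exists_inP; exists (bottom_pd pi); first exact: bottom_in_Pipes.
  by rewrite bottom_reduced /=.
rewrite /codimPD E -(card_elbows _ PP); have := card_bottom_le PP; lia.
Qed.

End Codim.

(** * Evaluation *)

Local Open Scope ring_scope.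

Lemma mpolyX_set_mnm m (F : {set 'I_m * 'I_m}) :
  'X_[set_mnm F] = \prod_(e in F) 'X_(mxvec_index e.1 e.2) :> {mpoly {poly rat}[m * m]}.
Proof. by rewrite /set_mnm (big_morph _ (@mpolyXD _ _) (mpolyX0 _ _)). Qed.

Section EvalReduced.
Variables (n m : nat) (v : 'M[ratfun n]_m).

Definition rat_const : {rmorphism rat -> ratfun n} := (@tofrac {mpoly rat[n + n]}) \o @mpolyC (n + n) rat.

Definition eval_at_m1 (p : {mpoly {poly rat}[m * m]}) : ratfun n :=
  eval_sd v (map_mpoly (horner_eval (-1)) p).

Lemma eval_at_m1E p : eval_at_m1 p =
  mmap rat_const (fun k => mxvec v 0 k) (map_mpoly (horner_eval (-1)) p).
Proof. by []. Qed.

Lemma eval_at_m1_is_additive : zmod_morphism eval_at_m1.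
Proof. by move=> p q; rewrite !eval_at_m1E !raddfB. Qed.

HB.instance Definition _ := GRing.isZmodMorphism.Build _ _ eval_at_m1 eval_at_m1_is_additive.

Lemma eval_at_m1Z p : eval_at_m1 (@beta *: p) = - eval_at_m1 p.
Proof.
have E : horner_eval (-1) beta = -1 by rewrite /horner_eval /beta hornerX.
by rewrite !eval_at_m1E map_mpolyZ mmapZ -[X in rat_const X]/(horner_eval (-1) beta) E rmorphN1 mulN1r.
Qed.

Lemma eval_at_m1X (F : {set 'I_m * 'I_m}) : eval_at_m1 'X_[set_mnm F] = \prod_(e in F) v e.1 e.2.
Proof.
rewrite mpolyX_set_mnm eval_at_m1E !rmorph_prod /=.
by apply: eq_bigr => e _; rewrite map_mpolyX mmapX mmap1U mxvecE.
Qed.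

Lemma tree_monomialE (T : {set 'I_m * 'I_m}) : good_forest T -> tree_monomial T = 'X_[set_mnm T].
Proof.
case=> inc _ _; rewrite /tree_monomial mpolyX_set_mnm; apply: eq_bigl => -[i j] /=.
by case: (boolP (_ \in _)) => //= /inc.
Qed.

End EvalReduced.

Lemma weight_neq0 n (c : box n) : weight c != 0.
Proof.
apply/eqP => /(congr1 (fun p : {mpoly rat[n + n]} => p@_(U_(lshift n c.1)))).
rewrite mcoeff0 /weight /xvar /yvar mcoeffD mcoeffB -mpolyXD !mcoeffX eqxx.
rewrite eq_mnm1 eq_sym eq_lrshift.
have -> : (U_(lshift n c.1) + U_(rshift n c.2) == U_(lshift n c.1))%MM = false.
  by apply/eqP => /mnmP/(_ (rshift n c.2)); rewrite mnmDE !mnm1E eqxx eq_lrshift.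
by rewrite subr0 addr0 => /eqP; rewrite oner_eq0.
Qed.

(** * Matching the two sums *)

Section Final.
Variables (n : nat) (pi : 'S_n).
Hypotheses (n_gt0 : (0 < n)%N) (pi_dom : one_dominant pi).
Variable z : 'M[ratfun n]_(tree_size pi).
Local Notation lam := (lam pi).
Local Notation reg := (reg lam).
Local Notation w := (perm_nat pi).
Local Notation kap := (kap n_gt0 pi_dom).
Local Notation rho := (rho n_gt0 pi_dom).
Local Notation t c := (tofrac (weight c)).

Definition tree_var (e : 'I_(tree_size pi) * 'I_(tree_size pi)) : ratfun n :=
  - tree_subst z e.1 e.2.

(** The value 1 off the region lets the recursion run over all columns of a row. *)
Definition box_var a b : ratfun n := if reg a b then tree_var (kap b, rho a) else 1.

Lemma box_varE (c : box n) : c \in region pi -> box_var c.1 c.2 = - (t c)^-1.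
Proof.
move=> cR; rewrite /box_var -regionE // cR /tree_var mxE /=.
by rewrite phi_box.
Qed.

Lemma crf_Zsum back : eval_sd (tree_subst z) (Crf_beta (-1) back (tree pi)) =
  (-1) ^+ #|tree pi| * Zsum lam box_var n.-1 [set: 'I_n].
Proof.
pose Phi : {additive _ -> ratfun n} := eval_at_m1 (tree_subst z).
have PhiZ p : Phi (@beta *: p) = - Phi p by exact: eval_at_m1Z.
have PhiX F : Phi 'X_[set_mnm F] = \prod_(e in F) tree_subst z e.1 e.2.
  exact: eval_at_m1X.
have gT := good_tree n_gt0 pi_dom.
rewrite -[LHS]/(Phi (Crf back (tree pi))) /Crf (tree_monomialE gT).
rewrite -[LHS](signrMK #|tree pi|) -[X in _ * X]/(ev_tree Phi _ _); congr (_ * _).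
have -> : ev_tree Phi (if back then rev (enum 'I_(tree_size pi)) else enum 'I_(tree_size pi)) (tree pi)
   = ev_tree Phi (enum 'I_(tree_size pi)) (tree pi).
  case: back => //; apply: ev_rev gT; first exact: ev_tree_none.
  exact: ev_tree_step.
rewrite (treeE n_gt0 pi_dom) in gT *.
apply: (ev_front (yv := tree_var)) gT.
- by move=> F; rewrite (ev_tree_nil PhiX).
- exact: ev_tree_none.
- exact: ev_tree_step.
- exact: n_gt0.
- exact: lam0.
- exact: lam_mono.
- exact: lam_lt.
- exact: rho_lt.
- exact: kap_lt.
- exact: kap_lt_rho.
- exact: kap_eq_rho.
- by move=> a b; rewrite /box_var => ->.
- by move=> a b; rewrite /box_var => /negPf->.
Qed.

(** A cross contributes [- t], which cancels the factor [- 1 / t] of its box. In this form the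
    weight is defined for all sets of crosses, inside the region or not. The default 0 is met only
    for [a >= n]. *)
Definition row_weight a (C : {set 'I_n}) : ratfun n :=
  (\prod_(i in C) - (if insub a is Some a' then t (a', i) else 0)) * \prod_(i < n) box_var a i.

Lemma row_weightE a (C : {set 'I_n}) : (forall i : 'I_n, i \in C -> reg a i) ->
  row_weight a C = \prod_(i | i \notin C) box_var a i.
Proof.
move=> CR; rewrite /row_weight [X in _ * X](bigID (mem C)) /= mulrA -big_split /=.
rewrite big1 ?mul1r // => i /CR ri; have [an _] := reg_lt n_gt0 ri.
rewrite insubT /= -[a]/(val (Ordinal an)); have := @box_varE (Ordinal an, i).
rewrite regionE //= => ->//.
by rewrite mulrNN mulfV // tofrac_eq0 weight_neq0.
Qed.

Lemma prod_row_weight (P : {set box n}) : \prod_(a < n) row_weight a (row_set P a) =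
  (-1) ^+ #|P| * (\prod_(c in P) t c) * ((-1) ^+ #|region pi| * \prod_(c in region pi) (t c)^-1).
Proof.
rewrite big_split /= -!prodrN; congr (_ * _).
  rewrite [RHS](eq_bigl (fun c : box n => (c.1 == c.1) && (c.2 \in row_set P c.1))); last first.
    by move=> [a b]; rewrite eqxx mem_row_set.
  rewrite pair_big_dep /= big_mkcond [RHS]big_mkcond.
  by apply: eq_bigr => -[a b] _ /=; rewrite eqxx valK.
rewrite pair_big /= [RHS]big_mkcond; apply: eq_bigr => -[a b] _ /=.
case: ifP => [/box_varE //|]; rewrite regionE // /box_var /= => ->//.
Qed.

Lemma Zsum_pipes : Zsum lam box_var n.-1 [set: 'I_n] =
  \sum_(P in Pipes pi) \prod_(a < n) row_weight a (row_set P a).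
Proof.
rewrite -(completions_all n_gt0 (wK pi) (@posK _ pi) (w0 n_gt0 pi_dom) (@perm_nat_ge _ pi)
  (diagE n_gt0 pi_dom) (lam_mono n_gt0 pi_dom) (lam_lt n_gt0) (reg := reg) (wt := row_weight));
  last 3 first.
- by move=> a i h; rewrite /reg h.
- by move=> a i h; rewrite /reg h orbT.
- exact: row_weightE.
rewrite completions_sum //.
have up : upper_triangle n n = triangle n.
  by apply/setP => c; rewrite inE ltn_ord andbT.
have run0 (P : {set box n}) : run P n (addn^~ n) = rows_done P n.
  by rewrite -(run_rows_done P (leqnn n)) subnn.
rewrite up [LHS]big_mkcond [RHS]big_mkcond; apply: eq_bigr => P _.
rewrite PipesE run0; case: (P \subset _) => //=.
have -> : [forall i : 'I_n, rows_done P n i == w i] = [forall i : 'I_n, rows_done P n i == pi i].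
  by apply: eq_forallb => i; rewrite perm_natE.
by case: ifP; rewrite ?mulr1 ?mulr0.
Qed.

End Final.

Theorem theorem5p4 (n : nat) (pi : 'S_n) (n_gt0 : (0 < n)%N)
    (pi_dom : one_dominant pi) (back : bool)
    (z : 'M[ratfun n]_(tree_size pi)) :
  eval_sd (tree_subst z) (Crf_beta (-1) back (tree pi)) =
  (\prod_(c in region pi) (tofrac (weight c))^-1) * tofrac (double_grothendieck pi).
Proof.
rewrite (crf_Zsum n_gt0 pi_dom) Zsum_pipes raddf_sum !big_distrr /=; apply: eq_bigr => P PP.
rewrite prod_row_weight // rmorphM rmorphXn rmorphN1 rmorph_prod.
(* Signs come from the tree, the crosses of [P] and the region. By these two counts the signs of the
   tree and of the bottom pipe dream occur twice, and only that of the codimension is left. *)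
have cT := card_tree n_gt0 pi_dom; have cP := codim_elbows n_gt0 pi_dom PP.
rewrite -cT -cP !exprD.
have sq k : (-1) ^+ k * (-1) ^+ k = 1 :> ratfun n by rewrite -signr_odd -expr2 sqrr_sign.
have := sq #|tree pi|; have := sq #|bottom_pd pi|.
move: ((-1) ^+ #|tree pi|) ((-1) ^+ #|bottom_pd pi|) => e f ff ee.
rewrite /=; move: (\prod_(c in region pi) _) (\prod_(c in P) _) (_ ^+ codimPD _ _) => r p s.
transitivity (e * e * (f * f) * (s * p * r)); first by ring.
by rewrite ee ff !mul1r mulrC.
Qed.
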